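(* Let $k$ be an algebraically closed field and $n\ge1$. An $n$-tuple of integers $\mathbf g=(a_1,\dots,a_n)$ is the $g$-vector of a band semibrick over $\Lambda_n$ if and only if $\sum_{i=1}^{l}a_i\le 0$ for all $1\le l\le n-1$ and $\sum_{i=1}^n a_i=0$. In this case, there is a finite collection $(\mathscr F_i)_{1\le i\le r}$ of one-parameter families of band bricks (repetitions allowed), unique up to permutation, such that if $X=\bigoplus_{i=1}^r B_i$ where $B_i$ is chosen generically in $\mathscr F_i$, then $X$ is a band semibrick and $g(X)=\mathbf g$.
   Context: The algebra $\Lambda_n$. $Q_n$ is the quiver with vertices $1,\dots,n$ and, for each $1\le i\le n-1$, two arrows $\alpha_i,\beta_i:i+1\to i$. $R_n=\{\alpha_i\beta_{i+1},\ \beta_i\alpha_{i+1}:1\le i\le n-2\}$ (paths composed right to left), $\Lambda_n=kQ_n/(R_n)$; modules are finite-dimensional left modules, i.e. representations of $(Q_n,R_n)$. $P_i=\Lambda_n e_i$ is the indecomposable projective at vertex $i$. $g$-vectors. If $\bigoplus_i P_i^{\oplus b_i}\to\bigoplus_iP_i^{\oplus a_i}\to X\to0$ is the minimal projective presentation of $X$, then $g(X)=(a_1-b_1,\dots,a_n-b_n)$. Band modules. A walk $z=\gamma_r\cdots\gamma_1$ is a sequence of arrows or formal inverses of arrows (source and target exchanged), the target of $\gamma_s$ being the source of $\gamma_{s+1}$; $\gamma_s$ goes from $v_{s-1}$ to $v_s$. It is a string walk if $\gamma_{s+1}\ne\gamma_s^{-1}$ and neither $\gamma_{s+1}\gamma_s$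 nor its inverse is in $R_n$, for all $s$. A band walk is a string walk of positive length with $v_0=v_r$, not a proper power of another walk, all of whose powers are string walks. For a band walk $z$ and $\lambda\in k^\times$, $B_{z,1,\lambda}$ has basis $\epsilon_0,\dots,\epsilon_{r-1}$ with $\epsilon_s$ at vertex $v_s$ (and $\epsilon_r=\epsilon_0$); if $\gamma_s=\gamma$ is an arrow then $\gamma\epsilon_{s-1}=\epsilon_s$ for $s<r$ and $\gamma\epsilon_{r-1}=\lambda\epsilon_r$ for $s=r$; if $\gamma_s=\gamma^{-1}$ then $\gamma\epsilon_s=\epsilon_{s-1}$ for $s<r$ and $\gamma\epsilon_r=\lambda^{-1}\epsilon_{r-1}$ for $s=r$; all other actions of arrows are zero. More generally $B_{z,m,\lambda}$ ($m\ge1$) is obtained by replacing each $k\epsilon_s$ by $k^m$, the scalars $1$ by identity matrices and $\lambda$ (resp. $\lambda^{-1}$) by a Jordan block of size $m$ with that eigenvalue. The modules $B_{z,m,\lambda}$ are the band modules. A brick is a module with endomorphism ring $k$; a band brick is a band module that is a brick (it is then of the form $B_{z,1,\lambda}$). A band semibrick is a finite direct sum of band bricks with no non-zero morphisms between distinct summands; the empty sum (zero module) is allowed. A one-parameter family of band bricks is a family $\{B_{z,1,\lambda}:\lambda\in k^\times\}$ all of whose members are bricks; families are considered up to isomorphism of their members (i.e. $z$ up to cyclic conjugation and inversion). ''Chosen generically'' means that the tuple of parameters $(\lambda_1,\dots,\lambda_r)$ is taken in a suitable non-empty Zariski-open subset of $(k^\times)^r$. *)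

(* Defs.v *)
From HB Require Import structures.
From mathcomp Require Import all_boot all_order all_algebra.
From mathcomp Require Import mpoly.

Set Implicit Arguments.
Unset Strict Implicit.
Unset Printing Implicit Defensive.

Import GRing.Theory.
Local Open Scope ring_scope.

(* The vertex i + 1 of Q_n (i = 0, ..., n - 1) is the ordinal i : 'I_n.  The
   arrow (i, true) is alpha_(i+1) and (i, false) is beta_(i+1), both going from
   vertex i + 2 to vertex i + 1 in the 1-based numbering. *)
Definition arrow (n : nat) := ('I_n.-1 * bool)%type.

Lemma asrc_subproof n (i : 'I_n.-1) : (i.+1 < n)%N.
Proof. by case: n i => [|n] [i]. Qed.

Lemma atgt_subproof n (i : 'I_n.-1) : (i < n)%N.
Proof. exact: ltnW (asrc_subproof i). Qed.

Definition asrc n (a : arrow n) : 'I_n := Ordinal (asrc_subproof a.1).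
Definition atgt n (a : arrow n) : 'I_n := Ordinal (atgt_subproof a.1).

(* in_R a b: the path ab (b first, then a) is one of the relations
   alpha_i beta_(i+1), beta_i alpha_(i+1). *)
Definition in_R n (a b : arrow n) : bool :=
  (b.1 == a.1.+1 :> nat) && (a.2 != b.2).

(* A finite-dimensional left module over Lambda_n = kQ_n/(R_n), given by the
   action of the generators of the path algebra: the trivial paths e_i and the
   arrows.  The first four axioms are the defining relations of kQ_n; the
   representation of Q_n has the space e_i M at the vertex i. *)
Record lmodule (k : fieldType) (n : nat) := LModule {
  carrier :> vectType k;
  idem : 'I_n -> 'End(carrier);
  arr : arrow n -> 'End(carrier);
  idem_mul : forall i j,
    (idem i \o idem j)%VF = if i == j then idem i else 0;
  idem_sum : \sum_i idem i = \1%VF;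
  idem_tgt : forall a, (idem (atgt a) \o arr a)%VF = arr a;
  idem_src : forall a, (arr a \o idem (asrc a))%VF = arr a;
  arr_rel : forall a b, in_R a b -> (arr a \o arr b)%VF = 0
}.

Section Modules.
Variables (k : fieldType) (n : nat).
Implicit Types M N : lmodule k n.

Definition is_hom M N (f : 'Hom(M, N)) : Prop :=
  (forall i x, f (idem M i x) = idem N i (f x)) /\
  (forall a x, f (arr M a x) = arr N a (f x)).

Definition is_iso M N : Prop := exists f : 'Hom(M, N), is_hom f /\ bijective f.

Definition submodule M (U : {vspace M}) : Prop :=
  (forall i, (idem M i @: U <= U)%VS) /\ (forall a, (arr M a @: U <= U)%VS).

Definition superfluous M (K : {vspace M}) : Prop :=
  forall U : {vspace M}, submodule U -> (K + U)%VS = fullv -> U = fullv.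

(* k -> End(M) is bijective; in particular M is non-zero. *)
Definition brick M : Prop :=
  \dim {: M} <> 0%N /\
  (forall f : 'End(M), is_hom f -> exists c : k, f = c *: \1%VF).

End Modules.

Section ZeroModule.
Variables (k : fieldType) (n : nat).

Let zend : 'End('rV[k]_0) := 0.

Lemma zend_unique (f g : 'End('rV[k]_0)) : f = g.
Proof. by apply/lfunP => x; rewrite [RHS]thinmx0 [LHS]thinmx0. Qed.

Definition zero_module : lmodule k n :=
  @LModule k n 'rV[k]_0 (fun=> zend) (fun=> zend)
    (fun _ _ => zend_unique _ _) (zend_unique _ _)
    (fun _ => zend_unique _ _) (fun _ => zend_unique _ _)
    (fun _ _ _ => zend_unique _ _).

End ZeroModule.

Section PairEnd.
Variables (k : fieldType) (V W : vectType k).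

Definition pair_fun (f : 'End(V)) (g : 'End(W)) (x : V * W) : V * W :=
  (f x.1, g x.2).

Lemma pair_fun_linear f g : linear (pair_fun f g).
Proof. by move=> c x y; rewrite /pair_fun /= !linearP. Qed.

HB.instance Definition _ f g :=
  GRing.isLinear.Build k (V * W)%type (V * W)%type *:%R (pair_fun f g)
    (pair_fun_linear f g).

Definition pair_end f g : 'End((V * W)%type) := linfun (pair_fun f g).

Lemma pair_endE f g x : pair_end f g x = (f x.1, g x.2).
Proof. by rewrite lfunE. Qed.

End PairEnd.

Section DirectSum.
Variables (k : fieldType) (n : nat) (M N : lmodule k n).

Let di i := pair_end (idem M i) (idem N i).
Let da a := pair_end (arr M a) (arr N a).

Lemma dsum_idem_mul i j : (di i \o di j)%VF = if i == j then di i else 0.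
Proof.
apply/lfunP => x; rewrite comp_lfunE !pair_endE /= -!comp_lfunE !idem_mul.
by case: ifP => _; rewrite ?pair_endE // !zero_lfunE.
Qed.

Lemma dsum_idem_sum : \sum_i di i = \1%VF.
Proof.
apply/lfunP => x; rewrite sum_lfunE id_lfunE.
rewrite (eq_bigr (fun i => (idem M i x.1, idem N i x.2))); last first.
  by move=> i _; rewrite pair_endE.
rewrite [LHS]surjective_pairing [RHS]surjective_pairing.
rewrite (raddf_sum fst) (raddf_sum snd) /=.
by rewrite -!sum_lfunE !idem_sum !id_lfunE.
Qed.

Lemma dsum_idem_tgt a : (di (atgt a) \o da a)%VF = da a.
Proof.
by apply/lfunP => x; rewrite comp_lfunE !pair_endE /= -!comp_lfunE !idem_tgt.
Qed.

Lemma dsum_idem_src a : (da a \o di (asrc a))%VF = da a.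
Proof.
by apply/lfunP => x; rewrite comp_lfunE !pair_endE /= -!comp_lfunE !idem_src.
Qed.

Lemma dsum_arr_rel a b : in_R a b -> (da a \o da b)%VF = 0.
Proof.
move=> Rab; apply/lfunP => x.
by rewrite comp_lfunE !pair_endE /= -!comp_lfunE !arr_rel // !zero_lfunE.
Qed.

Definition dsum : lmodule k n :=
  LModule dsum_idem_mul dsum_idem_sum dsum_idem_tgt dsum_idem_src dsum_arr_rel.

End DirectSum.

Notation "\dsum_ ( i < r ) M" := (\big[@dsum _ _/@zero_module _ _]_(i < r) M)
  (at level 41, M at level 41, i, r at level 50).

(* P_i = Lambda_n e_i.  A path is the sequence of its arrows, the first arrow
   applied coming first; P_i has as a basis the paths starting at i which do
   not contain a relation, on which arrows act by composition.  Such a path has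
   fewer than n arrows, so the length bound n loses nothing. *)
Section Projective.
Variables (k : fieldType) (n : nat) (i : 'I_n).

Definition nonzero_path (p : seq (arrow n)) : bool :=
  (if p is a :: _ then asrc a == i else true) &&
  sorted (fun a b => (atgt a == asrc b) && ~~ in_R b a) p.

Definition path_end (p : seq (arrow n)) : 'I_n := last i [seq atgt a | a <- p].

Definition pbasis := {p : n.-bseq (arrow n) | nonzero_path p}.

Definition pcarrier : vectType k := {ffun pbasis -> k^o}.

Definition proj_idem_fun (j : 'I_n) (x : pcarrier) : pcarrier :=
  [ffun q : pbasis => if path_end (val q) == j then x q else 0].

Definition proj_arr_fun (a : arrow n) (x : pcarrier) : pcarrier :=
  [ffun q : pbasis =>
    \sum_(p : pbasis | val q == rcons (val p) a :> seq _) x p].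

Lemma proj_idem_linear j : linear (proj_idem_fun j).
Proof.
by move=> c x y; apply/ffunP => q; rewrite !ffunE; case: ifP; rewrite ?scaler0 ?addr0.
Qed.

Lemma proj_arr_linear a : linear (proj_arr_fun a).
Proof.
move=> c x y; apply/ffunP => q; rewrite !ffunE scaler_sumr -big_split /=.
by apply: eq_bigr => p _; rewrite !ffunE.
Qed.

HB.instance Definition _ j :=
  GRing.isLinear.Build k pcarrier pcarrier *:%R (proj_idem_fun j)
    (proj_idem_linear j).
HB.instance Definition _ a :=
  GRing.isLinear.Build k pcarrier pcarrier *:%R (proj_arr_fun a)
    (proj_arr_linear a).

Definition proj_idem j : 'End(pcarrier) := linfun (proj_idem_fun j).
Definition proj_arr a : 'End(pcarrier) := linfun (proj_arr_fun a).

Lemma proj_idemE j x q :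
  proj_idem j x q = if path_end (val q) == j then x q else 0.
Proof. by rewrite lfunE ffunE. Qed.

Lemma proj_arrE a x q :
  proj_arr a x q =
  \sum_(p : pbasis | val q == rcons (val p) a :> seq _) x p.
Proof. by rewrite lfunE ffunE. Qed.

Lemma proj_idem_mul j l :
  (proj_idem j \o proj_idem l)%VF = if j == l then proj_idem j else 0.
Proof.
apply/lfunP => x; rewrite comp_lfunE; apply/ffunP => q; rewrite !proj_idemE.
case: (eqVneq j l) => [<-|njl]; first by rewrite !proj_idemE; case: (_ == j).
rewrite zero_lfunE ffunE; case: eqP => // ->.
by rewrite (negPf njl).
Qed.

Lemma proj_idem_sum : \sum_j proj_idem j = \1%VF.
Proof.
apply/lfunP => x; rewrite sum_lfunE id_lfunE; apply/ffunP => q.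
rewrite sum_ffunE (bigD1 (path_end (val q))) //= proj_idemE eqxx big1 ?addr0 //.
by move=> j; rewrite proj_idemE eq_sym => /negPf->.
Qed.

Lemma path_end_rcons p a : path_end (rcons p a) = atgt a.
Proof. by rewrite /path_end map_rcons last_rcons. Qed.

Lemma nonzero_path_rcons p a :
  nonzero_path (rcons p a) ->
  path_end p = asrc a /\ forall b p', p = rcons p' b -> ~~ in_R a b.
Proof.
case/lastP: p => [|p b].
  by case/andP=> /eqP e _; split=> [|b [|c p']].
case/andP=> _; rewrite path_end_rcons -cats1 -cats1 -catA => /cat_sorted2[_].
rewrite /= andbT => /andP[/eqP-> nR]; split => // c p'.
by rewrite cats1 => /rcons_inj[_ <-].
Qed.

Lemma proj_idem_tgt a : (proj_idem (atgt a) \o proj_arr a)%VF = proj_arr a.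
Proof.
apply/lfunP => x; rewrite comp_lfunE; apply/ffunP => q.
rewrite proj_idemE; case: ifPn => // nq; rewrite proj_arrE big_pred0 // => p.
by apply: contraNF nq => /eqP e; rewrite e path_end_rcons.
Qed.

Lemma proj_idem_src a : (proj_arr a \o proj_idem (asrc a))%VF = proj_arr a.
Proof.
apply/lfunP => x; rewrite comp_lfunE; apply/ffunP => q.
rewrite !proj_arrE; apply: eq_bigr => p /eqP e; rewrite proj_idemE.
by have := valP q; rewrite e => /nonzero_path_rcons[-> _]; rewrite eqxx.
Qed.

Lemma proj_arr_rel a b : in_R a b -> (proj_arr a \o proj_arr b)%VF = 0.
Proof.
move=> Rab; apply/lfunP => x; rewrite comp_lfunE zero_lfunE; apply/ffunP => q.
rewrite proj_arrE ffunE big1 // => p /eqP e; rewrite proj_arrE big_pred0 // => p'.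
apply/eqP => e'; have := valP q; rewrite e => /nonzero_path_rcons[_ /(_ b)].
by move=> /(_ _ e'); rewrite Rab.
Qed.

Definition proj : lmodule k n :=
  LModule proj_idem_mul proj_idem_sum proj_idem_tgt proj_idem_src proj_arr_rel.

End Projective.

(* P -p-> X is a projective cover, and Q -f-> ker p is a projective cover. *)
Definition min_presentation (k : fieldType) n (Q P X : lmodule k n)
    (f : 'Hom(Q, P)) (p : 'Hom(P, X)) : Prop :=
  [/\ is_hom f, is_hom p, limg p = fullv, limg f = lker p
    & superfluous (lker p) /\ superfluous (lker f)].

Definition proj_sum (k : fieldType) n (a : 'I_n -> nat) : lmodule k n :=
  \dsum_(i < n) \dsum_(j < a i) proj k i.

Definition gvector (k : fieldType) n (X : lmodule k n) (g : 'I_n -> int) : Prop :=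
  exists a b : 'I_n -> nat,
    (exists (f : 'Hom(proj_sum k b, proj_sum k a)) (p : 'Hom(proj_sum k a, X)),
       min_presentation f p) /\
    (forall i, g i = (a i)%:Z - (b i)%:Z).

Section Walks.
Variable n : nat.

(* (a, true) is the arrow a and (a, false) is its formal inverse.  A walk
   gamma_r ... gamma_1 is the sequence [:: gamma_1; ...; gamma_r]. *)
Definition letter := (arrow n * bool)%type.

Definition lsrc (x : letter) : 'I_n := if x.2 then asrc x.1 else atgt x.1.
Definition ltgt (x : letter) : 'I_n := if x.2 then atgt x.1 else asrc x.1.
Definition linv (x : letter) : letter := (x.1, ~~ x.2).

Definition walk (z : seq letter) : bool :=
  sorted (fun x y => ltgt x == lsrc y) z.

(* yx or its formal inverse is a relation. *)
Definition letters_in_R (y x : letter) : bool :=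
  [&& x.2, y.2 & in_R y.1 x.1] || [&& ~~ x.2, ~~ y.2 & in_R x.1 y.1].

Definition string_walk (z : seq letter) : bool :=
  walk z && sorted (fun x y => (y != linv x) && ~~ letters_in_R y x) z.

Definition wpower (m : nat) (z : seq letter) : seq letter := flatten (nseq m z).

Definition band_walk (z : seq letter) : Prop :=
  [/\ string_walk z,
      if z is x :: z' then lsrc x = ltgt (last x z') else False,
      forall w m, walk w -> (1 < m)%N -> z <> wpower m w
    & forall m, string_walk (wpower m z)].

Record band := Band { band_seq :> seq letter; band_seqP : band_walk band_seq }.

(* gamma_(s+1), which goes from v_s to v_(s+1). *)
Definition blet (z : band) (s : 'I_(size z)) : letter := tnth (in_tuple z) s.

Definition bvertex (z : band) (s : 'I_(size z)) : 'I_n := lsrc (blet s).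

End Walks.

Definition jordan (k : fieldType) (m : nat) (c : k) : 'M[k]_m :=
  \matrix_(i, j) (c *+ (i == j) + ((j == i.+1 :> nat)%:R)).

(* The column s of x : 'M_(m, size z) is the component of x in the copy of k^m
   replacing k epsilon_s. *)
Section BandModule.
Variables (k : fieldType) (n : nat) (z : band n) (m : nat) (lambda : k).

Let r := size z.

Definition bscalar (c : k) (s : 'I_r) : 'M[k]_m :=
  if s.+1 == r then jordan m c else 1%:M.

Definition band_idem_fun (i : 'I_n) (x : 'M[k]_(m, r)) : 'M[k]_(m, r) :=
  \matrix_(t, s) (if bvertex s == i then x t s else 0).

(* x *m delta_mx s t is the column s of x moved to the position t; ordS is the
   cyclic successor, so that epsilon_r = epsilon_0. *)
Definition band_arr_fun (a : arrow n) (x : 'M[k]_(m, r)) : 'M[k]_(m, r) :=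
  \sum_(s < r)
    if blet s == (a, true) then bscalar lambda s *m x *m delta_mx s (ordS s)
    else if blet s == (a, false)
         then bscalar lambda^-1 s *m x *m delta_mx (ordS s) s
    else 0.

Lemma band_idem_linear i : linear (band_idem_fun i).
Proof.
by move=> c x y; apply/matrixP => t s; rewrite !mxE; case: ifP; rewrite ?mulr0 ?addr0.
Qed.

Lemma band_arr_linear a : linear (band_arr_fun a).
Proof.
move=> c x y; rewrite /band_arr_fun scaler_sumr -big_split /=.
apply: eq_bigr => s _; case: ifP => _; last case: ifP => _.
- by rewrite mulmxDr mulmxDl -scalemxAr -scalemxAl.
- by rewrite mulmxDr mulmxDl -scalemxAr -scalemxAl.
- by rewrite scaler0 addr0.
Qed.

HB.instance Definition _ i :=
  GRing.isLinear.Build k 'M[k]_(m, r) 'M[k]_(m, r) *:%R (band_idem_fun i)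
    (band_idem_linear i).
HB.instance Definition _ a :=
  GRing.isLinear.Build k 'M[k]_(m, r) 'M[k]_(m, r) *:%R (band_arr_fun a)
    (band_arr_linear a).

Definition band_idem i : 'End('M[k]_(m, r)) := linfun (band_idem_fun i).
Definition band_arr a : 'End('M[k]_(m, r)) := linfun (band_arr_fun a).

Lemma band_idemE i x t s :
  band_idem i x t s = if bvertex s == i then x t s else 0.
Proof. by rewrite lfunE /= mxE. Qed.

Lemma band_arrE a x : band_arr a x = band_arr_fun a x.
Proof. by rewrite lfunE. Qed.

Lemma band_cycle (s : 'I_r) :
  [/\ ltgt (blet s) = bvertex (ordS s), blet (ordS s) != linv (blet s)
    & ~~ letters_in_R (blet (ordS s)) (blet s)].
Proof.
have [_ _ _ /(_ 2)] := band_seqP z; rewrite /wpower /= cats0 /string_walk /walk.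
have r_gt0 : (0 < size z)%N := leq_ltn_trans (leq0n s) (ltn_ord s).
case/andP => /(sortedP (blet s))/(_ s) W /(sortedP (blet s))/(_ s) S.
have lt2 : (s.+1 < size (z ++ z))%N.
  by rewrite size_cat (leq_ltn_trans (ltn_ord s)) // -[ltnLHS]addn0 ltn_add2l.
have e1 : nth (blet s) (z ++ z) s = blet s.
  by rewrite nth_cat ltn_ord [RHS](tnth_nth (blet s)).
have e2 : nth (blet s) (z ++ z) s.+1 = blet (ordS s).
  rewrite nth_cat [RHS](tnth_nth (blet s)) /=; case: ltnP => h.
    by rewrite modn_small.
  have -> : s.+1 = size z by apply/eqP; rewrite eqn_leq h ltn_ord.
  by rewrite subnn modnn.
have := W lt2; have := S lt2; rewrite e1 e2 => /andP[n1 n2] /eqP w.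
by split.
Qed.

Lemma band_idem_mul i j :
  (band_idem i \o band_idem j)%VF = if i == j then band_idem i else 0.
Proof.
apply/lfunP => x; rewrite comp_lfunE; apply/matrixP => t s; rewrite !band_idemE.
case: (eqVneq i j) => [<-|nij]; first by rewrite !band_idemE; case: (_ == i).
by rewrite zero_lfunE mxE; case: eqP => // ->; rewrite (negPf nij).
Qed.

Lemma band_idem_sum : \sum_i band_idem i = \1%VF.
Proof.
apply/lfunP => x; rewrite sum_lfunE id_lfunE; apply/matrixP => t s.
rewrite summxE (bigD1 (bvertex s)) //= band_idemE eqxx big1 ?addr0 //.
by move=> i; rewrite band_idemE eq_sym => /negPf->.
Qed.

Lemma band_idem_delta i (y : 'M[k]_(m, r)) s t :
  band_idem i (y *m delta_mx s t) =
  if bvertex t == i then y *m delta_mx s t else 0.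
Proof.
apply/matrixP => u v; rewrite band_idemE !mxE.
have [->|nvt] := eqVneq v t; first by case: ifP => _; rewrite !mxE.
have z0 : \sum_j y u j * delta_mx s t j v = 0.
  by rewrite big1 // => j _; rewrite mxE (negPf nvt) andbF mulr0.
by rewrite z0 !(fun_if (fun A : 'M_(_, _) => A u v)) !mxE z0 !if_same.
Qed.

Lemma band_idem_tgt a : (band_idem (atgt a) \o band_arr a)%VF = band_arr a.
Proof.
apply/lfunP => x; rewrite comp_lfunE band_arrE linear_sum; apply: eq_bigr => s _.
have [e1 _ _] := band_cycle s.
case: eqP => [e|_] /=; first by rewrite band_idem_delta -e1 e eqxx.
case: eqP => [e|_]; last by rewrite linear0.
by rewrite band_idem_delta /bvertex e eqxx.
Qed.

Lemma delta_band_idem i (y : 'M[k]_m) (x : 'M[k]_(m, r)) (s t : 'I_r) :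
  y *m band_idem i x *m delta_mx s t =
  if bvertex s == i then y *m x *m delta_mx s t else 0.
Proof.
rewrite -!mulmxA.
have -> : band_idem i x *m (delta_mx s t : 'M[k]_r) =
          if bvertex s == i then x *m delta_mx s t else 0 :> 'M[k]_(m, r).
  apply/matrixP => u v; rewrite mxE (bigD1 s) //= big1 ?addr0; last first.
    by move=> j /negPf js; rewrite mxE js mulr0.
  rewrite band_idemE; case: ifP => _; last by rewrite mul0r mxE.
  rewrite [RHS]mxE (bigD1 s) //= big1 ?addr0 // => j /negPf js.
  by rewrite mxE js mulr0.
by case: ifP => _; rewrite ?mulmx0.
Qed.

Lemma band_idem_src a : (band_arr a \o band_idem (asrc a))%VF = band_arr a.
Proof.
apply/lfunP => x; rewrite comp_lfunE !band_arrE; apply: eq_bigr => s _.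
have [e1 _ _] := band_cycle s.
case: eqP => [e|_]; first by rewrite delta_band_idem /bvertex e eqxx.
case: eqP => [e|//].
by rewrite delta_band_idem -e1 e eqxx.
Qed.

Lemma band_arr_rel a b : in_R a b -> (band_arr a \o band_arr b)%VF = 0.
Proof.
move=> Rab; apply/lfunP => x; rewrite comp_lfunE zero_lfunE !band_arrE.
have dd (A B : 'M[k]_m) s t u v : t != u ->
    A *m (B *m x *m delta_mx s t) *m delta_mx u v = 0 :> 'M[k]_(m, r).
  by move=> tu; rewrite -!mulmxA mul_delta_mx_0 // !mulmx0.
have nab : a != b.
  by apply: contraTneq Rab => ->; rewrite /in_R eqxx andbF.
rewrite /band_arr_fun; apply: big1 => s _.
have [_ _ nRs] := band_cycle s.
case: eqP => [es|_]; last case: eqP => [es|_] //.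
  rewrite mulmx_sumr mulmx_suml big1 // => t _.
  have [_ _ nRt] := band_cycle t.
  case: eqP => [et|_]; last case: eqP => [et|_]; last by rewrite mulmx0 mul0mx.
    apply: dd; apply: contraNneq nRt => e.
    by rewrite e es et /letters_in_R /= Rab.
  by apply: dd; apply: contra_neq nab => e; move: es; rewrite -e et => -[].
rewrite mulmx_sumr mulmx_suml big1 // => t _.
case: eqP => [et|_]; last case: eqP => [et|_]; last by rewrite mulmx0 mul0mx.
  apply: dd; apply: contra_neq nab => /ordS_inj e.
  by move: es; rewrite -e et => -[].
apply: dd; apply: contraNneq nRs => <-.
by rewrite es et /letters_in_R /= Rab.
Qed.

(* B_{z,m,lambda}; it is only meaningful for m > 0 and lambda != 0. *)
Definition band_module : lmodule k n :=
  LModule band_idem_mul band_idem_sum band_idem_tgt band_idem_src band_arr_rel.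

End BandModule.

Section Bricks.
Variables (k : fieldType) (n : nat).

Definition band_brick (B : lmodule k n) : Prop :=
  brick B /\
  exists (z : band n) (m : nat) (lambda : k),
    [/\ (0 < m)%N, lambda != 0 & is_iso B (band_module z m lambda)].

Definition band_semibrick (X : lmodule k n) : Prop :=
  exists (r : nat) (B : 'I_r -> lmodule k n),
    [/\ forall i, band_brick (B i),
        forall i j, i != j -> forall f : 'Hom(B i, B j), is_hom f -> f = 0
      & is_iso X (\dsum_(i < r) B i)].

(* The one-parameter family {B_{z,1,lambda} : lambda <> 0} is represented
   by z. *)
Definition brick_family (z : band n) : Prop :=
  forall lambda : k, lambda != 0 -> brick (band_module z 1 lambda).

Definition same_family (z w : band n) : Prop :=
  (forall lambda : k, lambda != 0 -> exists2 mu : k, mu != 0 &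
     is_iso (band_module z 1 lambda) (band_module w 1 mu)) /\
  (forall mu : k, mu != 0 -> exists2 lambda : k, lambda != 0 &
     is_iso (band_module w 1 mu) (band_module z 1 lambda)).

End Bricks.

Definition torus (k : fieldType) r (x : 'I_r -> k) : Prop := forall i, x i != 0.

(* Zariski-open subsets of (k \ 0)^r; the Laurent monomials being invertible on
   the torus, polynomials suffice to define its closed subsets. *)
Definition zariski_open (k : fieldType) r (U : ('I_r -> k) -> Prop) : Prop :=
  exists S : {mpoly k[r]} -> Prop,
    forall x, U x <-> torus x /\ exists2 p, S p & p.@[x] != 0.

Definition generically (k : fieldType) r (Pr : ('I_r -> k) -> Prop) : Prop :=
  exists U : ('I_r -> k) -> Prop,
    [/\ zariski_open U, (exists x, U x) & forall x, U x -> Pr x].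

Definition generic_decomposition (k : fieldType) n (g : 'I_n -> int)
    r (F : 'I_r -> band n) : Prop :=
  (forall i, brick_family k (F i)) /\
  generically (fun lambda : 'I_r -> k =>
    let X := \dsum_(i < r) band_module (F i) 1 (lambda i) in
    band_semibrick X /\ gvector X g).

(* Main.v *)
Require Import Defs.
From HB Require Import structures.
From mathcomp Require Import all_boot all_order all_algebra.
From mathcomp Require Import mpoly zify.

Set Implicit Arguments.
Unset Strict Implicit.
Unset Printing Implicit Defensive.

Import Order.TTheory GRing.Theory Num.Theory.
Local Open Scope ring_scope.

(* Up to reversal, a band descends along alpha and ascends along beta, so it is a
   cyclic word in these two letters with a starting vertex.  Its module has a
   minimal presentation by the projectives over its peaks and troughs; hence the
   sum of the first l entries of the g-vector is minus the number of descents
   from vertex l + 1 to vertex l.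

   If beta u alpha occurs in one band and alpha u beta in another (or the same)
   one, at the same place, then the common stretch u carries a non-zero morphism;
   conversely, away from equal parameters every morphism between bands arises in
   this way.  A generic sum is therefore a semibrick exactly if the collection of
   bands is uncrossed: for each u at most one of these two words occurs.

   Uniqueness: the numbers of occurrences of x u and of u y leave one degree of
   freedom for those of the four words x u y, which is removed by the vanishing
   of one of two numbers.  So all word counts follow from g by induction on the
   length, and they determine the bands up to rotation.

   Existence: put on the edge below vertex l + 1 as many levels as g prescribes.
   A strand keeps its level while it can and otherwise turns, exchanging alpha
   with beta and reversing the order of the levels.  The orbits of this rule are
   the required bands; comparing levels shows that they are primitive and
   uncrossed. *)

(** The modules enter only through two operators, the sum of all alphas and that of all betas, which
    annihilate each other. A non-zero coefficient of a morphism spreads along a common stretch;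
    forwards it can stop only where the source strand goes down and the target strand up, backwards
    only where the source came up and the target came down. This is why crossings are the exact
    obstruction.

    A semibrick is given only up to isomorphism, so its summands must be compared with the given
    ones. Commutativity of its endomorphism ring does this in place of a Krull-Schmidt theorem.

    Turning has to reverse the levels for the following reason. Of two strands on the same edge, the
    one more inclined to go down is the one of smaller level on an alpha-edge, but of larger level
    on a beta-edge. The reversal makes this preference invariant, so that strands part only in the
    permitted way. *)

Lemma lfun_of_linear (k : fieldType) (V W : vectType k) (f : V -> W) :
  linear f -> exists g : 'Hom(V, W), forall x, g x = f x.
Proof.
move=> lf; pose F := GRing.isLinear.Build k V W *:%R f lf.
pose fl : {linear V -> W} := HB.pack f F.
by exists (linfun fl) => x; rewrite lfunE.
Qed.

(** In each fibre, elements of equal rank in the two enumerations are matched. This turns equal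
    numbers of bands with a given invariant into a bijection of collections. *)
Lemma fibre_bij (I J : finType) (C : eqType) (u : I -> C) (v : J -> C) :
  (forall c, #|[pred i | u i == c]| = #|[pred j | v j == c]|) ->
  exists2 h : I -> J, bijective h & forall i, v (h i) = u i.
Proof.
move=> E.
have rank_lt i : (index i (enum [pred i' | u i' == u i]) <
                  size (enum [pred j | v j == u i]))%N.
  by rewrite -cardE -E cardE index_mem mem_enum inE.
have Jx (i : I) : J.
  have := rank_lt i; case: (enum [pred j | v j == u i]) => [|j _ _]; first by [].
  exact: j.
pose h i := nth (Jx i) (enum [pred j | v j == u i]) (index i (enum [pred i' | u i' == u i])).
have hv i : v (h i) = u i.
  by have := mem_nth (Jx i) (rank_lt i); rewrite mem_enum inE => /eqP.
have h_inj : injective h.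
  move=> i i' e; have ui : u i = u i' by rewrite -!hv e.
  move: e; rewrite /h -ui (set_nth_default (Jx i)) -?ui //; last first.
    by have := rank_lt i'; rewrite -ui.
  move/eqP; rewrite nth_uniq ?enum_uniq ?rank_lt //; last first.
    by have := rank_lt i'; rewrite -ui.
  move=> /eqP e; have := nth_index i (s := enum [pred i'0 | u i'0 == u i]) (x := i).
  rewrite mem_enum inE eqxx e => /(_ isT) <-.
  by rewrite nth_index // mem_enum inE ui.
exists h => //; apply: inj_card_bij => //.
have cI (K : finType) (w : K -> C) (s : seq C) : uniq s -> (forall i, w i \in s) ->
    #|K| = \sum_(c <- s) #|[pred i | w i == c]|.
  move=> us ws; rewrite -sum1_card.
  under [RHS]eq_bigr => c _ do rewrite -sum1_card.
  rewrite (exchange_big_dep predT) //=; apply: eq_bigr => i _.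
  rewrite -big_filter; rewrite (eq_filter (a2 := pred1 (w i))).
    by rewrite filter_pred1_uniq // big_seq1.
  by move=> c; rewrite /= inE eq_sym.
(* [C] may be infinite, so both cardinals are summed over the finitely many values taken. *)
pose s := undup ([seq u i | i : I] ++ [seq v j | j : J]).
rewrite (cI _ u s) ?(cI _ v s) ?undup_uniq //.
- by apply: eq_leq; apply: eq_bigr.
- by move=> j; rewrite mem_undup mem_cat (map_f v) ?orbT // mem_enum.
- by move=> i; rewrite mem_undup mem_cat (map_f u) // mem_enum.
Qed.

Lemma card_tag n (c : 'I_n -> nat) (j : 'I_n) :
  #|[pred t : {l : 'I_n & 'I_(c l)} | tag t == j]| = c j.
Proof.
rewrite -sum1_card; transitivity (\sum_(l < n | l == j) \sum_(m < c l | true) 1)%N.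
  by rewrite sig_big_dep; apply: eq_bigl => t; rewrite inE andbT.
by rewrite big_pred1_eq sum1_card card_ord.
Qed.

(** * Modules through idempotents and two colour operators *)

Section Operators.
Variables (k : fieldType) (n : nat).
Implicit Types M N L : lmodule k n.

Lemma idem_idem M i j x : idem M i (idem M j x) = if i == j then idem M i x else 0.
Proof. by rewrite -comp_lfunE idem_mul; case: eqP => // _; rewrite zero_lfunE. Qed.

Lemma idem_arr M j a x : idem M j (arr M a x) = if j == atgt a then arr M a x else 0.
Proof.
rewrite -(idem_tgt M a) comp_lfunE idem_idem; case: eqP => [->|] //.
Qed.

Lemma arr_idem M j a x : arr M a (idem M j x) = if asrc a == j then arr M a x else 0.
Proof.
by rewrite -(idem_src M a) !comp_lfunE idem_idem; case: eqP => // _; rewrite linear0.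
Qed.

Lemma idem_decomp M x : x = \sum_i idem M i x.
Proof. by rewrite -sum_lfunE idem_sum id_lfunE. Qed.

(** The sum of all alphas ([true]) or of all betas ([false]). With the idempotents it recovers each
    arrow, see [arr_colour], so morphisms can be tested on two operators without vertex indices. *)
Definition colour M (c : bool) : 'End(M) := \sum_i arr M (i, c).

Lemma colourE M c x : colour M c x = \sum_i arr M (i, c) x.
Proof. by rewrite sum_lfunE. Qed.

Lemma arr_colour M a x : arr M a x = idem M (atgt a) (colour M a.2 x).
Proof.
case: a => i c; rewrite colourE linear_sum (bigD1 i) //= idem_arr eqxx.
rewrite big1 ?addr0 // => j ji; rewrite idem_arr; case: eqP => // e.
by case/eqP: ji; apply: val_inj; move/(congr1 val): e.
Qed.

(** Two arrows of different colours either form a relation or have no common vertex at which to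
    compose. *)
Lemma colour_colour M c c' x : c != c' -> colour M c (colour M c' x) = 0.
Proof.
move=> cc'; rewrite colourE big1 // => i _; rewrite colourE linear_sum big1 // => j _ /=.
have [e|ne] := eqVneq (j : nat) i.+1.
  by rewrite -comp_lfunE arr_rel ?zero_lfunE // /in_R /= e eqxx.
rewrite -(idem_tgt M (j, c')) comp_lfunE arr_idem; case: eqP => // e.
by case/eqP: ne; move/(congr1 val): e.
Qed.

Lemma colour_homog M c (i j : 'I_n) x : i = j.+1 :> nat -> idem M i x = x ->
  idem M j (colour M c x) = colour M c x.
Proof.
move=> ij <-; rewrite colourE linear_sum; apply: eq_bigr => l _.
rewrite /= arr_idem; case: eqP => [e|_]; last by rewrite linear0.
rewrite idem_arr; case: eqP => // -[]; apply: val_inj => /=.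
by move/(congr1 val): e => /=; rewrite ij => -[].
Qed.

Lemma homP M N (f : 'Hom(M, N)) :
  (forall i x, f (idem M i x) = idem N i (f x)) ->
  (forall c x, f (colour M c x) = colour N c (f x)) -> is_hom f.
Proof. by move=> fi fc; split=> // a x; rewrite !arr_colour fi fc. Qed.

Lemma hom_colour M N (f : 'Hom(M, N)) : is_hom f ->
  forall c x, f (colour M c x) = colour N c (f x).
Proof.
case=> _ fa c x; rewrite !colourE linear_sum; apply: eq_bigr => i _; exact: fa.
Qed.

Lemma hom_comp M N L (f : 'Hom(N, L)) (g : 'Hom(M, N)) :
  is_hom f -> is_hom g -> is_hom (f \o g)%VF.
Proof.
by move=> [f1 f2] [g1 g2]; split=> [i|a] x; rewrite !comp_lfunE ?g1 ?f1 ?g2 ?f2.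
Qed.

Lemma hom0 M N : is_hom (0 : 'Hom(M, N)).
Proof. by split=> *; rewrite !zero_lfunE linear0. Qed.

Lemma hom1 M : is_hom (\1%VF : 'End(M)).
Proof. by split=> *; rewrite !id_lfunE. Qed.

Lemma iso_inv M N : is_iso M N -> exists (f : 'Hom(M, N)) (g : 'Hom(N, M)),
  [/\ is_hom f, is_hom g, cancel f g & cancel g f].
Proof.
case=> f [hf [g fK gK]].
have lg : linear g.
  by move=> c x y; apply: (can_inj fK); rewrite linearP /= !gK -{1}[x]gK -{1}[y]gK !gK.
have [g' g'E] := lfun_of_linear lg; exists f, g'; split=> //.
- split=> [i x|a x]; rewrite !g'E; apply: (can_inj fK);
  by rewrite gK ?(hf.1) ?(hf.2) gK.
- by move=> x; rewrite g'E fK.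
- by move=> x; rewrite g'E gK.
Qed.

Lemma iso_refl M : is_iso M M.
Proof. by exists \1%VF; split; [exact: hom1 | exists id => x; rewrite id_lfunE]. Qed.

Lemma iso_sym M N : is_iso M N -> is_iso N M.
Proof. by case/iso_inv=> f [g [hf hg fK gK]]; exists g; split=> //; exists f. Qed.

(** A predicate instead of a subspace, so that it can serve as the motive of the induction on
    generators [free_ind]. *)
Definition subrep M (S : M -> Prop) : Prop :=
  [/\ S 0, forall a y1 y2, S y1 -> S y2 -> S (a *: y1 + y2),
      forall i y, S y -> S (idem M i y) & forall c y, S y -> S (colour M c y)].

Lemma limg_submodule M N (f : 'Hom(M, N)) : is_hom f -> submodule (limg f).
Proof.
move=> [f1 f2]; split=> [i|a]; apply/subvP=> _ /memv_imgP[_ /memv_imgP[x _ ->] ->].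
  by rewrite -f1 memv_img ?memvf.
by rewrite -f2 memv_img ?memvf.
Qed.

Definition in_rad M (x : M) : Prop :=
  exists y : arrow n -> M, x = \sum_a arr M a (y a).

Lemma colour_in_rad M c x : in_rad (colour M c x).
Proof.
exists (fun a => if a.2 == c then x else 0); rewrite colourE.
transitivity (\sum_i \sum_d if d == c then arr M (i, d) x else 0).
  apply: eq_bigr => i _; rewrite (bigD1 c) //= eqxx big1 ?addr0 // => d /negPf dc.
  by rewrite dc.
rewrite pair_bigA; apply: eq_bigr => -[i d] _ /=.
by case: ifP => // _; rewrite linear0.
Qed.

Lemma in_rad_subrep M : subrep (@in_rad M).
Proof.
split.
- by exists (fun=> 0); rewrite big1 // => a _; rewrite linear0.
- move=> c _ _ [y1 ->] [y2 ->]; exists (fun a => c *: y1 a + y2 a).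
  by rewrite scaler_sumr -big_split; apply: eq_bigr => a _; rewrite linearP.
- move=> i _ [y ->]; exists (fun a => if i == atgt a then y a else 0).
  rewrite linear_sum; apply: eq_bigr => a _ /=; rewrite idem_arr.
  by case: ifP => // _; rewrite linear0.
- by move=> c y _; apply: colour_in_rad.
Qed.

(* Nakayama: e_i M lies in U as soon as the e_j M with j > i do. *)
Lemma rad_superfluous M (K : {vspace M}) :
  (forall x, x \in K -> in_rad x) -> superfluous K.
Proof.
move=> KR U [Ui Ua] KU.
have H m : forall (i : 'I_n) x, (n - i <= m)%N -> idem M i x \in U.
  elim: m => [|m IH] i x.
    by rewrite leqn0 subn_eq0 leqNgt ltn_ord.
  move=> im; have: x \in (K + U)%VS by rewrite KU memvf.
  case/memv_addP=> _ /KR[y ->] [u uU ->]; rewrite linearD memvD //; last first.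
    by apply: (subvP (Ui i)); rewrite memv_img.
  rewrite linear_sum memv_suml // => a _ /=; rewrite idem_arr.
  case: eqP => [e|_]; last exact: mem0v.
  rewrite -(idem_src M a) comp_lfunE; apply: (subvP (Ua a)); rewrite memv_img // IH //.
  by rewrite /= leq_subLR; move: im; rewrite leq_subLR e /= addSnnS.
apply/vspaceP => x; rewrite memvf [x]idem_decomp memv_suml // => i _.
exact: H (leqnn _).
Qed.

End Operators.

(** * Free families of generators *)

(** The universal property of the direct sum of the projectives at the vertices [v c], with
    generators [x c]. The path basis is not looked at again once [free_proj] is proved. *)
Record free_on (k : fieldType) n (M : lmodule k n) (I : finType) (v : I -> 'I_n)
    (x : I -> M) : Prop := FreeOn {
  free_homog : forall c, idem M (v c) (x c) = x c;
  free_ind : forall S : M -> Prop, subrep S -> (forall c, S (x c)) -> forall y, S y;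
  free_lift : forall (N : lmodule k n) (y : I -> N),
    (forall c, idem N (v c) (y c) = y c) ->
    exists f : 'Hom(M, N), is_hom f /\ forall c, f (x c) = y c }.

Section FreeProj.
Variables (k : fieldType) (n : nat) (i : 'I_n).

Implicit Type N : lmodule k n.

Let path_basis (q : pbasis i) : pcarrier k i := [ffun p => (p == q)%:R].

Definition path_act (N : lmodule k n) (p : seq (arrow n)) (y : N) : N :=
  foldl (fun y a => arr N a y : N) y p.

Lemma path_act_rcons N p a (y : N) :
  path_act (rcons p a) y = arr N a (path_act p y).
Proof. by rewrite /path_act -cats1 foldl_cat. Qed.

Lemma nonzero_path_belast p (a : arrow n) :
  nonzero_path i (rcons p a) -> nonzero_path i p.
Proof.
rewrite /nonzero_path; case: p => [//|b p] /=.
by rewrite rcons_path => /andP[-> /andP[-> _]].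
Qed.

Lemma path_act_homog N p (y : N) : nonzero_path i p -> idem N i y = y ->
  idem N (path_end i p) (path_act p y) = path_act p y.
Proof.
case/lastP: p => [//|p a] np yi.
by rewrite path_end_rcons path_act_rcons idem_arr eqxx.
Qed.

(** Each arrow lowers the vertex by one; this bounds the length of a path that is prolonged by an
    arrow. *)
Lemma path_size p : nonzero_path i p -> (size p + path_end i p = i)%N.
Proof.
elim/last_ind: p => [//|p a IH] np; have /nonzero_path_rcons[e _] := np.
have := IH (nonzero_path_belast np); rewrite e path_end_rcons size_rcons /= => <-.
by rewrite addSnnS.
Qed.

(** A prolongation is missing from the path basis because its ends do not fit or because it contains
    a relation. A module kills it in both cases, so the lift in [free_proj] commutes with the
    arrows. *)
Lemma path_act_rcons0 N p a (y : N) : nonzero_path i p -> idem N i y = y ->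
  ~~ nonzero_path i (rcons p a) -> arr N a (path_act p y) = 0.
Proof.
move=> np yi nr; have [e|ne] := eqVneq (asrc a) (path_end i p); last first.
  by rewrite -(path_act_homog np yi) arr_idem (negPf ne).
case/lastP: p => [|p b] in np nr e *.
  by rewrite /nonzero_path /= e eqxx in nr.
rewrite path_act_rcons -comp_lfunE arr_rel ?zero_lfunE //.
apply: contraNT nr => nR; move: np; rewrite /nonzero_path.
rewrite path_end_rcons in e.
case: p => [|c p] /=; first by move=> /andP[-> _]; rewrite e eqxx nR.
rewrite !rcons_path !last_rcons /= => /andP[-> /andP[-> ->]] /=.
by rewrite e eqxx nR.
Qed.

Lemma proj_decomp (x : proj k i) : x = \sum_p (x : pcarrier k i) p *: path_basis p.
Proof.
apply/ffunP => q; rewrite sum_ffunE (bigD1 q) //= big1 ?addr0.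
  by rewrite !ffunE eqxx [_ *: _]mulr1.
by move=> p /negPf pq; rewrite !ffunE eq_sym pq [_ *: _]mulr0.
Qed.

Lemma free_proj : exists x : proj k i, free_on (fun _ : unit => i) (fun=> x).
Proof.
have b0 : nonzero_path i (val ([bseq] : n.-bseq (arrow n))) by [].
pose p0 : pbasis i := exist _ ([bseq] : n.-bseq (arrow n)) b0.
pose x0 := path_basis p0.
exists (x0 : proj k i); split.
- move=> _; apply/ffunP => q; rewrite proj_idemE !ffunE.
  by case: (eqVneq q p0) => [->|_]; rewrite /path_end /= ?eqxx ?if_same.
- move=> S [S0 Sl Si Sc] Sx y.
  have Sb m : forall q : pbasis i, size (val q) = m -> S (path_basis q).
    elim: m => [|m IH] q.
      move/size0nil => q0; have -> : path_basis q = x0; last exact: Sx.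
      by apply: congr1; apply: val_inj; apply: val_inj; rewrite /= q0.
    move=> sq; have [p [a e]] : exists p a, val q = rcons p a :> seq _.
      by case/lastP: (val q : seq _) sq => [//|p a]; exists p, a.
    have nq := valP q; rewrite e in nq.
    have pn : (size p <= n)%N.
      by apply: leq_trans (size_bseq (val q)); rewrite e size_rcons.
    pose p' : pbasis i := exist _ (Bseq pn) (nonzero_path_belast nq).
    have -> : path_basis q = arr (proj k i) a (path_basis p').
      apply/ffunP => q'; rewrite proj_arrE ffunE.
      case: eqP => [->|ne].
        rewrite (bigD1 p') /=; last by rewrite e.
        rewrite big1 ?addr0 ?ffunE ?eqxx // => p2 /andP[_ /negPf h].
        by rewrite ffunE h.
      rewrite big1 // => p2 /eqP e3; rewrite ffunE; case: eqP => // e2.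
      by case: ne; do 2!apply: val_inj => /=; rewrite e3 e2 e.
    rewrite arr_colour; apply/Si/Sc/IH.
    by move: sq; rewrite e size_rcons => -[].
  rewrite [y]proj_decomp; elim/big_ind: _ => [//|u v Su Sv|p _].
    by rewrite -[u]scale1r; apply: Sl.
  by rewrite -[_ *: _]addr0; apply: Sl => //; apply: Sb (erefl _).
- move=> N y /(_ tt) yi.
  have lf : linear (fun x : proj k i =>
      \sum_(p : pbasis i) (x : pcarrier k i) p *: path_act (val p) (y tt)).
    move=> c u v; rewrite scaler_sumr -big_split; apply: eq_bigr => p _ /=.
    by rewrite !ffunE scalerDl scalerA.
  have [f fE] := lfun_of_linear lf; exists f; split; last first.
    case; rewrite fE (bigD1 p0) //= big1 ?addr0.
      by rewrite ffunE eqxx scale1r.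
    by move=> p /negPf h; rewrite ffunE h scale0r.
  split=> [j x|a x]; rewrite !fE linear_sum.
    apply: eq_bigr => p _; rewrite proj_idemE linearZ /=.
    rewrite -(path_act_homog (valP p) yi) idem_idem eq_sym.
    by case: eqP => [->|_]; rewrite ?scale0r ?scaler0.
  rewrite (eq_bigr (fun q : pbasis i => \sum_(p : pbasis i | val q == rcons (val p) a :> seq _)
     (x : pcarrier k i) p *: path_act (val q) (y tt))); last first.
    by move=> q _; rewrite proj_arrE scaler_suml.
  rewrite (exchange_big_dep predT) //=; apply: eq_bigr => p _.
  rewrite linearZ /=.
  have [nq|nq] := boolP (nonzero_path i (rcons (val p) a)); last first.
    rewrite path_act_rcons0 ?scaler0 ?big_pred0 //; last exact: valP p.
    by move=> q; apply/eqP => e; move: (valP q); rewrite e (negPf nq).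
  have qn : (size (rcons (val p) a) <= n)%N.
    by apply: leq_trans (ltnW (ltn_ord i)); rewrite -(path_size nq) leq_addr.
  by rewrite (big_pred1 (exist _ (Bseq qn) nq)) /= ?path_act_rcons.
Qed.

End FreeProj.

Section DirectSums.
Variables (k : fieldType) (n : nat).
Implicit Types M N L : lmodule k n.

Lemma idem_dsum M N i (x : dsum M N) :
  idem (dsum M N) i x = (idem M i x.1, idem N i x.2).
Proof. by rewrite /= pair_endE. Qed.

Lemma colour_dsum M N c (x : dsum M N) :
  colour (dsum M N) c x = (colour M c x.1, colour N c x.2).
Proof.
rewrite !colourE (eq_bigr (fun i => (arr M (i, c) x.1, arr N (i, c) x.2))).
  rewrite [LHS]surjective_pairing.
  by rewrite (raddf_sum fst) (raddf_sum snd).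
by move=> i _; rewrite /= pair_endE.
Qed.

Lemma free_dsum M N (I J : finType) (u : I -> 'I_n) (v : J -> 'I_n) x y :
  @free_on _ _ M I u x -> @free_on _ _ N J v y ->
  @free_on _ _ (dsum M N) (I + J)%type
    (fun c => match c with inl i => u i | inr j => v j end)
    (fun c => match c with inl i => (x i, 0) | inr j => (0, y j) end).
Proof.
move=> [xh xi xl] [yh yi yl]; split.
- by case=> c; rewrite idem_dsum /= linear0 ?xh ?yh.
- move=> S [S0 Sl Si Sc] Sxy [a b].
  have Sa : S (a, 0).
    apply: (xi (fun a => S (a, 0))) => [|c]; last exact: (Sxy (inl c)).
    split=> [//|c z w Sz Sw|i z Sz|c z Sz].
    + by have := Sl c _ _ Sz Sw; congr S; congr pair; rewrite /= scaler0 addr0.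
    + by have := Si i _ Sz; rewrite idem_dsum /= linear0.
    + by have := Sc c _ Sz; rewrite colour_dsum /= linear0.
  have Sb : S (0, b).
    apply: (yi (fun b => S (0, b))) => [|c]; last exact: (Sxy (inr c)).
    split=> [//|c z w Sz Sw|i z Sz|c z Sz].
    + by have := Sl c _ _ Sz Sw; congr S; congr pair; rewrite /= scaler0 addr0.
    + by have := Si i _ Sz; rewrite idem_dsum /= linear0.
    + by have := Sc c _ Sz; rewrite colour_dsum /= linear0.
  have := Sl 1 _ _ Sa Sb; rewrite scale1r; congr S; congr pair => /=.
    by rewrite addr0.
  by rewrite add0r.
- move=> L z zh.
  have [f [fh fx]] := xl L (fun i => z (inl i)) (fun i => zh (inl i)).
  have [g [gh gy]] := yl L (fun j => z (inr j)) (fun j => zh (inr j)).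
  have lh : linear (fun w : dsum M N => f w.1 + g w.2).
    by move=> c w1 w2 /=; rewrite !linearP /= scalerDr addrACA.
  have [h hE] := lfun_of_linear lh; exists h; split.
    apply: homP => [i w|c w]; rewrite !hE ?idem_dsum ?colour_dsum /=.
      by rewrite fh.1 gh.1 linearD.
    by rewrite !hom_colour // linearD.
  by case=> c; rewrite hE /= linear0 ?addr0 ?add0r.
Qed.

(** Forgets the indexing set and keeps the number of generators at each vertex, which adds up in
    direct sums. *)
Definition free_count M (a : 'I_n -> nat) : Prop :=
  exists (I : finType) (v : I -> 'I_n) (x : I -> M),
    free_on v x /\ forall i, #|[pred c | v c == i]| = a i.

Lemma free_count_ext M a b : a =1 b -> free_count M a -> free_count M b.
Proof. by move=> ab [I [v [x [H E]]]]; exists I, v, x; split=> // i; rewrite E. Qed.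

Lemma free_count0 : free_count (zero_module k n) (fun=> 0%N).
Proof.
exists void, (of_void _), (of_void _); split; last by move=> i; apply: eq_card0; case.
split=> [[]|S [S0 _ _ _] _ y|N y _].
  by rewrite (_ : y = 0) //; apply: thinmx0.
by exists 0; split=> [|[]]; first exact: hom0.
Qed.

Lemma free_countD M N a b :
  free_count M a -> free_count N b -> free_count (dsum M N) (fun i => a i + b i)%N.
Proof.
move=> [I [u [x [Hx Ex]]]] [J [v [y [Hy Ey]]]].
eexists _, _, _; split; first exact: free_dsum Hx Hy.
move=> i; rewrite -Ex -Ey -!sum1_card big_sumType /=.
by congr (_ + _)%N; apply: eq_bigl.
Qed.

Lemma free_count_sum r (M : 'I_r -> lmodule k n) (a : 'I_r -> 'I_n -> nat) :
  (forall j, free_count (M j) (a j)) ->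
  free_count (\dsum_(j < r) M j) (fun i => \sum_(j < r) a j i)%N.
Proof.
move=> H; pose op (u v : 'I_n -> nat) := fun i => (u i + v i)%N.
suff: free_count (\dsum_(j < r) M j) (\big[op/fun=> 0%N]_(j < r) a j).
  apply: free_count_ext => i.
  by apply: (big_ind2 (fun (u : 'I_n -> nat) m => u i = m)) => // u m v p <- <-.
apply: (big_ind2 free_count) => [|M1 u1 M2 u2 H1 H2|j _]; last exact: H.
  exact: free_count0.
exact: free_countD.
Qed.

(** The generators may be indexed by any finite set with the right numbers over each vertex, such as
    peaks, troughs or tagged ordinals. *)
Lemma free_proj_sum (I : finType) (v : I -> 'I_n) (a : 'I_n -> nat) :
  (forall i, #|[pred c | v c == i]| = a i) ->
  exists x : I -> proj_sum k a, free_on v x.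
Proof.
move=> va.
have [J [u [y [Hy uE]]]] : free_count (proj_sum k a) a.
  apply: (@free_count_ext _ (fun i => \sum_(j < n) \sum_(l < a j) (i == j))%N).
    move=> i; rewrite (bigD1 i) //= eqxx sum_nat_const card_ord muln1.
    by rewrite big1 ?addn0 // => j /negPf ji; rewrite eq_sym ji big1.
  apply: free_count_sum => j; apply: free_count_sum => l.
  have [x Hx] := free_proj k j; exists unit, (fun=> j), (fun=> x); split=> // i.
  case: (eqVneq i j) => _; first by rewrite -[RHS]card_unit; apply: eq_card => c.
  by apply: eq_card0 => c.
have [h [g hK gK] uh] : exists2 h : I -> J, bijective h & forall c, u (h c) = v c.
  by apply: fibre_bij => i; rewrite va uE.
exists (fun c => y (h c)); case: Hy => yh yi yl; split.
- by move=> c; rewrite -uh yh.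
- by move=> S HS Sy; apply: yi => // c; rewrite -[c]gK.
- move=> N z zh; have [|f [hf fy]] := yl N (fun c => z (g c)).
    by move=> c; rewrite -{1}[c]gK uh zh.
  by exists f; split=> // c; rewrite fy hK.
Qed.

End DirectSums.

(** * Uniqueness of minimal presentations *)

Section MinimalPresentations.
Variables (k : fieldType) (n : nat).
Implicit Types M N L : lmodule k n.

Definition simple_idem (i j : 'I_n) : 'End(k^o) := if j == i then \1%VF else 0.

Lemma simple_idem_mul i j l :
  (simple_idem i j \o simple_idem i l)%VF = if j == l then simple_idem i j else 0.
Proof.
rewrite /simple_idem; apply/lfunP => x; rewrite comp_lfunE.
case: (eqVneq j l) => [<-|jl]; first by case: ifP; rewrite !(id_lfunE, zero_lfunE).
case: (eqVneq j i) => [ji|_]; last by rewrite !zero_lfunE.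
by rewrite -ji eq_sym (negPf jl) !zero_lfunE linear0.
Qed.

Lemma simple_idem_sum i : \sum_j simple_idem i j = \1%VF.
Proof.
rewrite (bigD1 i) //= /simple_idem eqxx big1 ?addr0 // => j /negPf ji.
by rewrite ji.
Qed.

Definition simple (i : 'I_n) : lmodule k n :=
  @LModule k n k^o (simple_idem i) (fun=> 0) (simple_idem_mul i) (simple_idem_sum i)
    (fun _ => comp_lfun0r _ _) (fun _ => comp_lfun0l _ _)
    (fun _ _ _ => comp_lfun0l _ _).

(* Modulo the radical, the generators of P at each vertex span those of P'. *)
Lemma free_surj_card (P P' : lmodule k n) (I I' : finType) v v' x x'
    (h : 'Hom(P, P')) :
  @free_on _ _ P I v x -> @free_on _ _ P' I' v' x' -> is_hom h -> limg h = fullv ->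
  forall i, (#|[pred c | v' c == i]| <= #|[pred c | v c == i]|)%N.
Proof.
move=> HP HP' hh hs i.
pose A := [pred c | v c == i]; pose A' := [pred c | v' c == i].
(* A morphism to the simple module at [i] that is dual to the generator [c']; it kills the
   radical. *)
have thetaP c' : exists th : 'Hom(P', simple i), is_hom th /\
    (v' c' = i -> forall d, th (x' d) = (d == c')%:R :> k^o).
  have [|th [thh thx]] := free_lift HP' (N := simple i)
     (y := fun d => ((v' d == i) && (d == c'))%:R : k^o).
    move=> d; rewrite /= /simple_idem; case: eqP => [e|_]; last by rewrite zero_lfunE.
    by rewrite id_lfunE.
  exists th; split=> // e d; rewrite thx; case: (eqVneq d c') => [->|_]; rewrite ?andbF //.
  by rewrite e eqxx.
have th_arr (th : 'Hom(P', simple i)) a y : is_hom th -> th (arr P' a y) = 0.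
  by case=> _ ->; rewrite zero_lfunE.
have [th thP] := fin_all_exists thetaP.
(* Modulo the radical, [y] is a combination of the generators of [P]; only its values under the
   functionals are recorded. *)
have rep (y : P) : exists c : I -> k, forall c', th c' (h y) = \sum_d c d *: th c' (h (x d)).
  apply: (free_ind HP (S := fun y => exists c : I -> k, forall c',
    th c' (h y) = \sum_d c d *: th c' (h (x d)))).
    split=> [|a z1 z2 [c1 e1] [c2 e2]|j z [c e]|b z _].
    - by exists (fun=> 0) => c'; rewrite !linear0 big1 // => d _; rewrite scale0r.
    - exists (fun d => a * c1 d + c2 d) => c'; rewrite !linearP /= e1 e2 scaler_sumr.
      by rewrite -big_split; apply: eq_bigr => d _; rewrite scalerDl scalerA.
    - exists (fun d => if j == i then c d else 0) => c'.
      rewrite hh.1 (thP c').1.1 /= /simple_idem; case: eqP => _.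
        by rewrite id_lfunE e.
      by rewrite zero_lfunE big1 // => d _; rewrite scale0r.
    - exists (fun=> 0) => c'; rewrite big1 => [|d _]; last by rewrite scale0r.
      by rewrite hom_colour // colourE linear_sum big1 //= => l _; apply: th_arr; case: (thP c').
  move=> c; exists (fun d => (d == c)%:R) => c'.
  rewrite (bigD1 c) //= eqxx scale1r big1 ?addr0 // => d /negPf ->.
  by rewrite scale0r.
have gen c' : exists c : I -> k, forall d', th d' (x' c') = \sum_d c d *: th d' (h (x d)).
  have /memv_imgP[y _ ->] : x' c' \in limg h by rewrite hs memvf.
  exact: rep.
have {gen rep} [c cP] := fin_all_exists gen.
pose C : 'M[k]_(#|A'|, #|A|) := \matrix_(p, q) c (enum_val p) (enum_val q).
pose D : 'M[k]_(#|A|, #|A'|) := \matrix_(q, p) (th (enum_val p) (h (x (enum_val q))) : k^o).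
(* [C] expresses the generators of [P'] by those of [P], and [D] evaluates the latter. The identity
   of size [#|A'|] thus factors through size [#|A|], which bounds its rank. *)
have CD : C *m D = 1%:M.
  apply/matrixP => p q; rewrite !mxE.
  have vq : v' (enum_val q) = i by apply/eqP; have := enum_valP q; rewrite inE.
  have := cP (enum_val p) (enum_val q); rewrite (thP _).2 // (inj_eq enum_val_inj) => ->.
  rewrite (bigID (mem A)) /= [X in _ + X]big1 ?addr0 => [|d]; last first.
    rewrite inE => /negPf di; rewrite -(free_homog HP d) hh.1 (thP _).1.1 /=.
    by rewrite /simple_idem di zero_lfunE scaler0.
  by rewrite [RHS]big_enum_val; apply: eq_bigr => d _; rewrite !mxE.
have := mxrankM_maxl C D; rewrite CD mxrank1 => /leq_trans; apply; exact: rank_leq_col.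
Qed.

(** Projectivity: it suffices to lift the generators, and a lift is made homogeneous by the
    idempotent of its vertex. *)
Lemma free_cover_lift (P P' N : lmodule k n) (I : finType) v x (h : 'Hom(P, N))
    (f : 'Hom(P', N)) : @free_on _ _ P I v x -> is_hom h -> is_hom f ->
  (limg h <= limg f)%VS -> exists h' : 'Hom(P, P'), is_hom h' /\ forall y, f (h' y) = h y.
Proof.
move=> HP hh hf hl.
have y_ex c : exists y, idem P' (v c) y = y /\ f y = h (x c).
  have /memv_imgP[y _ e] : h (x c) \in limg f.
    by apply: (subvP hl); rewrite memv_img ?memvf.
  exists (idem P' (v c) y); rewrite idem_idem eqxx; split=> //.
  by rewrite hf.1 -e -hh.1 (free_homog HP).
have [y yP] := fin_all_exists y_ex.
have [h' [hh' h'x]] := free_lift HP (fun c => (yP c).1).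
exists h'; split=> //; apply: (free_ind HP) => [|c]; last by rewrite h'x (yP c).2.
split=> [|a u w eu ew|i u eu|c u eu].
- by rewrite !linear0.
- by rewrite !linearP /= eu ew.
- by rewrite hh'.1 hf.1 eu hh.1.
- by rewrite !hom_colour // eu.
Qed.

Lemma superfluous_surj M N (f : 'Hom(M, N)) (U : {vspace M}) :
  superfluous (lker f) -> submodule U -> (f @: U)%VS = limg f -> U = fullv.
Proof.
move=> sf sU e; apply: sf => //; apply/vspaceP => x; rewrite memvf.
have : f x \in (f @: U)%VS by rewrite e memv_img ?memvf.
case/memv_imgP=> u uU fx; rewrite -(subrK u x) memv_add //.
by rewrite memv_ker linearB /= fx subrr.
Qed.

Lemma min_presentation_le (Q P X Q' P' X' : lmodule k n)
    (I J I' J' : finType) u v u' v' x y x' y' (f : 'Hom(Q, P)) p (f' : 'Hom(Q', P')) p' :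
  @free_on _ _ P I u x -> @free_on _ _ Q J v y ->
  @free_on _ _ P' I' u' x' -> @free_on _ _ Q' J' v' y' ->
  @min_presentation _ _ Q P X f p -> @min_presentation _ _ Q' P' X' f' p' ->
  is_iso X X' -> forall i,
  (#|[pred c | u' c == i]| <= #|[pred c | u c == i]|)%N /\
  (#|[pred c | v' c == i]| <= #|[pred c | v c == i]|)%N.
Proof.
move=> HP HQ HP' HQ' [hf hp ps fp [sp sf]] [hf' hp' ps' fp' [sp' sf']].
case/iso_inv=> w [w' [hw hw' wK w'K]] i.
have [h [hh hE]] : exists h : 'Hom(P, P'), is_hom h /\ forall z, p' (h z) = (w \o p)%VF z.
  apply: (free_cover_lift HP) => //; first exact: hom_comp.
  by rewrite ps' subvf.
have hs : limg h = fullv.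
  apply: (superfluous_surj sp'); first exact: limg_submodule.
  rewrite ps'; apply/vspaceP => z; rewrite memvf.
  have /memv_imgP[t _ e] : w' z \in limg p by rewrite ps memvf.
  rewrite -(w'K z) e -comp_lfunE -hE.
  by rewrite memv_img // memv_img ?memvf.
have [h' [hh' h'E]] : exists h' : 'Hom(Q, Q'), is_hom h' /\ forall z, f' (h' z) = (h \o f)%VF z.
  apply: (free_cover_lift HQ) => //; first exact: hom_comp.
  apply/subvP=> _ /memv_imgP[z _ ->]; rewrite fp' memv_ker comp_lfunE hE comp_lfunE.
  have : f z \in lker p by rewrite -fp memv_img ?memvf.
  by rewrite memv_ker => /eqP ->; rewrite linear0.
have hs' : limg h' = fullv.
  apply: (superfluous_surj sf'); first exact: limg_submodule.
  apply/vspaceP => z; apply/idP/idP; first by apply: subvP; rewrite limgS ?subvf.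
  rewrite fp' => zk.
  have /memv_imgP[t _ e] : z \in limg h by rewrite hs memvf.
  have : t \in lker p.
    rewrite memv_ker; apply/eqP/(can_inj wK); rewrite linear0.
    by rewrite -comp_lfunE -hE -e; apply/eqP; rewrite -memv_ker.
  rewrite -fp => /memv_imgP[q _ e']; rewrite e e' -comp_lfunE -h'E.
  by rewrite memv_img // memv_img ?memvf.
split; [exact: (free_surj_card HP HP' hh hs) | exact: (free_surj_card HQ HQ' hh' hs')].
Qed.

(** [gvector] asserts only that some minimal presentation exists; this makes its value independent
    of the choice. *)
Lemma gvector_unique X X' (I J : finType) u v (P Q : lmodule k n) x y f p g :
  @free_on _ _ P I u x -> @free_on _ _ Q J v y -> @min_presentation _ _ Q P X f p ->
  is_iso X X' -> gvector X' g ->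
  forall i, g i = #|[pred c | u c == i]|%:Z - #|[pred c | v c == i]|%:Z.
Proof.
move=> HP HQ pr XX' [a [b [[f' [p' pr']] gE]]] i.
have [xa Ha] := free_proj_sum k (card_tag a).
have [xb Hb] := free_proj_sum k (card_tag b).
have [l1 l2] := min_presentation_le HP HQ Ha Hb pr pr' XX' i.
have [l3 l4] := min_presentation_le Ha Hb HP HQ pr' pr (iso_sym XX') i.
rewrite !card_tag in l1 l2 l3 l4.
rewrite gE; congr (_%:Z - _%:Z); apply/eqP; rewrite eqn_leq ?l1 ?l2 ?l3 ?l4 //.
Qed.

End MinimalPresentations.

(** * The minimal presentation of a union of strands *)

(* A union of alpha-descending strands: the node t is at the vertex vx t, and
   the step from t to nx t goes down along alpha if dr t and up along beta
   otherwise.  co gives the coordinates with respect to the nodes. *)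
Record strand_basis (k : fieldType) n (M : lmodule k n) (T : finType)
    (vx : T -> 'I_n) (dr : T -> bool) (nx pv : T -> T) (wt : T -> k)
    (co : T -> M -> k) (e : T -> M) : Prop := StrandBasis {
  st_nxK : cancel nx pv;
  st_pvK : cancel pv nx;
  st_step : forall t, if dr t then vx t = (vx (nx t)).+1 :> nat
                      else vx (nx t) = (vx t).+1 :> nat;
  st_wt : forall t, wt t != 0;
  st_co_lin : forall t c x y, co t (c *: x + y) = c * co t x + co t y;
  st_co_e : forall s t, co s (e t) = (s == t)%:R;
  st_decomp : forall x, x = \sum_t co t x *: e t;
  st_idem : forall i t x, co t (idem M i x) = if vx t == i then co t x else 0;
  st_down : forall t x, co t (colour M true x) =
    if dr (pv t) then wt (pv t) * co (pv t) x else 0;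
  st_up : forall t x, co t (colour M false x) =
    if dr t then 0 else (wt t)^-1 * co (nx t) x }.

Section Strands.
Variables (k : fieldType) (n : nat) (M : lmodule k n) (T : finType).
Variables (vx : T -> 'I_n) (dr : T -> bool) (nx pv : T -> T) (wt : T -> k).
Variables (co : T -> M -> k) (e : T -> M).
Hypothesis SB : strand_basis vx dr nx pv wt co e.

Let nxK : cancel nx pv := st_nxK SB.
Let pvK : cancel pv nx := st_pvK SB.
Let wt0 t : wt t != 0 := st_wt SB t.

Lemma co_ext x y : (forall t, co t x = co t y) -> x = y.
Proof.
move=> E; rewrite (st_decomp SB x) (st_decomp SB y).
by apply: eq_bigr => t _; rewrite E.
Qed.

Lemma co0 t : co t 0 = 0.
Proof. by have := st_co_lin SB t (-1) 0 0; rewrite scaler0 addr0 mulN1r addNr. Qed.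

Lemma coD t x y : co t (x + y) = co t x + co t y.
Proof. by rewrite -[x]scale1r (st_co_lin SB) scale1r mul1r. Qed.

Lemma coZ t c x : co t (c *: x) = c * co t x.
Proof. by rewrite -[c *: x]addr0 (st_co_lin SB) co0 addr0. Qed.

Lemma co_sum t (I : Type) (r : seq I) (P : pred I) (F : I -> M) :
  co t (\sum_(i <- r | P i) F i) = \sum_(i <- r | P i) co t (F i).
Proof. exact: (big_morph _ (coD t) (co0 t)). Qed.

Lemma node_eq (s t : T) : (nx s == t) = (s == pv t).
Proof. by rewrite -{1}(pvK t) (can_eq nxK). Qed.

Lemma idem_node i t : idem M i (e t) = if vx t == i then e t else 0.
Proof.
apply: co_ext => s; rewrite (st_idem SB) (st_co_e SB).
case: (eqVneq s t) => [->|/negPf st].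
  by case: ifP => _; rewrite ?co0 // (st_co_e SB) eqxx.
by rewrite if_same; case: ifP => _; rewrite ?co0 // (st_co_e SB) st.
Qed.

Lemma down_node t : colour M true (e t) = if dr t then wt t *: e (nx t) else 0.
Proof.
apply: co_ext => s; rewrite (st_down SB) !(st_co_e SB).
case: (eqVneq s (nx t)) => [->|st].
  by rewrite nxK eqxx mulr1; case: ifP; rewrite ?co0 // coZ (st_co_e SB) eqxx mulr1.
rewrite [pv s == t]eq_sym -node_eq eq_sym (negPf st) mulr0 if_same.
by case: ifP; rewrite ?co0 // coZ (st_co_e SB) (negPf st) mulr0.
Qed.

Lemma up_node t : colour M false (e (nx t)) = if dr t then 0 else (wt t)^-1 *: e t.
Proof.
apply: co_ext => s; rewrite (st_up SB) !(st_co_e SB) (can_eq nxK).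
case: (eqVneq s t) => [->|st].
  by rewrite mulr1; case: ifP; rewrite ?co0 // coZ (st_co_e SB) eqxx mulr1.
rewrite mulr0 if_same.
by case: ifP; rewrite ?co0 // coZ (st_co_e SB) (negPf st) mulr0.
Qed.

Lemma strand_subrep (S : M -> Prop) : S 0 ->
  (forall a y1 y2, S y1 -> S y2 -> S (a *: y1 + y2)) -> (forall t, S (e t)) ->
  forall x, S x.
Proof.
move=> S0 Sl Se x; rewrite (st_decomp SB x); elim/big_ind: _ => [//|u v Su Sv|t _].
  by rewrite -[u]scale1r; apply: Sl.
by rewrite -[_ *: _]addr0; apply: Sl.
Qed.

Definition is_peak t := dr t && ~~ dr (pv t).
Definition is_trough t := ~~ dr t && dr (pv t).

Section Presentation.
Variables (P : lmodule k n) (x : {t | is_peak t} -> P).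
Hypothesis HP : free_on (fun t => vx (val t)) x.

(* sg t is the path in P from the generator over the peak above t; a trough is
   reached along alpha. *)
Fixpoint sg_fuel m t : P :=
  if m is m'.+1 then
    if dr (pv t) then (wt (pv t))^-1 *: colour P true (sg_fuel m' (pv t))
    else if insub t is Some c then x c
    else wt t *: colour P false (sg_fuel m' (nx t))
  else 0.

(** The recursion always moves one vertex up, so the distance to the top is enough fuel. *)
Definition sg t := sg_fuel (n - vx t) t.

Lemma sg_rec t : sg t =
  if dr (pv t) then (wt (pv t))^-1 *: colour P true (sg (pv t))
  else if insub t is Some c then x c
  else wt t *: colour P false (sg (nx t)).
Proof.
rewrite {1}/sg; have : (n - vx t = (n - (vx t).+1).+1)%N by rewrite subnSK.
move=> -> /=; have := st_step SB (pv t); rewrite pvK.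
case: ifP => [_ e1|Dp _]; first by rewrite /sg e1.
case: insubP => // ; rewrite /is_peak Dp andbT => Dt.
by have := st_step SB t; rewrite (negPf Dt) /sg => ->.
Qed.

Lemma sg_down t : dr t -> sg (nx t) = (wt t)^-1 *: colour P true (sg t).
Proof. by move=> Dt; rewrite sg_rec nxK Dt. Qed.

Lemma sg_peak c : sg (val c) = x c.
Proof.
by rewrite sg_rec valK; have := valP c; rewrite /is_peak => /andP[_ /negPf ->].
Qed.

Lemma sg_up t : ~~ dr t -> ~~ dr (pv t) -> sg t = wt t *: colour P false (sg (nx t)).
Proof.
move=> /negPf Dt /negPf Dp; rewrite sg_rec Dp; case: insubP => // c.
by rewrite /is_peak Dt.
Qed.

(** Induction on the distance to the top: the neighbour to which [sg] recurs lies one vertex higher.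
    A trough has two higher neighbours, and only the one on the alpha side is offered there, as in
    [sg]. *)
Lemma sg_ind (S : T -> Prop) :
  (forall t, (dr (pv t) -> S (pv t)) -> (~~ dr t -> ~~ dr (pv t) -> S (nx t)) -> S t) ->
  forall t, S t.
Proof.
move=> IH t; elim: {t}_.+1 {-2}t (ltnSn (n - vx t)) => // m IHm t; rewrite ltnS => tm.
apply: IH => [Dp|Dt _]; apply: IHm; apply: leq_trans tm.
  have := st_step SB (pv t); rewrite Dp pvK => e1; rewrite e1 subnS prednK //.
  by rewrite subn_gt0.
have := st_step SB t; rewrite (negPf Dt) => e1; rewrite e1 subnS prednK //.
by rewrite subn_gt0.
Qed.

Lemma sg_homog t : idem P (vx t) (sg t) = sg t.
Proof.
elim/sg_ind: t => t IH1 IH2; rewrite sg_rec.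
have := st_step SB (pv t); rewrite pvK; case: ifP => [Dp e1|/negbT Dp _].
  by rewrite linearZ /= (colour_homog _ e1) // IH1.
case: insubP => [c _ <-|]; first exact: free_homog HP c.
rewrite /is_peak Dp andbT => Dt; have := st_step SB t; rewrite (negPf Dt) => e1.
by rewrite linearZ /= (colour_homog _ e1) // IH2.
Qed.

Variable p : 'Hom(P, M).
Hypothesis (hp : is_hom p) (px : forall c, p (x c) = e (val c)).

Lemma p_sg t : p (sg t) = e t.
Proof.
elim/sg_ind: t => t IH1 IH2; rewrite sg_rec.
case: ifP => [Dp|/negbT Dp].
  rewrite linearZ /= hom_colour // IH1 // down_node Dp pvK.
  by rewrite scalerA mulVf ?scale1r.
case: insubP => [c _ <-//|]; rewrite /is_peak Dp andbT => Dt.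
by rewrite linearZ /= hom_colour // IH2 // up_node (negPf Dt) scalerA divff ?scale1r.
Qed.

(** A linear section of [p] that need not be a morphism; [lift_node_colour] measures its failure to
    be one. *)
Definition lift_node (m : M) : P := \sum_t co t m *: sg t.

Lemma lift_node_lin a m1 m2 :
  lift_node (a *: m1 + m2) = a *: lift_node m1 + lift_node m2.
Proof.
rewrite /lift_node scaler_sumr -big_split; apply: eq_bigr => t _ /=.
by rewrite (st_co_lin SB) scalerDl scalerA.
Qed.

Lemma lift_node0 : lift_node 0 = 0.
Proof. by rewrite /lift_node big1 // => t _; rewrite co0 scale0r. Qed.

Lemma lift_nodeZ a m : lift_node (a *: m) = a *: lift_node m.
Proof. by rewrite -[_ *: m]addr0 lift_node_lin lift_node0 addr0. Qed.

Lemma lift_node_e t : lift_node (e t) = sg t.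
Proof.
rewrite /lift_node (bigD1 t) //= (st_co_e SB) eqxx scale1r big1 ?addr0 // => s st.
by rewrite (st_co_e SB) (negPf st) scale0r.
Qed.

Lemma p_lift_node m : p (lift_node m) = m.
Proof.
rewrite /lift_node linear_sum [RHS](st_decomp SB); apply: eq_bigr => t _.
by rewrite linearZ /= p_sg.
Qed.

Lemma lift_node_idem i m : idem P i (lift_node m) = lift_node (idem M i m).
Proof.
rewrite /lift_node linear_sum; apply: eq_bigr => t _.
rewrite (st_idem SB) linearZ /= -{1}sg_homog idem_idem eq_sym.
by case: eqP => [<-|_]; rewrite ?sg_homog ?scale0r ?scaler0.
Qed.

Variables (Q : lmodule k n) (y : {t | is_trough t} -> Q).
Hypothesis HQ : free_on (fun t => vx (val t)) y.
Variable f : 'Hom(Q, P).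
Hypothesis hf : is_hom f.
Hypothesis fy : forall c, f (y c) = sg (val c) - wt (val c) *: colour P false (sg (nx (val c))).

Lemma f_trough t : ~~ dr t -> dr (pv t) ->
  sg t - wt t *: colour P false (sg (nx t)) \in limg f.
Proof.
move=> D1 D2; have tr : is_trough t by rewrite /is_trough D1.
by rewrite -(fy (Sub t tr)) memv_img ?memvf.
Qed.

Lemma limg_colour c z : z \in limg f -> colour P c z \in limg f.
Proof. by case/memv_imgP=> w _ ->; rewrite -hom_colour // memv_img ?memvf. Qed.

(** The defect vanishes away from troughs. At a trough [sg] follows the alpha side, so the defect
    there is a multiple of the relation imposed by [f], or the image of that relation under a colour
    operator. *)
Lemma lift_node_colour c m : colour P c (lift_node m) - lift_node (colour M c m) \in limg f.
Proof.
elim/strand_subrep: m => [|a m1 m2 h1 h2|t].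
- by rewrite linear0 lift_node0 linear0 subr0 mem0v.
- rewrite lift_node_lin !linearP /= lift_node_lin opprD addrACA -scalerBr.
  by rewrite memvD ?memvZ.
rewrite lift_node_e; case: c.
  rewrite down_node; case: ifP => [Dt|/negbT Dt].
    by rewrite lift_nodeZ lift_node_e sg_down // scalerA divff // scale1r subrr mem0v.
  rewrite lift_node0 subr0; case: (boolP (dr (pv t))) => Dp; last first.
    by rewrite sg_up // linearZ /= colour_colour // scaler0 mem0v.
  have := limg_colour true (f_trough Dt Dp).
  by rewrite linearB linearZ /= colour_colour // scaler0 subr0.
rewrite -{2}(pvK t) up_node; case: ifP => [Dp|/negbT Dp].
  by rewrite lift_node0 subr0 sg_rec Dp linearZ /= colour_colour // scaler0 mem0v.
rewrite lift_nodeZ lift_node_e; case: (boolP (dr (pv (pv t)))) => Dpp; last first.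
  by rewrite [sg (pv t)]sg_up // pvK scalerA mulVf // scale1r subrr mem0v.
have := f_trough Dp Dpp; rewrite pvK => /(memvZ (- (wt (pv t))^-1)).
by rewrite scalerBr !scaleNr opprK addrC scalerA mulVf // scale1r.
Qed.

(** For the harder inclusion, [z] and [lift_node (p z)] agree modulo the image of [f]: this holds on
    generators and spreads by [lift_node_colour]. *)
Lemma strand_exact : limg f = lker p.
Proof.
apply/vspaceP => z; apply/idP/idP; last first.
  rewrite memv_ker => /eqP pz; rewrite -[z]subr0 -lift_node0 -pz.
  apply: (free_ind HP (S := fun z => z - lift_node (p z) \in limg f)) => {z pz}.
    split=> [|a z1 z2 h1 h2|i z h|c z h].
    - by rewrite linear0 lift_node0 subr0 mem0v.
    - by rewrite linearP lift_node_lin opprD addrACA -scalerBr memvD ?memvZ.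
    - have -> : idem P i z - lift_node (p (idem P i z)) = idem P i (z - lift_node (p z)).
        by rewrite hp.1 -lift_node_idem linearB.
      case/memv_imgP: h => w _ ->.
      by rewrite -hf.1 memv_img ?memvf.
    - have -> : colour P c z - lift_node (p (colour P c z)) =
        colour P c (z - lift_node (p z)) +
        (colour P c (lift_node (p z)) - lift_node (colour M c (p z))).
        by rewrite linearB hom_colour //= addrA subrK.
      by rewrite memvD ?limg_colour ?lift_node_colour.
  by move=> c; rewrite px lift_node_e sg_peak subrr mem0v.
case/memv_imgP=> w _ ->{z}; rewrite memv_ker; apply/eqP; move: w.
apply: (free_ind HQ); first split=> [|a z1 z2 h1 h2|i z h|c z h].
- by rewrite !linear0.
- by rewrite !linearP /= h1 h2 scaler0 addr0.
- by rewrite hf.1 hp.1 h linear0.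
- by rewrite !hom_colour // h linear0.
move=> c; rewrite fy linearB linearZ /= hom_colour // !p_sg up_node.
have /andP[/negPf -> _] := valP c.
by rewrite scalerA divff // scale1r subrr.
Qed.

Lemma lker_p_rad z : z \in lker p -> in_rad z.
Proof.
rewrite -strand_exact => /memv_imgP[w _ ->]; move: w.
have [R0 Rl Ri Rc] := in_rad_subrep P.
apply: (free_ind HQ); first split=> [|a z1 z2 h1 h2|i w h|c w h].
- by rewrite linear0.
- by rewrite linearP; apply: Rl.
- by rewrite hf.1; apply: Ri.
- by rewrite hom_colour //; apply: Rc.
move=> c; rewrite fy sg_rec; have /andP[_ ->] := valP c.
apply: (Rl); first exact: colour_in_rad.
by rewrite -scaleNr -[_ *: _]addr0; apply: Rl => //; exact: colour_in_rad.
Qed.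

(* Killing beta separates the alpha-ends of the runs. *)
Definition kill_arr (a : arrow n) : 'End(M) := if a.2 then arr M a else 0.

Lemma kill_tgt a : (idem M (atgt a) \o kill_arr a)%VF = kill_arr a.
Proof. by rewrite /kill_arr; case: ifP; rewrite ?idem_tgt ?comp_lfun0r. Qed.

Lemma kill_src a : (kill_arr a \o idem M (asrc a))%VF = kill_arr a.
Proof. by rewrite /kill_arr; case: ifP; rewrite ?idem_src ?comp_lfun0l. Qed.

Lemma kill_rel a b : in_R a b -> (kill_arr a \o kill_arr b)%VF = 0.
Proof.
rewrite /kill_arr => ab; case: ifP; case: ifP; rewrite ?comp_lfun0l ?comp_lfun0r //.
by rewrite arr_rel.
Qed.

Definition kill : lmodule k n :=
  LModule (@idem_mul _ _ M) (idem_sum M) kill_tgt kill_src kill_rel.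

Lemma colour_kill c z : colour kill c z = if c then colour M c z else 0.
Proof.
rewrite colourE; case: c; first by rewrite colourE; apply: eq_bigr.
by rewrite big1 // => i _; rewrite /= /kill_arr zero_lfunE.
Qed.

(** The relation at a trough has an alpha part and a beta part. Once the betas are killed, only the
    alpha part survives, and the generators over the troughs go to distinct basis vectors, which the
    alphas annihilate. So an element of the kernel has no component outside the radical. *)
Lemma lker_f_rad z : z \in lker f -> in_rad z.
Proof.
have [ph [hph phx]] : exists ph : 'Hom(P, kill), is_hom ph /\ forall c, ph (x c) = e (val c) :> M.
  by apply: (free_lift HP) => c; rewrite /= idem_node eqxx.
have phc b w : (ph (colour P b w) : M) = if b then colour M b (ph w) else 0.
  by rewrite [LHS](hom_colour hph) colour_kill.
have phi i w : (ph (idem P i w) : M) = idem M i (ph w) by rewrite [LHS]hph.1.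
have ph_sg t : dr t || dr (pv t) -> ph (sg t) = e t :> M.
  elim/sg_ind: t => t IH1 _; rewrite sg_rec.
  case: ifP => [Dp|/negbT Dp]; last first.
    rewrite orbF => Dt; case: insubP => [c _ <-//|]; by rewrite /is_peak Dp Dt.
  rewrite linearZ /= phc IH1 ?Dp // => _.
  by rewrite down_node Dp pvK scalerA mulVf ?scale1r.
have ph_f c : ph (f (y c)) = e (val c) :> M.
  rewrite fy linearB linearZ /= phc scaler0 subr0 ph_sg //.
  by case/andP: (valP c) => _ ->; rewrite orbT.
have ph_rad w : in_rad w -> ph (f w) = 0 :> M.
  case=> u ->; rewrite !linear_sum big1 // => a _ /=.
  rewrite hf.2 arr_colour phi phc; case: ifP => [->|_]; last by rewrite linear0.
  suff -> : colour M true (ph (f (u a))) = 0 by rewrite linear0.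
  move: (u a); apply: (free_ind HQ); first split=> [|b z1 z2 h1 h2|i w' h|c w' h].
  - by rewrite !linear0.
  - by rewrite !linearP /= h1 h2 scaler0 addr0.
  - rewrite hf.1 phi colourE big1 // => l _; rewrite arr_idem; case: ifP => // _.
    by rewrite arr_colour h linear0.
  - rewrite hom_colour // phc; case: c; first by rewrite h linear0.
    by rewrite linear0.
  by move=> c; rewrite ph_f down_node; have /andP[/negPf -> _] := valP c.
have [c [w [-> wR]]] : exists (c : {t | is_trough t} -> k) w,
    z = \sum_d c d *: y d + w /\ in_rad w.
  have [R0 Rl Ri Rc] := in_rad_subrep Q.
  move: z; apply: (free_ind HQ); first split.
  - by exists (fun=> 0), 0; rewrite big1 ?addr0 // => d _; rewrite scale0r.
  - move=> a z1 z2 [c1 [w1 [-> h1]]] [c2 [w2 [-> h2]]].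
    exists (fun d => a * c1 d + c2 d), (a *: w1 + w2); split; last exact: Rl.
    rewrite scalerDr addrACA scaler_sumr -big_split; congr (_ + _).
    by apply: eq_bigr => d _; rewrite scalerDl scalerA.
  - move=> i z [c [w [-> h]]].
    exists (fun d => if i == vx (val d) then c d else 0), (idem Q i w); split; last exact: Ri.
    rewrite linearD linear_sum; congr (_ + _); apply: eq_bigr => d _.
    rewrite linearZ /= -(free_homog HQ) idem_idem.
    by case: eqP => [->|_]; rewrite ?(free_homog HQ) ?scale0r ?scaler0.
  - move=> b z _; exists (fun=> 0), (colour Q b z); split; last exact: colour_in_rad.
    by rewrite big1 ?add0r // => d _; rewrite scale0r.
  move=> d; exists (fun d' => (d' == d)%:R), 0; split; last by [].
  rewrite (bigD1 d) //= eqxx scale1r big1 ?addr0 // => d' /negPf ->.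
  by rewrite scale0r.
rewrite memv_ker linearD linear_sum => /eqP /(congr1 ph).
rewrite linear0 linearD linear_sum /= [ph (f w)]ph_rad // addr0 => E.
rewrite big1 ?add0r // => d _; suff -> : c d = 0 by rewrite scale0r.
have := congr1 (co (val d)) E; rewrite co0 co_sum (bigD1 d) //= big1.
  rewrite !linearZ /= ph_f coZ (st_co_e SB) eqxx mulr1 addr0 => -> //.
move=> d' /negPf dd'; rewrite !linearZ /= ph_f coZ (st_co_e SB).
by rewrite eq_sym (inj_eq val_inj) dd' mulr0.
Qed.

Lemma strand_min_presentation : min_presentation f p.
Proof.
split=> //; first 1 last.
- exact: strand_exact.
- by split; apply: rad_superfluous; [exact: lker_p_rad | exact: lker_f_rad].
apply/vspaceP => m; rewrite memvf -(p_lift_node m); exact: memv_img (memvf _).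
Qed.

End Presentation.

Lemma strand_gvector_pres :
  exists (f : 'Hom(proj_sum k (fun i => #|[pred c : {t | is_trough t} | vx (val c) == i]|),
                   proj_sum k (fun i => #|[pred c : {t | is_peak t} | vx (val c) == i]|)))
         (p : 'Hom(proj_sum k (fun i => #|[pred c : {t | is_peak t} | vx (val c) == i]|), M)),
    min_presentation f p.
Proof.
have [x HP] := free_proj_sum k (fun i => erefl #|[pred c : {t | is_peak t} | vx (val c) == i]|).
have [y HQ] := free_proj_sum k (fun i => erefl #|[pred c : {t | is_trough t} | vx (val c) == i]|).
have [|p [hp px]] := free_lift HP (N := M) (y := fun c => e (val c)).
  by move=> c; rewrite idem_node eqxx.
have [|f [hf fy]] := free_lift HQ (y := fun c =>
    sg x (val c) - wt (val c) *: colour _ false (sg x (nx (val c)))).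
  move=> c; have := st_step SB (val c); have /andP[/negPf -> _] := valP c => e1.
  by rewrite linearB linearZ /= (colour_homog _ e1) ?(sg_homog HP).
by exists f, p; apply: (strand_min_presentation HP hp px HQ hf fy).
Qed.

Definition descents (j : nat) := #|[pred t | dr t && (vx t == j :> nat)]|.

(** At each vertex, the nodes left downwards are the peaks and the nodes passed downwards; the nodes
    entered from above are the troughs and the same passed nodes. Stepping back by [pv] turns the
    latter into the descents from one vertex higher. *)
Lemma peaks_troughs (i : 'I_n) :
  #|[pred c : {t | is_peak t} | vx (val c) == i]|%:Z -
  #|[pred c : {t | is_trough t} | vx (val c) == i]|%:Z =
  (descents i)%:Z - (descents i.+1)%:Z.
Proof.
have subE (A : pred T) : #|[pred c : {t | A t} | vx (val c) == i]| =
    #|[pred t | A t && (vx t == i)]|.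
  rewrite -(card_imset _ val_inj); apply: eq_card => t; rewrite !inE.
  apply/imsetP/andP => [[c ci ->]|[At ti]]; first by split; [exact: valP c | exact: ci].
  by exists (Sub t At); rewrite ?inE.
rewrite !subE; set pk := #|_|; set tr := #|_|.
pose d := #|[pred t | [&& dr t, dr (pv t) & vx t == i]]|.
have -> : descents i = (pk + d)%N.
  rewrite /descents -(cardID [pred t | dr (pv t)]) addnC; congr (_ + _)%N; apply: eq_card => t.
    by rewrite !inE /is_peak; case: (dr t); rewrite ?andbF //= andbC.
  by rewrite !inE; case: (dr t); rewrite ?andbF //= andbC.
have -> : descents i.+1 = (tr + d)%N.
  have -> : descents i.+1 = #|[pred t | dr (pv t) && (vx t == i)]|.
    rewrite /descents -(card_image (can_inj nxK)); apply: eq_card => t; rewrite !inE.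
    rewrite -{1}(pvK t) mem_image ?inE; last exact: can_inj nxK.
    have := st_step SB (pv t); rewrite pvK; case: (dr (pv t)) => //= ->.
    by rewrite eqSS.
  rewrite -(cardID dr) addnC; congr (_ + _)%N; apply: eq_card => t.
    by rewrite !inE /is_trough -[in LHS]topredE /=; case: (dr t).
  by rewrite !inE -[in LHS]topredE /= andbC.
by rewrite !PoszD opprD addrACA subrr addr0.
Qed.

Lemma strand_gvector g : gvector M g <->
  forall i : 'I_n, g i = (descents i)%:Z - (descents i.+1)%:Z.
Proof.
have [f [p pr]] := strand_gvector_pres; split=> [gM i|E]; last first.
  by eexists _, _; split; [exists f, p; exact: pr | move=> i; rewrite E peaks_troughs].
have [x HP] := free_proj_sum k (fun i => erefl #|[pred c : {t | is_peak t} | vx (val c) == i]|).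
have [y HQ] := free_proj_sum k (fun i => erefl #|[pred c : {t | is_trough t} | vx (val c) == i]|).
by rewrite (gvector_unique HP HQ pr (iso_refl M) gM) peaks_troughs.
Qed.

End Strands.

(** * Strands under isomorphism and direct sum *)

Section StrandClosure.
Variables (k : fieldType) (n : nat).
Implicit Types M N : lmodule k n.

(** Hides the index type, so that the notion passes through isomorphisms and iterated sums; the
    numbers of descents are all that the g-vector needs. *)
Definition has_strand M (a : nat -> nat) : Prop :=
  exists (T : finType) (vx : T -> 'I_n) (dr : T -> bool) (nx pv : T -> T) (wt : T -> k)
    (co : T -> M -> k) (e : T -> M),
    strand_basis vx dr nx pv wt co e /\ forall j, descents vx dr j = a j.

Lemma has_strand_iso M N a : is_iso M N -> has_strand M a -> has_strand N a.
Proof.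
case/iso_inv=> f [g [hf hg fK gK]] [T [vx [dr [nx [pv [wt [co [e [SB E]]]]]]]]].
exists T, vx, dr, nx, pv, wt, (fun t y => co t (g y)), (fun t => f (e t)).
case: SB => nxK pvK st w0 col coe dec id dn up; split=> //; split=> //.
- by move=> t c x y; rewrite linearP col.
- by move=> s t; rewrite fK coe.
- move=> y; rewrite -[LHS]gK {1}[g y]dec linear_sum; apply: eq_bigr => t _.
  by rewrite linearZ.
- by move=> i t y; rewrite hg.1 id.
- by move=> t y; rewrite hom_colour // dn.
- by move=> t y; rewrite hom_colour // up.
Qed.

Lemma has_strand0 : has_strand (zero_module k n) (fun=> 0%N).
Proof.
exists void, (of_void _), (of_void _), id, id, (of_void _), (of_void _), (of_void _).
split; last by move=> j; apply: eq_card0; case.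
split=> //; try by case.
by move=> x; rewrite big1 => [|[]//]; apply: thinmx0.
Qed.

Lemma has_strandD M N a b : has_strand M a -> has_strand N b ->
  has_strand (dsum M N) (fun j => a j + b j)%N.
Proof.
move=> [T [vx [dr [nx [pv [wt [co [e [SB E]]]]]]]]].
move=> [T' [vx' [dr' [nx' [pv' [wt' [co' [e' [SB' E']]]]]]]]].
exists (T + T')%type, (fun t => match t with inl t => vx t | inr t => vx' t end),
  (fun t => match t with inl t => dr t | inr t => dr' t end),
  (fun t => match t with inl t => inl (nx t) | inr t => inr (nx' t) end),
  (fun t => match t with inl t => inl (pv t) | inr t => inr (pv' t) end),
  (fun t => match t with inl t => wt t | inr t => wt' t end),
  (fun t (x : dsum M N) => match t with inl t => co t x.1 | inr t => co' t x.2 end),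
  (fun t => match t with inl t => (e t, 0) | inr t => (0, e' t) end).
split; last first.
  move=> j; rewrite -E -E' /descents -!sum1_card big_sumType /=.
  by congr (_ + _)%N; apply: eq_bigl.
have c0 := co0 SB; have c0' := co0 SB'.
case: SB => nxK pvK st w0 col coe dec id dn up.
case: SB' => nxK' pvK' st' w0' col' coe' dec' id' dn' up'; split.
- by case=> t /=; rewrite ?nxK ?nxK'.
- by case=> t /=; rewrite ?pvK ?pvK'.
- by case.
- by case.
- by case=> t c x y /=; rewrite ?col ?col'.
- by case=> s [] t /=; rewrite ?coe ?coe' ?c0 ?c0'.
- move=> [x y]; rewrite big_sumType /= [LHS]surjective_pairing [RHS]surjective_pairing /=.
  rewrite !(raddf_sum fst) !(raddf_sum snd) /=; congr pair.
    by rewrite [X in _ + X]big1 ?addr0 => [|t _]; rewrite /= ?scaler0 // {1}[x]dec.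
  by rewrite [X in X + _]big1 ?add0r => [|t _]; rewrite /= ?scaler0 // {1}[y]dec'.
- by move=> i [] t x; rewrite idem_dsum /= ?id ?id'.
- by case=> t x; rewrite colour_dsum /= ?dn ?dn'.
- by case=> t x; rewrite colour_dsum /= ?up ?up'.
Qed.

Lemma has_strand_sum r (M : 'I_r -> lmodule k n) (a : 'I_r -> nat -> nat) :
  (forall i, has_strand (M i) (a i)) ->
  has_strand (\dsum_(i < r) M i) (fun j => \sum_(i < r) a i j)%N.
Proof.
move=> H; pose op (u v : nat -> nat) := fun j => (u j + v j)%N.
have [T [vx [dr [nx [pv [wt [co [e [SB E]]]]]]]]] :
    has_strand (\dsum_(j < r) M j) (\big[op/fun=> 0%N]_(i < r) a i).
  apply: (big_ind2 has_strand) => [|M1 u1 M2 u2 H1 H2|j _]; last exact: H.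
    exact: has_strand0.
  exact: has_strandD.
exists T, vx, dr, nx, pv, wt, co, e; split=> // j; rewrite E.
by apply: (big_ind2 (fun (u : nat -> nat) m => u j = m)) => // u m v p <- <-.
Qed.

Lemma has_strand_gvector M a g : has_strand M a ->
  gvector M g <-> forall i : 'I_n, g i = (a i)%:Z - (a i.+1)%:Z.
Proof.
move=> [T [vx [dr [nx [pv [wt [co [e [SB E]]]]]]]]].
by rewrite (strand_gvector SB); split=> H i; rewrite H !E.
Qed.

(** No step down starts at the lowest vertex, and the index [n] is not a vertex. The first zero
    starts the telescoping of the partial sums, the second makes the total sum vanish. *)
Lemma has_strand_ends M a : has_strand M a -> a 0%N = 0%N /\ a n = 0%N.
Proof.
move=> [T [vx [dr [nx [pv [wt [co [e [SB E]]]]]]]]]; rewrite -!E; split; apply: eq_card0 => t.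
  rewrite !inE; case D: (dr t) => //=; have := st_step SB t; rewrite D => ->.
  by [].
by rewrite !inE ltn_eqF ?andbF.
Qed.

End StrandClosure.

(** * Morphisms carried by a common stretch *)

Section ChainHom.
Variables (k : fieldType) (n : nat) (M N : lmodule k n) (T T' : finType).
Variables (vx : T -> 'I_n) (dr : T -> bool) (nx pv : T -> T) (wt : T -> k).
Variables (co : T -> M -> k) (e : T -> M).
Variables (vx' : T' -> 'I_n) (dr' : T' -> bool) (nx' pv' : T' -> T') (wt' : T' -> k).
Variables (co' : T' -> N -> k) (e' : T' -> N).
Hypothesis SB : strand_basis vx dr nx pv wt co e.
Hypothesis SB' : strand_basis vx' dr' nx' pv' wt' co' e'.
Variables (s : T) (s' : T') (l : nat).
Hypothesis vs : vx s = vx' s'.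
Hypothesis drs : forall m, (m < l)%N -> dr (iter m nx s) = dr' (iter m nx' s').

(** The coefficients forced by commutation with the steps: each step contributes the ratio of the
    two weights. *)
Definition chain_coef m : k := \prod_(i < m) (wt' (iter i nx' s') / wt (iter i nx s)).

Definition chain_fun (x : M) : N :=
  \sum_(m < l.+1) (chain_coef m * co (iter m nx s) x) *: e' (iter m nx' s').

Lemma chain_coef_neq0 m : chain_coef m != 0.
Proof.
apply/prodf_neq0 => i _; rewrite mulf_neq0 ?invr_eq0 //.
  exact: st_wt SB' _.
exact: st_wt SB _.
Qed.

Lemma chain_coefS m :
  chain_coef m.+1 = chain_coef m * (wt' (iter m nx' s') / wt (iter m nx s)).
Proof. by rewrite /chain_coef big_ord_recr. Qed.

Lemma chain_vx m : (m <= l)%N -> vx (iter m nx s) = vx' (iter m nx' s').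
Proof.
elim: m => [//|m IH] ml; apply: val_inj => /=.
have := st_step SB (iter m nx s); have := st_step SB' (iter m nx' s').
rewrite -(drs ml) (IH (ltnW ml)); case: (dr _) => e1 e2; last by rewrite e1 e2.
by apply: succn_inj; rewrite -e1 -e2.
Qed.

(** Under a colour operator the inner terms match after a shift, and these are the terms left at the
    two ends. For a crossing both sides are zero; for a stretch that is a whole band with matching
    parameters they are equal. *)
Hypothesis bd_down : forall x,
  co s (colour M true x) *: e' s' =
  (chain_coef l * co (iter l nx s) x) *: colour N true (e' (iter l nx' s')).
Hypothesis bd_up : forall x,
  (chain_coef l * co (iter l nx s) (colour M false x)) *: e' (iter l nx' s') =
  co s x *: colour N false (e' s').

Lemma chain_hom : exists f : 'Hom(M, N), is_hom f /\ forall x, f x = chain_fun x.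
Proof.
have lf : linear chain_fun.
  move=> c x y; rewrite /chain_fun scaler_sumr -big_split; apply: eq_bigr => m _ /=.
  by rewrite (st_co_lin SB) mulrDr scalerDl scalerA mulrCA.
have [f fE] := lfun_of_linear lf; exists f; split=> //; apply: homP => [i x|c x].
  rewrite !fE /chain_fun linear_sum; apply: eq_bigr => -[m ml] _ /=.
  rewrite linearZ /= (idem_node SB') (st_idem SB) chain_vx //.
  by case: ifP; rewrite ?mulr0 ?scaler0 ?scale0r.
have w0 t := st_wt SB t; have w0' t := st_wt SB' t.
rewrite !fE /chain_fun linear_sum; case: c.
  rewrite big_ord_recl [RHS]big_ord_recr /= linearZ /= -bd_down addrC.
  rewrite /chain_coef big_ord0 mul1r; congr (_ + _); apply: eq_bigr => -[m ml] _ /=.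
  rewrite linearZ /= (down_node SB') -(drs ml) (st_down SB) (st_nxK SB).
  case: ifP => _; last by rewrite mulr0 scale0r scaler0.
  rewrite scalerA; congr (_ *: _); rewrite -/(chain_coef _) chain_coefS -!mulrA; congr (_ * _).
  by rewrite mulKf // mulrC.
rewrite [LHS]big_ord_recr [RHS]big_ord_recl /= linearZ /= bd_up addrC.
rewrite {2}/chain_coef big_ord0 mul1r; congr (_ + _); apply: eq_bigr => -[m ml] _ /=.
rewrite linearZ /= (up_node SB') -(drs ml) (st_up SB).
case: ifP => _; first by rewrite mulr0 scale0r scaler0.
rewrite scalerA; congr (_ *: _); rewrite chain_coefS -!mulrA; congr (_ * _).
by rewrite [RHS]mulrC -!mulrA mulVf // mulr1.
Qed.

End ChainHom.

(** * The strand of a band *)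

Lemma iter_can (T : Type) (f g : T -> T) m : cancel f g -> cancel (iter m f) (iter m g).
Proof. by move=> fK; elim: m => // m IH x; rewrite iterSr /= fK IH. Qed.

Lemma val_iter_ordS r m (s : 'I_r) : val (iter m (@ordS r) s) = ((s + m) %% r)%N.
Proof.
elim: m => [|m IH]; first by rewrite addn0 modn_small.
by rewrite iterS /= IH -addn1 modnDml addn1 addnS.
Qed.

Lemma nth_wpower n m (w : seq (letter n)) x0 i : (i < m * size w)%N ->
  nth x0 (wpower m w) i = nth x0 w (i %% size w).
Proof.
elim: m i => [//|m IH] i; rewrite mulSn => im.
rewrite /wpower /= nth_cat; case: ltnP => h; first by rewrite modn_small.
rewrite -[flatten _]/(wpower m w) IH; last by rewrite ltn_subLR.
by rewrite -{2}(subnK h) modnDr.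
Qed.

Lemma size_wpower n m (w : seq (letter n)) : size (wpower m w) = (m * size w)%N.
Proof. by elim: m => // m IH; rewrite /wpower /= size_cat -/(wpower m w) IH mulSn. Qed.

(** Invariance under rotation by [d] gives, by Bezout, invariance under rotation by the gcd of [d]
    and the length, which would make the band a proper power. *)
Lemma band_rot_free n (z : band n) d : (0 < d < size z)%N ->
  ~ (forall s, blet s = blet (iter d (@ordS (size z)) s)).
Proof.
case/andP=> d0 dr H; have r0 : (0 < size z)%N by apply: leq_trans dr.
pose x0 := blet (Ordinal r0).
pose y i := nth x0 z (i %% size z).
have yd i : y (i + d)%N = y i.
  have := H (Ordinal (ltn_pmod i r0)); rewrite /blet !(tnth_nth x0) /=.
  by rewrite val_iter_ordS /= modnDml.
have ykd k i : y (i + k * d)%N = y i.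
  by elim: k => [|k IH]; rewrite ?addn0 // mulSn addnCA addnC yd.
have yr k i : y (i + k * size z)%N = y i by rewrite /y addnC modnMDl.
have [km kn e _] := egcdnP (size z) d0.
pose g := gcdn d (size z).
have g0 : (0 < g)%N by rewrite gcdn_gt0 d0.
have yg i : y (i + g)%N = y i by rewrite -(yr kn) -addnA [(g + _)%N]addnC -e ykd.
have ykg k i : y (i + k * g)%N = y i.
  by elim: k => [|k IH]; rewrite ?addn0 // mulSn addnCA addnC yg.
have gr : (g %| size z)%N by rewrite dvdn_gcdr.
have gd : (g %| d)%N by rewrite dvdn_gcdl.
have gz : (g < size z)%N by apply: leq_ltn_trans dr; apply: dvdn_leq.
have [/andP[W _] _ np _] := band_seqP z.
have sg : size (take g z) = g by rewrite size_take gz.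
have e1 : (size z %/ g * g)%N = size z by rewrite divnK.
apply: (np (take g z) (size z %/ g)%N); first exact: take_sorted.
  by rewrite ltn_divRL // mul1n.
apply: (@eq_from_nth _ x0) => [|i iz]; first by rewrite size_wpower sg e1.
rewrite nth_wpower sg ?e1 // nth_take ?ltn_pmod //.
have := ykg (i %/ g)%N (i %% g)%N; rewrite addnC -divn_eq /y modn_small // => ->.
by rewrite modn_small // (ltn_trans _ gz) // ltn_pmod.
Qed.

Section BandStrand.
Variables (n : nat) (z : band n).
Let r := size z.

(* Along a band, either all descents carry alpha and all ascents beta, or the
   other way round; in the second case the band is read backwards. *)
Definition lsign (x : letter n) : bool := x.2 == x.1.2.

(** Consecutive letters of equal direction have equal colours by the relations. Letters of opposite
    directions lie on one edge and have different colours, not being inverse to each other. The sign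
    is the same in both cases. *)
Lemma lsign_next (x y : letter n) : ltgt x = lsrc y -> y != linv x ->
  ~~ letters_in_R y x -> lsign y = lsign x.
Proof.
case: x y => [[i c] d] [[j c'] d'] /(congr1 val); rewrite /lsign /= /linv /letters_in_R /=.
case: d; case: d' => /= e; rewrite ?andbF ?orbF /= /in_R /=.
- by rewrite e eqxx /= => _; rewrite negbK => /eqP ->.
- rewrite !xpair_eqE eqxx andbT -(inj_eq val_inj) /= -e eqxx /= => cc _.
  by case: c c' cc => [] [].
- case: e => e; rewrite !xpair_eqE eqxx andbT -(inj_eq val_inj) /= -e eqxx /= => cc _.
  by case: c c' cc => [] [].
- by rewrite -e eqxx /= => _; rewrite negbK => /eqP ->.
Qed.

Definition bpos : bool := if (z : seq _) is x :: _ then lsign x else true.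

Lemma blet_sign (s : 'I_r) : lsign (blet s) = bpos.
Proof.
suff H m (mr : (m < r)%N) : lsign (blet (Ordinal mr)) = bpos.
  by case: s.
elim: m mr => [|m IH] mr.
  rewrite /blet /bpos; move: mr; rewrite /r; case: (z) => -[|x z'] //= zP mr.
have [e1 e2 e3] := band_cycle (Ordinal (ltnW mr)).
rewrite -(IH (ltnW mr)) -(lsign_next e1 e2 e3); congr (lsign (blet _)).
by apply: val_inj; rewrite /= modn_small.
Qed.

Definition bnx (s : 'I_r) : 'I_r := if bpos then ordS s else ord_pred s.
Definition bpv (s : 'I_r) : 'I_r := if bpos then ord_pred s else ordS s.
(** Read backwards, the step from [s] crosses the preceding letter in the opposite direction, hence
    the negation. *)
Definition bdr (s : 'I_r) : bool :=
  if bpos then (blet s).2 else ~~ (blet (ord_pred s)).2.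
Definition bvx (s : 'I_r) : 'I_n := bvertex s.

Lemma bnxK : cancel bnx bpv.
Proof. by move=> s; rewrite /bnx /bpv; case: bpos; rewrite (ordSK, ord_predK). Qed.

Lemma bpvK : cancel bpv bnx.
Proof. by move=> s; rewrite /bnx /bpv; case: bpos; rewrite (ordSK, ord_predK). Qed.

Lemma bstep s : if bdr s then bvx s = (bvx (bnx s)).+1 :> nat
                else bvx (bnx s) = (bvx s).+1 :> nat.
Proof.
rewrite /bdr /bnx /bvx; case: bpos.
  have [e1 _ _] := band_cycle s; rewrite -e1 /bvertex /lsrc /ltgt.
  by case: (blet s).2.
have [e1 _ _] := band_cycle (ord_pred s); rewrite ord_predK in e1.
rewrite -e1 /bvertex /lsrc /ltgt; by case: (blet (ord_pred s)).2.
Qed.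

Lemma iter_ordS_size (s : 'I_r) : iter r (@ordS r) s = s.
Proof. by apply: val_inj; rewrite val_iter_ordS modnDr modn_small. Qed.

Lemma iter_ordS_reach (s t : 'I_r) : exists2 d, (d < r)%N & t = iter d (@ordS r) s.
Proof.
have r0 : (0 < r)%N by apply: leq_ltn_trans (ltn_ord s).
exists ((t + (r - s)) %% r)%N; first by rewrite ltn_pmod.
apply: val_inj; rewrite val_iter_ordS modnDmr addnCA subnKC ?modnDr ?modn_small //.
exact: ltnW.
Qed.

Lemma iter_bnx_size (s : 'I_r) : iter r bnx s = s.
Proof.
rewrite /bnx; case: bpos; first exact: iter_ordS_size.
by rewrite -[in LHS](iter_ordS_size s) (iter_can r (@ordSK r)).
Qed.

Lemma bnx_reach (s t : 'I_r) : exists m, t = iter m bnx s.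
Proof.
rewrite /bnx; case: bpos; first by have [d _ ->] := iter_ordS_reach s t; exists d.
have [d _ ->] := iter_ordS_reach t s; exists d.
by rewrite (iter_can d (@ordSK r)).
Qed.

(** A common vertex and a common future determine all letters, so the rotation taking [s] to [t]
    fixes the band; by primitivity it is trivial. *)
Lemma band_rigid (s t : 'I_r) : bvx s = bvx t ->
  (forall m, bdr (iter m bnx s) = bdr (iter m bnx t)) -> s = t.
Proof.
move=> vst dst.
have vm m : bvx (iter m bnx s) = bvx (iter m bnx t).
  elim: m => [//|m IH]; apply: val_inj => /=.
  have := bstep (iter m bnx s); have := bstep (iter m bnx t).
  rewrite -dst IH; case: (bdr _) => e1 e2; last by rewrite e1 e2.
  by apply: succn_inj; rewrite -e1 -e2.
have [d dr te] := iter_ordS_reach s t.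
case: (posnP d) => [d0|d0]; first by rewrite te d0.
case: (@band_rot_free n z d); first by rewrite d0.
(* Sign and direction give the colour; one endpoint then gives the arrow. *)
have letE (x y : letter n) : lsign x = lsign y -> x.2 = y.2 ->
    (lsrc x = lsrc y \/ ltgt x = ltgt y) -> x = y.
  case: x y => [[i c] b] [[j c'] b']; rewrite /lsign /= => sxy b2; rewrite -b2 in sxy *.
  have -> : c = c' by case: b c c' sxy {b2} => [] [] [].
  by move=> h; congr (_, _, _); apply: val_inj; case: h => /(congr1 val) /=;
    rewrite /lsrc /ltgt /=; case: b {sxy b2} => //= -[].
move=> u; case P: bpos.
  have [m ->] := bnx_reach s u.
  have := vm m; have := dst m; rewrite te /bdr /bnx P.
  have -> : iter m (@ordS r) (iter d (@ordS r) s) = iter d (@ordS r) (iter m (@ordS r) s).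
    by rewrite -!iterD addnC.
  by move=> e1 e2; apply: letE; rewrite ?blet_sign //; left.
have [m mE] := bnx_reach s (ordS u).
have := vm m; have := dst m; rewrite te; move: mE; rewrite /bdr /bnx P => mE.
have -> : iter m (@ord_pred r) (iter d (@ordS r) s) = iter d (@ordS r) (iter m (@ord_pred r) s).
  rewrite -{1}[s](iter_can m (@ord_predK r)) -iterD addnC iterD.
  exact: (iter_can m (@ordSK r)).
rewrite -mE ordSK -iterSr iterS ordSK => /negb_inj e1 e2; apply: letE => //.
  by rewrite !blet_sign.
have [w1 _ _] := band_cycle u; have [w2 _ _] := band_cycle (iter d (@ordS r) u).
by right; rewrite w1 w2; exact: e2.
Qed.

Variables (k : fieldType) (lambda : k).
Hypothesis lambda0 : lambda != 0.

Definition lwt (c : k) (s : 'I_r) : k := if s.+1 == r then c else 1.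
Definition bwt (s : 'I_r) : k := if bpos then lwt lambda s else (lwt lambda (ord_pred s))^-1.
Definition bco (s : 'I_r) (x : band_module z 1 lambda) : k := (x : 'M[k]_(1, r)) 0 s.
Definition bnode (s : 'I_r) : band_module z 1 lambda := (delta_mx 0 s : 'M[k]_(1, r)).

Lemma lwt0 c s : c != 0 -> lwt c s != 0.
Proof. by rewrite /lwt; case: ifP => // _ _; apply: oner_neq0. Qed.

Lemma lwtV s : lwt lambda^-1 s = (lwt lambda s)^-1.
Proof. by rewrite /lwt; case: ifP; rewrite ?invr1. Qed.

Lemma bscalar1 c s m (x : 'M[k]_(1, m)) : bscalar 1 c s *m x = lwt c s *: x.
Proof.
apply/matrixP => i j; rewrite !mxE big_ord1 !ord1 /bscalar /lwt /r.
by case: ifP => _; rewrite !mxE ?eqxx ?addr0.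
Qed.

Lemma band_arr_co a x t : bco t (arr (band_module z 1 lambda) a x) =
  (if blet (ord_pred t) == (a, true) then lwt lambda (ord_pred t) * bco (ord_pred t) x else 0)
  + (if blet t == (a, false) then (lwt lambda t)^-1 * bco (ordS t) x else 0).
Proof.
rewrite /bco /= band_arrE /band_arr_fun summxE.
have dE (y : 'M[k]_(1, r)) u v : (y *m delta_mx u v) 0 t = if t == v then y 0 u else 0.
  rewrite mxE (bigD1 u) //= big1 ?addr0 => [|w /negPf wu]; rewrite mxE ?eqxx ?wu ?mulr0 //.
  by case: eqP; rewrite ?mulr1 ?mulr0.
transitivity (\sum_(s < r)
   ((if (t == ordS s) && (blet s == (a, true)) then lwt lambda s * x 0 s else 0) +
    (if (t == s) && (blet s == (a, false)) then (lwt lambda s)^-1 * x 0 (ordS s) else 0))).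
  apply: eq_bigr => s _; case: (eqVneq (blet s) (a, true)) => [->|_].
    have -> : ((a, true) == (a, false) :> letter n) = false by rewrite xpair_eqE andbF.
    by rewrite andbF addr0 andbT dE bscalar1; case: ifP; rewrite ?mxE.
  rewrite andbF add0r; case: (eqVneq (blet s) (a, false)) => [e|_].
    rewrite andbT dE bscalar1 lwtV; by case: ifP; rewrite ?mxE.
  by rewrite andbF mxE.
rewrite big_split /=; congr (_ + _).
  rewrite (bigD1 (ord_pred t)) //= ord_predK eqxx /= big1 ?addr0 // => s sn.
  case: eqP => // e; case/eqP: sn; by rewrite e ordSK.
by rewrite (bigD1 t) //= eqxx big1 ?addr0 // => s /negPf; rewrite eq_sym => ->.
Qed.

Lemma band_colour_co c x t : bco t (colour (band_module z 1 lambda) c x) =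
  (if (blet (ord_pred t)).2 && ((blet (ord_pred t)).1.2 == c)
   then lwt lambda (ord_pred t) * bco (ord_pred t) x else 0)
  + (if ~~ (blet t).2 && ((blet t).1.2 == c) then (lwt lambda t)^-1 * bco (ordS t) x else 0).
Proof.
have letE (y : letter n) d (w : k) :
    \sum_(i < n.-1) (if y == (i, c, d) then w else 0) =
    if (y.2 == d) && (y.1.2 == c) then w else 0.
  case: y => [[i c'] d'] /=; rewrite (bigD1 i) //= !xpair_eqE eqxx /= andbC.
  rewrite big1 ?addr0 // => j /negPf; rewrite eq_sym => ji.
  by rewrite !xpair_eqE ji.
rewrite colourE [bco t _]summxE.
under eq_bigr => i _ do rewrite -/(bco t _) band_arr_co.
by rewrite big_split /= !letE eqb_id eqbF_neg.
Qed.

Lemma band_strand_basis : strand_basis bvx bdr bnx bpv bwt bco bnode.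
Proof.
split.
- exact: bnxK.
- exact: bpvK.
- exact: bstep.
- by move=> t; rewrite /bwt; case: ifP; rewrite ?invr_eq0 lwt0.
- by move=> t c x y; rewrite /bco !mxE.
- by move=> s t; rewrite /bco mxE eqxx eq_sym.
- by move=> x; rewrite [LHS]row_sum_delta.
- by move=> i t x; rewrite /bco /= band_idemE.
- move=> t x; rewrite band_colour_co /bdr /bpv /bwt.
  have := blet_sign t; have := blet_sign (ord_pred t); rewrite /lsign.
  case: bpos => [/eqP <- /eqP <-|]; first by case: (blet _).2; case: (blet t).2; rewrite ?addr0.
  rewrite ordSK; case: (blet (ord_pred t)).2; case: (blet t).2;
    case: (blet (ord_pred t)).1.2; case: (blet t).1.2 => //=; by rewrite ?add0r ?addr0.
- move=> t x; rewrite band_colour_co /bdr /bnx /bwt.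
  have := blet_sign t; have := blet_sign (ord_pred t); rewrite /lsign.
  case: bpos => [/eqP <- /eqP <-|].
    by case: (blet (ord_pred t)).2; case: (blet t).2; rewrite ?addr0 ?add0r.
  rewrite invrK; case: (blet (ord_pred t)).2; case: (blet t).2;
    case: (blet (ord_pred t)).1.2; case: (blet t).1.2 => //=; by rewrite ?add0r ?addr0.
Qed.

(** Rescaling the nodes changes the weights but not their product around the band. A band read
    backwards has the inverse parameter. *)
Lemma prod_bwt : \prod_s bwt s = if bpos then lambda else lambda^-1.
Proof.
have lw c : (0 < r)%N -> \prod_s lwt c s = c.
  move=> r0; have r1 : (r.-1 < r)%N by rewrite prednK.
  rewrite (bigD1 (Ordinal r1)) //= /lwt /= prednK // eqxx big1 ?mulr1 // => s.
  by rewrite -(inj_eq val_inj) /= -(eqn_add2r 1) !addn1 prednK // => /negPf ->.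
have r0 : (0 < r)%N by have [_ h _ _] := band_seqP z; rewrite /r; case: (band_seq z) h.
rewrite /bwt; case: bpos; first exact: lw.
rewrite (reindex_inj (@ordS_inj r)) /=.
by under eq_bigr => s _ do rewrite ordSK; rewrite prodfV lw.
Qed.

End BandStrand.

(** * Crossings and semibricks *)

(* No common stretch s, ..., s_l which one strand enters and leaves from above,
   at both ends, while the other enters and leaves from below. *)
Definition uncrossed (T T' : Type) n (vx : T -> 'I_n) (dr : T -> bool) (nx pv : T -> T)
    (vx' : T' -> 'I_n) (dr' : T' -> bool) (nx' pv' : T' -> T') : Prop :=
  forall s s' l, vx s = vx' s' ->
    (forall m, (m < l)%N -> dr (iter m nx s) = dr' (iter m nx' s')) ->
    ~~ dr (pv s) -> dr' (pv' s') ->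
    dr (iter l nx s) -> ~~ dr' (iter l nx' s') -> False.

Definition bands_uncrossed n (z w : band n) : Prop :=
  uncrossed (@bvx n z) (@bdr n z) (@bnx n z) (@bpv n z)
            (@bvx n w) (@bdr n w) (@bnx n w) (@bpv n w).

Section Crossing.
Variables (k : fieldType) (n : nat) (z w : band n) (lambda mu : k).
Hypotheses (l0 : lambda != 0) (m0 : mu != 0).
Variables (s : 'I_(size z)) (s' : 'I_(size w)) (l : nat).
Hypothesis vs : bvx s = bvx s'.
Hypothesis drs : forall m, (m < l)%N -> bdr (iter m (@bnx n z) s) = bdr (iter m (@bnx n w) s').
Hypotheses (Ds : ~~ bdr (bpv s)) (Ds' : bdr (bpv s')).
Hypotheses (Dl : bdr (iter l (@bnx n z) s)) (Dl' : ~~ bdr (iter l (@bnx n w) s')).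

(** The arrows at the two ends lead out of the first stretch and into the second. The first behaves
    as a quotient of its module and the second as a submodule, so both sides of the boundary
    conditions vanish. *)
Lemma crossing_hom :
  exists f : 'Hom(band_module z 1 lambda, band_module w 1 mu), is_hom f /\
    bco (iter l (@bnx n w) s') (f (bnode lambda (iter l (@bnx n z) s))) != 0.
Proof.
have SB := band_strand_basis z l0; have SB' := band_strand_basis w m0.
have [|x|f [hf fE]] := chain_hom SB SB' vs drs.
- move=> x; rewrite (st_down SB) (negPf Ds) scale0r (down_node SB') (negPf Dl').
  by rewrite scaler0.
- rewrite (st_up SB) Dl mulr0 scale0r -[s']bpvK (up_node SB') Ds'.
  by rewrite scaler0.
exists f; split=> //; rewrite fE /chain_fun (co_sum SB') big_ord_recr /= big1 => [|[m ml] _ /=].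
  rewrite add0r (coZ SB') (st_co_e SB) (st_co_e SB') !eqxx !mulr1.
  exact: chain_coef_neq0 SB SB' _ _ _.
(* A long stretch may return to the same pair of nodes. It cannot return to the last pair, where the
   directions differ while they agree at every earlier position; so the coefficient read off there
   is a single term. *)
rewrite (coZ SB') (st_co_e SB) (st_co_e SB').
case: eqP => [e1|_]; last by rewrite mulr0 mul0r.
case: eqP => [e2|_]; last by rewrite mulr0.
by move: (drs ml); rewrite e1 -e2 Dl (negPf Dl').
Qed.

End Crossing.

Section Semibricks.
Variables (k : fieldType) (n : nat).
Implicit Types M N X Y : lmodule k n.

(** Replaces the coordinates of the iterated [dsum] by orthogonal idempotent endomorphisms, which
    can be transported along an isomorphism. *)
Definition biproduct X r (M : 'I_r -> lmodule k n) (E : 'I_r -> 'End(X)) : Prop :=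
  [/\ forall i, is_hom (E i), forall i j x, E i (E j x) = if i == j then E i x else 0,
      forall x, \sum_i E i x = x &
      forall i, exists (io : 'Hom(M i, X)) (pr : 'Hom(X, M i)),
        [/\ is_hom io, is_hom pr, forall x, pr (io x) = x & forall x, io (pr x) = E i x]].

Lemma dsum_biproduct r (M : 'I_r -> lmodule k n) :
  exists E : 'I_r -> 'End(\dsum_(i < r) M i), biproduct M E.
Proof.
elim: r M => [|r IH] M.
  exists (fun=> 0); split=> [[]//|[]//|x|[]//].
  rewrite big_ord0 in x *; by rewrite big_ord0; apply/esym/thinmx0.
rewrite big_ord_recl; have [E [Eh EE Es Eb]] := IH (fun i => M (lift ord0 i)).
set Y := \big[_/_]_(_ < _) _ in E Eh EE Es Eb *.
pose E' (i : 'I_r.+1) : 'End(dsum (M ord0) Y) :=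
  oapp (fun j => pair_end (0 : 'End(M ord0)) (E j)) (pair_end \1%VF (0 : 'End(Y))) (unlift ord0 i).
have E0 x : E' ord0 x = (x.1, 0) by rewrite /E' unlift_none /= pair_endE id_lfunE zero_lfunE.
have El j x : E' (lift ord0 j) x = (0, E j x.2) by rewrite /E' liftK /= pair_endE zero_lfunE.
have linl : linear (fun x : M ord0 => (x, 0) : dsum (M ord0) Y).
  by move=> c x y; congr pair; rewrite /= scaler0 addr0.
have linr : linear (fun x : Y => (0, x) : dsum (M ord0) Y).
  by move=> c x y; congr pair; rewrite /= scaler0 addr0.
have [il ilE] := lfun_of_linear linl; have [ir irE] := lfun_of_linear linr.
have linf : linear (fun x : dsum (M ord0) Y => x.1) by [].
have lins : linear (fun x : dsum (M ord0) Y => x.2) by [].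
have [pf pfE] := lfun_of_linear linf; have [ps psE] := lfun_of_linear lins.
have hil : is_hom il by apply: homP => [i x|c x]; rewrite !ilE ?idem_dsum ?colour_dsum /= linear0.
have hir : is_hom ir by apply: homP => [i x|c x]; rewrite !irE ?idem_dsum ?colour_dsum /= linear0.
have hpf : is_hom pf by apply: homP => [i x|c x]; rewrite !pfE ?idem_dsum ?colour_dsum.
have hps : is_hom ps by apply: homP => [i x|c x]; rewrite !psE ?idem_dsum ?colour_dsum.
exists E'; split.
- move=> i; apply: homP => [j x|c x]; rewrite ?idem_dsum ?colour_dsum;
  case: (unliftP ord0 i) => [l|] ->; rewrite ?E0 ?El ?idem_dsum ?colour_dsum /= ?linear0 //.
    by rewrite (Eh l).1.
  by rewrite hom_colour.
- move=> i j x; case: (unliftP ord0 i) => [a|] ->; case: (unliftP ord0 j) => [b|] ->;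
  rewrite ?E0 ?El /= ?linear0 ?eqxx ?(inj_eq lift_inj) //.
  by rewrite EE; case: ifP.
- move=> x; rewrite big_ord_recl E0 (eq_bigr (fun j => ir (E j x.2))) => [|j _].
    by rewrite -(linear_sum ir) Es /= irE; case: x => a b; congr pair; rewrite /= ?addr0 ?add0r.
  by rewrite El irE.
move=> i; case: (unliftP ord0 i) => [a|] ->.
  have [io [pr [hio hpr K1 K2]]] := Eb a.
  exists (ir \o io)%VF, (pr \o ps)%VF; split; rewrite ?hom_comp //; try exact: hom_comp.
    by move=> x; rewrite !comp_lfunE psE irE K1.
  by move=> x; rewrite !comp_lfunE psE K2 irE El.
exists il, pf; split=> // x; first by rewrite pfE ilE.
by rewrite ilE pfE E0.
Qed.

(** The module is isomorphic to a sum of bricks without morphisms between them, so its endomorphism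
    ring is a product of copies of [k], hence commutative. The idempotents of any other
    decomposition are then central, and a morphism between two of its summands is zero. *)
Lemma semibrick_summands r (M : 'I_r -> lmodule k n) :
  band_semibrick (\dsum_(i < r) M i) ->
  forall i j, i != j -> forall f : 'Hom(M i, M j), is_hom f -> f = 0.
Proof.
case=> q [B [Bb Bo /iso_inv[u [u' [hu hu' uK u'K]]]]] i j ij f hf.
have [E [Eh EE Es Eb]] := dsum_biproduct M.
have [G [Gh GG Gs Gb]] := dsum_biproduct B.
have scal (ps : 'End(\dsum_(a < q) B a)) : is_hom ps ->
    exists c : 'I_q -> k, forall y, ps y = \sum_a c a *: G a y.
  move=> hps.
  have diag a : exists c : k, forall y, G a (ps (G a y)) = c *: G a y.
    have [io [pr [hio hpr K1 K2]]] := Gb a.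
    have [_ /(_ (pr \o (ps \o io))%VF)[|c cE]] := (Bb a).1.
      by apply: hom_comp => //; apply: hom_comp.
    exists c => y; have := congr1 (fun h : 'End(B a) => h (pr y)) cE.
    by rewrite !comp_lfunE scale_lfunE id_lfunE K2 => /(congr1 io); rewrite K2 linearZ /= K2.
  have off a b y : a != b -> G a (ps (G b y)) = 0.
    move=> ab; have [io [pr [hio hpr K1 K2]]] := Gb b.
    have [io' [pr' [hio' hpr' K1' K2']]] := Gb a.
    have ba : b != a by rewrite eq_sym.
    have := Bo _ _ ba (pr' \o (ps \o io))%VF.
    case/(_ _)/Wrap => [|e]; first by apply: hom_comp => //; apply: hom_comp.
    have := congr1 (fun h : 'Hom(B b, B a) => io' (h (pr y))) e.
    by rewrite !comp_lfunE zero_lfunE linear0 K2 K2'.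
  have [c cE] := fin_all_exists diag; exists c => y.
  rewrite -{1}[y]Gs linear_sum -[LHS]Gs; apply: eq_bigr => a _.
  rewrite linear_sum (bigD1 a) //= cE big1 ?addr0 // => b ba.
  by rewrite off // eq_sym.
have comm (p1 p2 : 'End(\dsum_(a < q) B a)) y : is_hom p1 -> is_hom p2 -> p1 (p2 y) = p2 (p1 y).
  have Gsum a (c : 'I_q -> k) x : G a (\sum_b c b *: G b x) = c a *: G a x.
    rewrite linear_sum (bigD1 a) //= linearZ /= GG eqxx big1 ?addr0 // => b ba.
    by rewrite linearZ /= GG eq_sym (negPf ba) scaler0.
  move=> /scal[c1 E1] /scal[c2 E2]; rewrite !E1 !E2; apply: eq_bigr => a _.
  by rewrite !Gsum !scalerA mulrC.
have [io [pr [hio hpr K1 K2]]] := Eb i.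
have [io' [pr' [hio' hpr' K1' K2']]] := Eb j.
pose ph := (io' \o (f \o pr))%VF.
have hph : is_hom ph by apply: hom_comp => //; apply: hom_comp.
have phE x : ph (E i x) = E i (ph x).
  have := comm (u \o (ph \o u'))%VF (u \o (E i \o u'))%VF (u x).
  rewrite !comp_lfunE !uK => H; apply: (can_inj uK); apply: H.
    by apply: hom_comp => //; apply: hom_comp.
  by apply: hom_comp => //; apply: hom_comp.
apply/lfunP => x; rewrite zero_lfunE; have := congr1 pr' (phE (io x)).
rewrite -K2 !comp_lfunE !K1 !K1' => ->.
have -> : io' (f x) = E j (io' (f x)) by rewrite -K2' K1'.
by rewrite EE (negPf ij) linear0.
Qed.

Lemma semibrick_uncrossed r (F : 'I_r -> band n) (la : 'I_r -> k) :
  (forall i, brick_family k (F i)) -> torus la ->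
  band_semibrick (\dsum_(i < r) band_module (F i) 1 (la i)) ->
  forall i j, bands_uncrossed (F i) (F j).
Proof.
move=> Fb la0 sX i j s s' l vs drs Ds Ds' Dl Dl'.
have [f [hf fn0]] := crossing_hom (la0 i) (la0 j) vs drs Ds Ds' Dl Dl'.
case: (eqVneq i j) => [ij|ij]; last first.
  by move: fn0; rewrite (semibrick_summands sX ij hf) zero_lfunE /bco mxE eqxx.
case: j / ij in s' vs drs Ds' Dl' f hf fn0 *.
have [_ /(_ f hf)[c fE]] := Fb i _ (la0 i).
move: fn0; rewrite fE scale_lfunE id_lfunE (coZ (band_strand_basis _ (la0 i))).
rewrite (st_co_e (band_strand_basis _ (la0 i))).
(* A scalar endomorphism has only diagonal coefficients, and the two end nodes are distinct since
   they are left in different directions. *)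
have [e|_] := eqVneq (iter l _ s') (iter l _ s); last by rewrite mulr0 eqxx.
by move=> _; move: Dl'; rewrite e Dl.
Qed.

Lemma jordan_comm m (c : k) : jordan m c *m jordan m 0 = jordan m 0 *m jordan m c.
Proof.
have -> : jordan m c = c%:M + jordan m 0.
  by apply/matrixP => i j; rewrite !mxE mul0rn add0r.
by rewrite mulmxDl mulmxDr mul_scalar_mx mul_mx_scalar.
Qed.

Lemma brick_iso M N : is_iso M N -> brick M -> brick N.
Proof.
case/iso_inv=> f [g [hf hg fK gK]] [dM bM]; split=> [d0|h hh].
  apply: dM; have := limg_ker_dim f {: M}%VS.
  have -> : lker f = 0%VS.
    by apply/eqP/lker0P => x y e; rewrite -[x]fK e fK.
  rewrite capv0 dimv0 add0n => <-; apply/eqP; rewrite -leqn0 -d0.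
  by apply: dimvS; apply: subvf.
have [|c cE] := bM (g \o (h \o f))%VF.
  by apply: hom_comp => //; apply: hom_comp.
exists c; apply/lfunP => x; have := congr1 (fun h : 'End(M) => f (h (g x))) cE.
by rewrite !comp_lfunE !gK !scale_lfunE !id_lfunE linearZ /= gK.
Qed.

(* Left multiplication by the nilpotent Jordan block is an endomorphism. *)
Lemma band_module_brick (z : band n) m (la : k) : (0 < m)%N ->
  brick (band_module z m la) -> m = 1%N.
Proof.
case: m => [//|[//|m]] _ [_ bM].
have lf : linear (fun x : band_module z m.+2 la => jordan m.+2 0 *m (x : 'M[k]_(m.+2, size z))).
  by move=> c x y; rewrite mulmxDr -scalemxAr.
have [f fE] := lfun_of_linear lf.
have [|c cE] := bM f.
  split=> [i x|a x]; rewrite !fE.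
    apply/matrixP => t s; rewrite /= band_idemE !mxE.
    rewrite (eq_bigr (fun j => if bvertex s == i
      then jordan m.+2 0 t j * (x : 'M[k]_(m.+2, size z)) j s else 0)).
      by case: ifP => _; rewrite // big1.
    by move=> j _; rewrite band_idemE; case: ifP; rewrite ?mulr0.
  rewrite /= !band_arrE /band_arr_fun mulmx_sumr; apply: eq_bigr => s _.
  have bs (d : k) : bscalar m.+2 d s *m jordan m.+2 0 = jordan m.+2 0 *m bscalar m.+2 d s.
    by rewrite /bscalar; case: ifP => _; rewrite ?mulmx1 ?mul1mx // jordan_comm.
  by case: ifP => _; [|case: ifP => _]; rewrite ?mulmx0 // !mulmxA bs.
have r0 : (0 < size z)%N by have [_ h _ _] := band_seqP z; case: (band_seq z) h.
pose s0 := Ordinal r0; pose i1 : 'I_m.+2 := lift ord0 ord0.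
have := congr1 (fun h : 'End(band_module z m.+2 la) =>
  (h (delta_mx i1 s0 : 'M[k]_(m.+2, size z)) : 'M[k]_(m.+2, size z)) ord0 s0) cE.
rewrite fE scale_lfunE id_lfunE !mxE (bigD1 i1) //= big1 => [|j /negPf ji].
  rewrite !mxE !eqxx /= mulr0 mulr1 addr0 mul0rn add0r => /eqP.
  by rewrite oner_eq0.
by rewrite !mxE ji mulr0.
Qed.

Lemma band_has_strand (z : band n) (la : k) : la != 0 ->
  has_strand (band_module z 1 la) (descents (@bvx n z) (@bdr n z)).
Proof.
move=> la0; exists 'I_(size z), (@bvx n z), (@bdr n z), (@bnx n z), (@bpv n z), (@bwt n z k la),
  (@bco n z k la), (@bnode n z k la).
by split=> //; apply: band_strand_basis.
Qed.

Lemma semibrick_has_strand X : band_semibrick X -> exists a, has_strand X a.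
Proof.
case=> r [B [Bb _ XB]].
have H i : exists a : nat -> nat, has_strand (B i) a.
  have [br [z [m [la [mp la0 iz]]]]] := Bb i.
  have m1 := band_module_brick mp (brick_iso iz br); rewrite m1 in iz.
  by eexists; apply: has_strand_iso (iso_sym iz) _; apply: band_has_strand.
have [a Ha] := fin_all_exists H.
by eexists; apply: has_strand_iso (iso_sym XB) _; apply: has_strand_sum Ha.
Qed.

Lemma gvector_partial_sums X a g l : has_strand X a -> gvector X g -> (l <= n)%N ->
  \sum_(i < n | (i < l)%N) g i = - (a l)%:Z.
Proof.
move=> Ha /(has_strand_gvector _ Ha) gE ln.
rewrite (eq_bigr (fun i : 'I_n => (fun j => (a j)%:Z - (a j.+1)%:Z) i)) //.
rewrite -(big_ord_widen n (fun j => (a j)%:Z - (a j.+1)%:Z) ln).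
rewrite -(big_mkord xpredT (fun j => (a j)%:Z - (a j.+1)%:Z)).
rewrite (eq_bigr (fun j => - ((a j.+1)%:Z - (a j)%:Z))) => [|j _]; last by rewrite opprB.
rewrite sumrN telescope_sumr // (has_strand_ends Ha).1 subr0 //.
Qed.

End Semibricks.

(** * Counting words *)

Record strand_shape (T : Type) n (vx : T -> 'I_n) (dr : T -> bool) (nx pv : T -> T) : Prop :=
  StrandShape {
    sh_nxK : cancel nx pv;
    sh_pvK : cancel pv nx;
    sh_step : forall t, if dr t then vx t = (vx (nx t)).+1 :> nat
                        else vx (nx t) = (vx t).+1 :> nat }.

Section Words.
Variables (n : nat) (T : finType) (vx : T -> 'I_n) (dr : T -> bool) (nx pv : T -> T).
Hypothesis SH : strand_shape vx dr nx pv.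

Definition word L t : seq bool := mkseq (fun m => dr (iter m nx t)) L.

Lemma wordS L t : word L.+1 t = rcons (word L t) (dr (iter L nx t)).
Proof. by rewrite /word mkseqS. Qed.

Lemma wordSl L t : word L.+1 t = dr t :: word L (nx t).
Proof.
rewrite /word /mkseq /= (iotaDl 1 0 L) -map_comp; congr (_ :: _).
by apply: eq_map => m /=; rewrite -iterSr.
Qed.

(* occ v w counts the occurrences of the word w starting at the vertex v, and
   occ_after c v w those which are preceded by the letter c. *)
Definition occ (v : nat) (w : seq bool) : nat :=
  #|[pred t | (vx t == v :> nat) && (word (size w) t == w)]|.
Definition occ_after c (v : nat) (w : seq bool) : nat :=
  #|[pred t | [&& dr (pv t) == c, vx t == v :> nat & word (size w) t == w]]|.

Lemma occ_rcons v w : occ v w = (occ v (rcons w true) + occ v (rcons w false))%N.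
Proof.
rewrite /occ -(cardID [pred t | dr (iter (size w) nx t)]); congr (_ + _)%N;
  apply: eq_card => t; rewrite !inE size_rcons wordS eqseq_rcons;
  case: (dr _); rewrite ?andbT ?andbF //=; exact: andbT.
Qed.

Lemma occ_after_rcons c v w :
  occ_after c v w = (occ_after c v (rcons w true) + occ_after c v (rcons w false))%N.
Proof.
rewrite /occ_after -(cardID [pred t | dr (iter (size w) nx t)]); congr (_ + _)%N;
  apply: eq_card => t; rewrite !inE size_rcons wordS eqseq_rcons;
  case: (dr (iter _ _ _)); rewrite ?andbT ?andbF //=; exact: andbT.
Qed.

Lemma occ_cons v w : occ v w = (occ_after true v w + occ_after false v w)%N.
Proof.
rewrite /occ /occ_after -(cardID [pred t | dr (pv t)]); congr (_ + _)%N; apply: eq_card => t;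
  by rewrite !inE; case: (dr (pv t)); rewrite ?andbT ?andbF.
Qed.

Let nxK := sh_nxK SH.
Let pvK := sh_pvK SH.

Lemma occ_afterT v w : occ_after true v w = occ v.+1 (true :: w).
Proof.
apply: esym; rewrite /occ /occ_after -(card_image (can_inj nxK)); apply: eq_card => t.
rewrite -(pvK t) mem_image ?inE; last exact: can_inj nxK.
rewrite nxK wordSl eqseq_cons pvK; have := sh_step SH (pv t); rewrite pvK.
by case: (dr (pv t)) => //= [->|_]; rewrite ?eqSS ?andbF.
Qed.

Lemma occ_afterF v w : occ_after false v.+1 w = occ v (false :: w).
Proof.
apply: esym; rewrite /occ /occ_after -(card_image (can_inj nxK)); apply: eq_card => t.
rewrite -(pvK t) mem_image ?inE; last exact: can_inj nxK.
rewrite nxK wordSl eqseq_cons pvK; have := sh_step SH (pv t); rewrite pvK.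
by case: (dr (pv t)) => //= [_|->]; rewrite ?eqSS ?andbF.
Qed.

Lemma occ_afterF0 w : occ_after false 0 w = 0%N.
Proof.
apply: eq_card0 => t; rewrite !inE; have := sh_step SH (pv t); rewrite pvK.
by case: (dr (pv t)) => // ->.
Qed.

Lemma occ0T w : occ 0 (true :: w) = 0%N.
Proof.
apply: eq_card0 => t; rewrite !inE /= wordSl eqseq_cons; have := sh_step SH t.
by case: (dr t) => [->|]; rewrite ?andbF.
Qed.

Lemma occ_descents v : occ v [:: true] = descents vx dr v.
Proof.
by apply: eq_card => t; rewrite !inE /word /= eqseq_cons eqb_id eqxx andbT andbC.
Qed.

Hypothesis uc : uncrossed vx dr nx pv vx dr nx pv.

Lemma occ_uncrossed v w :
  occ_after false v (rcons w true) = 0%N \/ occ_after true v (rcons w false) = 0%N.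
Proof.
case: (posnP (occ_after false v (rcons w true))) => [->|/card_gt0P[s sP]]; first by left.
case: (posnP (occ_after true v (rcons w false))) => [->|/card_gt0P[s' sP']]; first by right.
move: sP sP'; rewrite !inE !size_rcons !wordS !eqseq_rcons.
case/and4P=> /eqP D /eqP vs /eqP ws /eqP Dl; case/and4P=> /eqP D' /eqP vs' /eqP ws' /eqP Dl'.
case: (uc (s := s) (s' := s') (l := size w)).
- by apply: val_inj; rewrite /= vs vs'.
- move=> m mw; have := congr1 (fun u => nth true u m) (etrans ws (esym ws')).
  by rewrite !nth_mkseq.
- by rewrite D.
- by rewrite D'.
- by rewrite Dl.
- by rewrite Dl'.
Qed.

End Words.

Section Determined.
Variables (n : nat) (T T' : finType).
Variables (vx : T -> 'I_n) (dr : T -> bool) (nx pv : T -> T).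
Variables (vx' : T' -> 'I_n) (dr' : T' -> bool) (nx' pv' : T' -> T').
Hypotheses (SH : strand_shape vx dr nx pv) (SH' : strand_shape vx' dr' nx' pv').
Hypotheses (uc : uncrossed vx dr nx pv vx dr nx pv)
           (uc' : uncrossed vx' dr' nx' pv' vx' dr' nx' pv').
Hypothesis desc : forall j, descents vx dr j = descents vx' dr' j.

Local Notation O := (occ vx dr nx).
Local Notation O' := (occ vx' dr' nx').
Local Notation A := (occ_after vx dr nx pv).
Local Notation A' := (occ_after vx' dr' nx' pv').

(** As many steps enter a vertex as leave it. The descents being given, the ascents are found from
    the lowest vertex upwards. *)
Lemma occ1_determined v d : O v [:: d] = O' v [:: d].
Proof.
case: d; first by rewrite !occ_descents desc.
have aT u : A true u [::] = A' true u [::].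
  by rewrite !(occ_afterT SH, occ_afterT SH') !occ_descents desc.
elim: v => [|v IH].
  have := occ_rcons vx dr nx 0 [::]; have := occ_rcons vx' dr' nx' 0 [::].
  rewrite (occ_cons vx dr nx pv) (occ_cons vx' dr' nx' pv') aT.
  rewrite (occ_afterF0 SH) (occ_afterF0 SH') /= !occ_descents desc; lia.
have := occ_rcons vx dr nx v.+1 [::]; have := occ_rcons vx' dr' nx' v.+1 [::].
rewrite (occ_cons vx dr nx pv) (occ_cons vx' dr' nx' pv') aT.
rewrite (occ_afterF SH) (occ_afterF SH') /= !occ_descents desc IH; lia.
Qed.

Lemma occ_determined v w : O v w = O' v w.
Proof.
have [L] := ubnP (size w); elim: L => // L IH in v w *; rewrite ltnS => wL.
have H0 u : O u [::] = O' u [::].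
  by rewrite occ_rcons [RHS]occ_rcons !occ1_determined.
case: w wL => [//|c w]; case/lastP: w => [|w d] /= wL; first exact: occ1_determined.
rewrite size_rcons in wL.
have AE b u x : (size x < L.-1)%N -> A b u x = A' b u x.
  move=> xL; case: b; first by rewrite (occ_afterT SH) (occ_afterT SH') IH //=; lia.
  case: u => [|u]; first by rewrite (occ_afterF0 SH) (occ_afterF0 SH').
  by rewrite (occ_afterF SH) (occ_afterF SH') IH //=; lia.
have key b u e : A b u (rcons w e) = A' b u (rcons w e).
  have h1 : A true u w = A' true u w by apply: AE; lia.
  have h2 : A false u w = A' false u w by apply: AE; lia.
  have h3 : O u (rcons w true) = O' u (rcons w true) by apply: IH; rewrite size_rcons; lia.
  have h4 : O u (rcons w false) = O' u (rcons w false) by apply: IH; rewrite size_rcons; lia.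
  move: h1 h2 h3 h4; rewrite !(occ_after_rcons _ _ _ _ _ _ w).
  rewrite !(occ_cons vx dr nx pv) !(occ_cons vx' dr' nx' pv').
  (* The 2 by 2 tables of counts for the two collections have equal row and column sums, so their
     off-diagonal entries differ by a common amount. Each table has a zero off the diagonal, and
     non-negativity forces this amount to be zero. *)
  case: b; case: e; case: (occ_uncrossed uc u w) (occ_uncrossed uc' u w) => z1 [] z2; lia.
case: c.
  case: v => [|v]; first by rewrite (occ0T SH) (occ0T SH').
  by rewrite -(occ_afterT SH) -(occ_afterT SH') key.
by rewrite -(occ_afterF SH) -(occ_afterF SH') key.
Qed.

End Determined.

(** * Bands with a common itinerary *)

Section Itineraries.
Variable n : nat.
Implicit Types z w y : band n.

(** Nodes with the same infinite word; by periodicity their pasts agree as well. *)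
Definition same_itin z w (s : 'I_(size z)) (t : 'I_(size w)) : Prop :=
  bvx s = bvx t /\ forall m, bdr (iter m (@bnx n z) s) = bdr (iter m (@bnx n w) t).

Lemma same_itin_sym z w s t : @same_itin z w s t -> @same_itin w z t s.
Proof. by case=> a b; split=> [|m]; rewrite ?a ?b. Qed.

Lemma same_itin_trans z w y s t u :
  @same_itin z w s t -> @same_itin w y t u -> @same_itin z y s u.
Proof. by move=> [a b] [c d]; split=> [|m]; rewrite ?a ?c ?b ?d. Qed.

Lemma same_itin_iter z w s t m : @same_itin z w s t ->
  same_itin (iter m (@bnx n z) s) (iter m (@bnx n w) t).
Proof.
case=> a b; split=> [|j]; last by rewrite -!iterD b.
elim: m => [//|m IH]; apply: val_inj => /=.
have := bstep (iter m (@bnx n z) s); have := bstep (iter m (@bnx n w) t).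
rewrite -b IH; case: (bdr _) => e1 e2; last by rewrite e1 e2.
by apply: succn_inj; rewrite -e1 -e2.
Qed.

Lemma same_itin_eq z s t : @same_itin z z s t -> s = t.
Proof. by case; exact: band_rigid. Qed.

Lemma bnx_period z (s : 'I_(size z)) m : iter m (@bnx n z) s = s -> (size z %| m)%N.
Proof.
have H (t : 'I_(size z)) : iter m (@ordS _) t = t -> (size z %| m)%N.
  move/(congr1 val); rewrite val_iter_ordS => e.
  by rewrite -[m]subn0 -eqn_mod_dvd // -(eqn_modDl t) addn0 e modn_small.
rewrite /bnx; case: bpos; first exact: H.
by move=> e; apply: (H s); rewrite -{1}e (iter_can m (@ord_predK _)).
Qed.

(** By rigidity the length of a band is the exact period of its itinerary. *)
Lemma same_itin_size z w s t : @same_itin z w s t -> size z = size w.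
Proof.
move=> st; apply/eqP; rewrite eqn_dvd; apply/andP; split.
  apply: (@bnx_period z s); apply: same_itin_eq.
  apply: (same_itin_trans _ (same_itin_sym st)); have := same_itin_iter (size w) st.
  by rewrite (iter_bnx_size t).
apply: (@bnx_period w t); apply: same_itin_eq.
apply: (same_itin_trans _ st); have := same_itin_iter (size z) (same_itin_sym st).
by rewrite (iter_bnx_size s).
Qed.

Lemma iter_bnx_inj z (s : 'I_(size z)) : injective (fun m : 'I_(size z) => iter m (@bnx n z) s).
Proof.
have H (a b : 'I_(size z)) : (a <= b)%N -> iter a (@bnx n z) s = iter b (@bnx n z) s -> a = b.
  move=> ab e; apply/val_inj/eqP; rewrite /= eqn_leq ab -subn_eq0.
  have d : (size z %| b - a)%N.
    apply: (@bnx_period z s); apply: (can_inj (iter_can a (@bnxK n z))).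
    by rewrite -iterD subnKC.
  case: (posnP (b - a)) => // ba; have := dvdn_leq ba d.
  by rewrite leqNgt (leq_ltn_trans (leq_subr _ _)).
move=> a b /= e; case: (leqP a b) => ab; first exact: H.
by apply/esym/H => //; exact: ltnW.
Qed.

(** The length is a separate variable [r], so that sums over two bands of equal length can share one
    range. *)
Lemma big_orbit (R : Type) (idx : R) (op : Monoid.com_law idx) z (s : 'I_(size z))
    (c : 'I_(size z) -> R) r : r = size z ->
  \big[op/idx]_(m < r) c (iter m (@bnx n z) s) = \big[op/idx]_t c t.
Proof. by move=> ->; rewrite [RHS](reindex_inj (@iter_bnx_inj z s)). Qed.

Section Isomorphism.
Variables (k : fieldType) (z w : band n) (s : 'I_(size z)) (t : 'I_(size w)).
Hypothesis st : same_itin s t.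
Variables (la mu : k).
Hypotheses (la0 : la != 0) (mu0 : mu != 0).
Hypothesis prods : \prod_(u < size z) bwt la u = \prod_(u < size w) bwt mu u.

Let SZ := band_strand_basis z la0.
Let SW := band_strand_basis w mu0.
Let M := band_module z 1 la.
Let N := band_module w 1 mu.

Definition cyc_coef m := chain_coef (@bnx n z) (@bwt n z k la) (@bnx n w) (@bwt n w k mu) s t m.

(** The chain map over a whole period, whose two ends are adjacent. Equal products of weights bring
    the coefficient back to one after a full turn, so the boundary terms match. *)
Lemma cyc_hom r : r = size z -> exists f : 'Hom(M, N), is_hom f /\
  forall x, f x = \sum_(m < r) (cyc_coef m * bco (iter m (@bnx n z) s) x)
                   *: bnode mu (iter m (@bnx n w) t).
Proof.
move=> ->; have r0 : (0 < size z)%N by apply: leq_ltn_trans (ltn_ord s).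
have zw := same_itin_size st.
pose l := (size z).-1; have lz : l.+1 = size z by rewrite prednK.
have sl : @bnx n z (iter l (@bnx n z) s) = s by rewrite -iterS lz iter_bnx_size.
have tl : @bnx n w (iter l (@bnx n w) t) = t by rewrite -iterS lz zw iter_bnx_size.
have [vs drs] := st.
have c1 : cyc_coef l * (bwt mu (iter l (@bnx n w) t) / bwt la (iter l (@bnx n z) s)) = 1.
  rewrite -chain_coefS lz /chain_coef big_split /= prodfV (big_orbit _ s) //.
  rewrite (big_orbit _ t (@bwt n w k mu) zw) prods divff //.
  by apply/prodf_neq0 => u _; exact: st_wt SW u.
have c2 : cyc_coef l * bwt mu (iter l (@bnx n w) t) = bwt la (iter l (@bnx n z) s).
  by rewrite -[RHS]mul1r -c1 -!mulrA mulVf ?mulr1 //; exact: st_wt SZ _.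
have [|x|f [hf fE]] := chain_hom SZ SW vs (l := l) (fun m _ => drs m).
- move=> x; rewrite (st_down SZ) (down_node SW) -drs tl -{1 2 3}sl bnxK.
  case: ifP => _; last by rewrite scale0r scaler0.
  by rewrite scalerA -[chain_coef _ _ _ _ _ _ _]/(cyc_coef l) mulrAC c2.
- have -> : colour N false (bnode mu t) = if bdr (iter l (@bnx n w) t) then 0
      else (bwt mu (iter l (@bnx n w) t))^-1 *: bnode mu (iter l (@bnx n w) t).
    by rewrite -(up_node SW) tl.
  rewrite (st_up SZ) sl -drs.
  case: ifP => _; first by rewrite mulr0 scale0r scaler0.
  rewrite scalerA -[chain_coef _ _ _ _ _ _ _]/(cyc_coef l); congr (_ *: _).
  rewrite mulrA mulrC; congr (_ * _).
  rewrite -c2 invfM mulrA divff ?mul1r //; exact: (chain_coef_neq0 SZ SW).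
by exists f; split=> // x; rewrite fE /chain_fun lz.
Qed.

End Isomorphism.

Lemma cyc_cancel (k : fieldType) z w (s : 'I_(size z)) (t : 'I_(size w)) (la mu : k)
    (c c' : nat -> k) r (f : 'Hom(band_module z 1 la, band_module w 1 mu))
    (g : 'Hom(band_module w 1 mu, band_module z 1 la)) :
  la != 0 -> mu != 0 -> r = size z -> r = size w ->
  (forall x, f x = \sum_(m < r) (c m * bco (iter m (@bnx n z) s) x)
                    *: bnode mu (iter m (@bnx n w) t)) ->
  (forall x, g x = \sum_(m < r) (c' m * bco (iter m (@bnx n w) t) x)
                    *: bnode la (iter m (@bnx n z) s)) ->
  (forall m, c' m * c m = 1) -> cancel f g.
Proof.
move=> la0 mu0 rz rw fE gE cc x.
have SZ := band_strand_basis z la0; have SW := band_strand_basis w mu0.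
rewrite [RHS](st_decomp SZ) -(big_orbit _ s _ rz) gE; apply: eq_bigr => m _; congr (_ *: _).
rewrite fE (co_sum SW) (bigD1 m) //= big1 => [|m' m'm].
  by rewrite addr0 (coZ SW) (st_co_e SW) eqxx mulr1 mulrA cc mul1r.
rewrite (coZ SW) (st_co_e SW); case: eqP => [e|_]; last by rewrite mulr0.
case/eqP: m'm; move: m m' e; rewrite {fE gE}; move: rw {rz} => -> m m' e.
by apply: (@iter_bnx_inj w t).
Qed.

Lemma iso_of_itin (k : fieldType) z w s t : @same_itin z w s t -> forall la : k, la != 0 ->
  exists2 mu : k, mu != 0 & is_iso (band_module z 1 la) (band_module w 1 mu).
Proof.
move=> st la la0; pose La : k := \prod_(u < size z) bwt la u.
have La0 : La != 0 by apply/prodf_neq0 => u _; exact: st_wt (band_strand_basis z la0) u.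
(* Chosen so that the products of the weights of the two bands coincide, whatever the orientation of
   [w]. *)
pose mu := if bpos w then La else La^-1.
have mu0 : mu != 0 by rewrite /mu; case: ifP; rewrite ?invr_eq0.
have prods : \prod_(u < size z) bwt la u = \prod_(u < size w) bwt mu u.
  rewrite -/La (prod_bwt w) /mu. by case: (bpos w); rewrite ?invrK.
exists mu => //; have zw := same_itin_size st.
have [f [hf fE]] := cyc_hom st la0 mu0 prods (erefl _).
have [g [hg gE]] := cyc_hom (same_itin_sym st) mu0 la0 (esym prods) zw.
have coef_mul m : cyc_coef s t la mu m * cyc_coef t s mu la m = 1.
  rewrite /cyc_coef /chain_coef -big_split big1 // => i _ /=.
  rewrite mulrA mulfVK ?divff //.
    exact: st_wt (band_strand_basis w mu0) _.
  exact: st_wt (band_strand_basis z la0) _.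
exists f; split=> //; exists g.
  by apply: (cyc_cancel la0 mu0 _ zw fE gE) => // m; rewrite mulrC.
exact: (cyc_cancel mu0 la0 zw _ gE fE).
Qed.

Lemma same_family_of_itin (k : fieldType) z w s t : @same_itin z w s t -> same_family k z w.
Proof.
by move=> st; split=> la la0; [apply: iso_of_itin st _ la0 | apply: iso_of_itin (same_itin_sym st) _ la0].
Qed.

End Itineraries.

(** * Uniqueness of the collection of bands *)

Section Uniqueness.
Variable n : nat.

Definition node r (F : 'I_r -> band n) := {i : 'I_r & 'I_(size (F i))}.

Section Nodes.
Variables (r : nat) (F : 'I_r -> band n).
Definition nvx (t : node F) : 'I_n := bvx (tagged t).
Definition ndr (t : node F) : bool := bdr (tagged t).
Definition nnx (t : node F) : node F := Tagged _ (bnx (tagged t)).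
Definition npv (t : node F) : node F := Tagged _ (bpv (tagged t)).

Lemma node_shape : strand_shape nvx ndr nnx npv.
Proof.
split=> [[i s]|[i s]|[i s]].
- by rewrite /npv /nnx /= bnxK.
- by rewrite /npv /nnx /= bpvK.
- exact: bstep.
Qed.

Lemma iter_nnx m i s : iter m nnx (Tagged _ s : node F) = Tagged _ (iter m (@bnx n (F i)) s).
Proof. by elim: m => //= m ->. Qed.

Lemma node_uncrossed : (forall i j, bands_uncrossed (F i) (F j)) ->
  uncrossed nvx ndr nnx npv nvx ndr nnx npv.
Proof.
move=> H [i s] [j s'] l vs drs Ds Ds' Dl Dl'; apply: (H i j s s' l vs _ Ds Ds').
- by move=> m ml; have := drs m ml; rewrite !iter_nnx.
- by move: Dl; rewrite iter_nnx.
- by move: Dl'; rewrite iter_nnx.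
Qed.

Lemma node_descents j : descents nvx ndr j = (\sum_(i < r) descents (@bvx n (F i)) (@bdr n (F i)) j)%N.
Proof.
rewrite /descents -sum1_card.
under [RHS]eq_bigr => i _ do rewrite -sum1_card.
by rewrite sig_big_dep; apply: eq_bigl.
Qed.

End Nodes.

Definition lword L (z : band n) (s : 'I_(size z)) : L.-tuple bool :=
  [tuple bdr (iter m (@bnx n z) s) | m < L].

(** For [L] a positive common multiple of the lengths, a complete invariant of a band that does not
    depend on its starting point, with values in one finite type for all bands. *)
Definition key L (z : band n) : {set 'I_n * L.-tuple bool} :=
  [set (bvx s, lword L s) | s : 'I_(size z)].

Lemma lword_itin L (z w : band n) (s : 'I_(size z)) (t : 'I_(size w)) :
  (0 < L)%N -> (size z %| L)%N -> (size w %| L)%N ->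
  bvx s = bvx t -> lword L s = lword L t -> same_itin s t.
Proof.
move=> L0 zL wL vst e; split=> // m.
have per (y : band n) (u : 'I_(size y)) : (size y %| L)%N ->
    iter m (@bnx n y) u = iter (m %% L) (@bnx n y) u.
  move=> /dvdnP[q yL]; rewrite {1}(divn_eq m L) addnC iterD; congr (iter _ _ _).
  rewrite yL mulnA; elim: (m %/ _ * q)%N => // a IH.
  by rewrite mulSn iterD IH iter_bnx_size.
rewrite !per //; have := congr1 (fun x : L.-tuple bool => tnth x (Ordinal (ltn_pmod m L0))) e.
by rewrite !tnth_mktuple.
Qed.

Lemma itin_lword L (z w : band n) (s : 'I_(size z)) (t : 'I_(size w)) :
  same_itin s t -> lword L s = lword L t.
Proof. by case=> _ h; apply: eq_from_tnth => m; rewrite !tnth_mktuple h. Qed.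

Lemma itin_key L (z w : band n) (s : 'I_(size z)) (t : 'I_(size w)) :
  same_itin s t -> key L z = key L w.
Proof.
have sub (z1 w1 : band n) (s1 : 'I_(size z1)) (t1 : 'I_(size w1)) :
    same_itin s1 t1 -> key L z1 \subset key L w1.
  move=> st; apply/subsetP=> _ /imsetP[u _ ->]; have [m ->] := bnx_reach s1 u.
  have h := same_itin_iter m st; rewrite (itin_lword L h) h.1.
  by apply/imsetP; exists (iter m (@bnx n w1) t1).
by move=> st; apply/eqP; rewrite eqEsubset (sub _ _ _ _ st) (sub _ _ _ _ (same_itin_sym st)).
Qed.

Lemma word_node L r (F : 'I_r -> band n) i (t : 'I_(size (F i))) :
  word (@ndr r F) (@nnx r F) L (Tagged (fun i => 'I_(size (F i))) t) = lword L t.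
Proof.
rewrite /lword /= /word /mkseq -val_enum_ord -map_comp.
by apply: eq_map => m /=; rewrite iter_nnx.
Qed.

(** A band with the key of [z] contains a node with the itinerary of [s], and by rigidity only one.
    So bands are counted by the occurrences of a single word. *)
Lemma card_key L r (F : 'I_r -> band n) (z : band n) (s : 'I_(size z)) :
  (0 < L)%N -> (forall i, (size (F i) %| L)%N) -> (size z %| L)%N ->
  #|[pred i | key L (F i) == key L z]| = occ (@nvx r F) (@ndr r F) (@nnx r F) (bvx s) (lword L s).
Proof.
move=> L0 FL zL.
have inP (t : node F) : ((nvx t == bvx s :> nat) &&
      (word (@ndr r F) (@nnx r F) (size (lword L s)) t == lword L s)) ->
    same_itin (tagged t) s.
  case: t => i t /andP[/eqP /val_inj vt /eqP wt]; apply: (lword_itin L0) => //.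
  by move: wt; rewrite size_tuple word_node => /val_inj.
rewrite /occ -(card_in_imset (f := @tag _ _)) => [|[i t] [j u] ti uj /= ij].
  apply: eq_card => i; rewrite !inE; apply/eqP/imsetP => [e|[t /inP h ->]]; last first.
    exact: itin_key h.
  have : (bvx s, lword L s) \in key L (F i) by rewrite e; apply/imsetP; exists s.
  case/imsetP=> t _ /pair_equal_spec[vt wt]; exists (Tagged (fun i => 'I_(size (F i))) t : node F) => //.
  by rewrite inE size_tuple word_node -wt eqxx andbT /nvx vt.
case: j / ij u uj => u uj; congr (Tagged _ _); apply: same_itin_eq.
by apply: same_itin_trans (inP _ ti) (same_itin_sym (inP _ uj)).
Qed.

Lemma families_determined (k : fieldType) r r' (F : 'I_r -> band n) (F' : 'I_r' -> band n) :
  (forall i j, bands_uncrossed (F i) (F j)) -> (forall i j, bands_uncrossed (F' i) (F' j)) ->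
  (forall j, \sum_(i < r) descents (@bvx n (F i)) (@bdr n (F i)) j =
             \sum_(i < r') descents (@bvx n (F' i)) (@bdr n (F' i)) j)%N ->
  exists2 sigma : 'I_r' -> 'I_r, bijective sigma & forall i, same_family k (F' i) (F (sigma i)).
Proof.
move=> uF uF' dFF'.
have size0 (z : band n) : (0 < size z)%N.
  by have [_ h _ _] := band_seqP z; case: (band_seq z) h.
(* All lengths in both collections divide [L], so words of one length compare all the bands. *)
pose L := ((\prod_(i < r) size (F i)) * (\prod_(i < r') size (F' i)))%N.
have L0 : (0 < L)%N by rewrite muln_gt0 !prodn_gt0.
have FL i : (size (F i) %| L)%N by rewrite /L (bigD1 i) //= -mulnA dvdn_mulr.
have FL' i : (size (F' i) %| L)%N by rewrite /L [X in (_ * X)%N](bigD1 i) //= mulnCA dvdn_mulr.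
have occE v w : occ (@nvx r F) (@ndr r F) (@nnx r F) v w =
                occ (@nvx r' F') (@ndr r' F') (@nnx r' F') v w.
  apply: (occ_determined (node_shape F) (node_shape F')); try exact: node_uncrossed.
  by move=> j; rewrite !node_descents.
have cardE (z : band n) : (size z %| L)%N ->
    #|[pred i | key L (F' i) == key L z]| = #|[pred i | key L (F i) == key L z]|.
  by move=> zL; rewrite !(card_key (Ordinal (size0 z)) L0) // occE.
have [|h hb hE] := @fibre_bij _ _ _ (fun i => key L (F' i)) (fun i => key L (F i)).
  (* [cardE] speaks of keys of bands only. A value missed by [F'] is handled by applying it to a
     band of [F] with that key. *)
  move=> K; case: (posnP #|[pred i | key L (F' i) == K]|) => [e0|/card_gt0P[i]]; last first.
    by rewrite inE => /eqP <-; apply: cardE.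
  rewrite e0; apply/esym/eqP; rewrite -leqn0 leqNgt; apply/negP => /card_gt0P[i].
  rewrite inE => /eqP iK; move: e0; rewrite -iK cardE //.
  by move/eqP; rewrite -leqn0 leqNgt => /negP; apply; apply/card_gt0P; exists i; rewrite inE.
exists h => // i; pose s := Ordinal (size0 (F' i)).
have : (bvx s, lword L s) \in key L (F (h i)) by rewrite hE; apply/imsetP; exists s.
case/imsetP=> t _ /pair_equal_spec[vt wt]; apply: (same_family_of_itin _ (s := s) (t := t)).
exact: (lword_itin L0).
Qed.

End Uniqueness.

(** * Morphisms between uncrossed bands *)

Section HomSupport.
Variables (k : fieldType) (n : nat) (M N : lmodule k n) (T T' : finType).
Variables (vx : T -> 'I_n) (dr : T -> bool) (nx pv : T -> T) (wt : T -> k).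
Variables (co : T -> M -> k) (e : T -> M).
Variables (vx' : T' -> 'I_n) (dr' : T' -> bool) (nx' pv' : T' -> T') (wt' : T' -> k).
Variables (co' : T' -> N -> k) (e' : T' -> N).
Hypothesis SB : strand_basis vx dr nx pv wt co e.
Hypothesis SB' : strand_basis vx' dr' nx' pv' wt' co' e'.
Variable f : 'Hom(M, N).
Hypothesis hf : is_hom f.

Let c s s' := co' s' (f (e s)).

Lemma hom_coef_vx s s' : c s s' != 0 -> vx s = vx' s'.
Proof.
rewrite /c => cn0; apply/eqP; move: cn0; apply: contraNT => ne.
have : co' s' (f (idem M (vx s) (e s))) = co' s' (f (e s)) by rewrite (idem_node SB) eqxx.
by rewrite hf.1 (st_idem SB') eq_sym (negPf ne) => <-.
Qed.

Lemma hom_coef_down s s' :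
  (if dr s then wt s * c (nx s) (nx' s') else 0) = if dr' s' then wt' s' * c s s' else 0.
Proof.
have := congr1 (co' (nx' s')) (hom_colour hf true (e s)).
rewrite (down_node SB) (st_down SB') (st_nxK SB') => <-.
by case: ifP => _; rewrite ?linear0 ?(co0 SB') // linearZ /= (coZ SB').
Qed.

Lemma hom_coef_up s s' :
  (if dr s then 0 else (wt s)^-1 * c s s') =
  if dr' s' then 0 else (wt' s')^-1 * c (nx s) (nx' s').
Proof.
have := congr1 (co' s') (hom_colour hf false (e (nx s))).
rewrite (up_node SB) (st_up SB') => <-.
by case: ifP => _; rewrite ?linear0 ?(co0 SB') // linearZ /= (coZ SB').
Qed.

Lemma hom_coef_next s s' : dr s = dr' s' -> wt s * c (nx s) (nx' s') = wt' s' * c s s'.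
Proof.
move=> E; have := hom_coef_down s s'; have := hom_coef_up s s'; rewrite -E.
case: (dr s) => // /(congr1 (fun x => wt' s' * wt s * x)) H _; move: H.
rewrite mulrA mulfK ?(st_wt SB) // => ->.
by rewrite [wt' s' * _]mulrC mulrA mulfK ?(st_wt SB').
Qed.

Lemma hom_coef_next_neq0 s s' : dr s = dr' s' -> (c (nx s) (nx' s') != 0) = (c s s' != 0).
Proof.
move=> /hom_coef_next /(congr1 (fun x => x == 0)).
by rewrite !mulf_eq0 (negPf (st_wt SB s)) (negPf (st_wt SB' s')) /= => ->.
Qed.

(** If the source went up and the target down, alpha would kill the source node but not the
    component [s'] of its image. *)
Lemma hom_coef_diverge s s' : c s s' != 0 -> dr s != dr' s' -> dr s && ~~ dr' s'.
Proof.
have := hom_coef_down s s'; case: (dr s) (dr' s') => [] [] //= /esym /eqP.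
by rewrite mulf_eq0 (negPf (st_wt SB' s')) /= => /eqP ->; rewrite eqxx.
Qed.

(** If the source went down and the target up, alpha would reach [nx s] from [s], whereas no alpha
    ends at [nx s']. *)
Lemma hom_coef_converge s s' : c (nx s) (nx' s') != 0 -> dr s != dr' s' -> ~~ dr s && dr' s'.
Proof.
have := hom_coef_down s s'; case: (dr s) (dr' s') => [] [] //= /eqP.
by rewrite mulf_eq0 (negPf (st_wt SB s)) /= => /eqP ->; rewrite eqxx.
Qed.

Lemma hom_coef_iter s s' l : (forall m, (m < l)%N -> dr (iter m nx s) = dr' (iter m nx' s')) ->
  (c (iter l nx s) (iter l nx' s') != 0) = (c s s' != 0).
Proof.
elim: l => [//|l IH] H; rewrite !iterS hom_coef_next_neq0 ?H //.
by apply: IH => m ml; apply: H; exact: ltnW.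
Qed.

Hypothesis uc : uncrossed vx dr nx pv vx' dr' nx' pv'.
Variable P : nat.
Hypotheses (P0 : (0 < P)%N) (pT : forall s, iter P nx s = s) (pT' : forall s, iter P nx' s = s).

(** If the strands ever part, follow them to the nearest partings forwards and backwards.
    Coefficients stay non-zero in between, so both ends are as in a crossing. *)
Lemma hom_support s s' : c s s' != 0 -> forall m, dr (iter m nx s) = dr' (iter m nx' s').
Proof.
move=> cn0 m0; apply/eqP; apply: contraT => ne0.
have [l lP lmin] := @ex_minnP (fun m => dr (iter m nx s) != dr' (iter m nx' s')) (ex_intro _ m0 ne0).
have nxK := st_nxK SB; have nxK' := st_nxK SB'; have pvK := st_pvK SB; have pvK' := st_pvK SB'.
have per (U : Type) (h : U -> U) q u : iter P h u = u -> iter (P * q) h u = u.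
  by move=> hu; elim: q => [|q IH]; rewrite ?muln0 // mulnS iterD IH.
(* By periodicity, [l] steps forwards amount to a positive number of steps backwards, so the parting
   found ahead is also met in the past. *)
have back (U : Type) (h h' : U -> U) u : cancel h h' -> (forall v, iter P h v = v) ->
    iter l h u = iter (P * l.+1 - l) h' u.
  move=> hK hP; have le : (l <= P * l.+1)%N by nia.
  by rewrite -{2}(per _ h l.+1 u (hP u)) -{2}(subnK le) iterD (iter_can _ hK).
have Pl : (0 < P * l.+1 - l)%N by rewrite subn_gt0; nia.
have [|b bP bmin] := @ex_minnP (fun m => dr (iter m.+1 pv s) != dr' (iter m.+1 pv' s')).
  exists (P * l.+1 - l).-1; rewrite prednK //.
  by rewrite -(back _ nx pv) // -(back _ nx' pv').
(* [q] and [q'] begin the maximal common stretch, which ends [l + b] steps later. *)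
pose q := iter b pv s; pose q' := iter b pv' s'.
have qs m : (m <= b)%N -> iter m nx q = iter (b - m) pv s.
  by move=> mb; rewrite /q -{1}(subnKC mb) iterD (iter_can _ pvK).
have qs' m : (m <= b)%N -> iter m nx' q' = iter (b - m) pv' s'.
  by move=> mb; rewrite /q' -{1}(subnKC mb) iterD (iter_can _ pvK').
have agree m : (m < l + b)%N -> dr (iter m nx q) = dr' (iter m nx' q').
  move=> mlb; case: (ltnP m b) => mb.
    rewrite qs ?qs' 1?ltnW //; apply/eqP; apply: contraT => h.
    have := bmin (b - m).-1; rewrite prednK ?subn_gt0 // => /(_ h); lia.
  have -> : m = ((m - b) + b)%N by rewrite subnK.
  rewrite !iterD qs ?qs' // subnn /=; apply/eqP; apply: contraT => h.
  by have := lmin _ h; lia.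
have cq : c q q' != 0.
  rewrite -(hom_coef_iter (l := b)) => [|m mb]; first by rewrite qs ?qs' // subnn.
  by apply: agree; lia.
have sE : iter (l + b) nx q = iter l nx s by rewrite iterD qs // subnn.
have sE' : iter (l + b) nx' q' = iter l nx' s' by rewrite iterD qs' // subnn.
have /andP[D1 D2] : ~~ dr (pv q) && dr' (pv' q').
  by apply: hom_coef_converge => //; rewrite pvK pvK'.
have /andP[D3 D4] : dr (iter (l + b) nx q) && ~~ dr' (iter (l + b) nx' q').
  by apply: hom_coef_diverge; [rewrite hom_coef_iter | rewrite sE sE'].
by case: (uc (hom_coef_vx cq) agree D1 D2 D3 D4).
Qed.

End HomSupport.

Section BandHoms.
Variables (k : fieldType) (n : nat).
Implicit Types z w : band n.

Lemma band_size_gt0 z : (0 < size z)%N.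
Proof. by have [_ h _ _] := band_seqP z; case: (band_seq z) h. Qed.

Lemma band_hom_support z w (la mu : k) (f : 'Hom(band_module z 1 la, band_module w 1 mu)) s s' :
  la != 0 -> mu != 0 -> bands_uncrossed z w -> is_hom f ->
  bco s' (f (bnode la s)) != 0 -> same_itin s s'.
Proof.
move=> la0 mu0 uc hf cn0.
have SZ := band_strand_basis z la0; have SW := band_strand_basis w mu0.
split; first exact: hom_coef_vx SZ SW _ hf _ _ cn0.
apply: (hom_support SZ SW hf uc (P := size z * size w)) => // [|t|t].
- by rewrite muln_gt0 !band_size_gt0.
- by elim: (size w) => [|q IH]; rewrite ?muln0 // mulnS iterD IH iter_bnx_size.
- by rewrite mulnC; elim: (size z) => [|q IH]; rewrite ?muln0 // mulnS iterD IH iter_bnx_size.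
Qed.

(** A non-zero coefficient carried once around returns to itself, which forces the products of the
    weights to agree. For positive bands these products are the parameters themselves, so distinct
    parameters exclude it. *)
Lemma band_hom_eq0 z w (la mu : k) (f : 'Hom(band_module z 1 la, band_module w 1 mu)) :
  la != 0 -> mu != 0 -> la != mu -> bpos z -> bpos w -> bands_uncrossed z w ->
  is_hom f -> f = 0.
Proof.
move=> la0 mu0 lm pz pw uc hf.
have SZ := band_strand_basis z la0; have SW := band_strand_basis w mu0.
suff c0 s s' : bco s' (f (bnode la s)) = 0.
  apply/lfunP => x; rewrite zero_lfunE; apply: (co_ext SW) => s'; rewrite (co0 SW).
  rewrite (st_decomp SZ x) linear_sum (co_sum SW) big1 // => s _.
  by rewrite linearZ /= (coZ SW) c0 mulr0.
apply/eqP; apply: contraT => cn0.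
have st := band_hom_support la0 mu0 uc hf cn0; have zw := same_itin_size st.
have H m : (\prod_(i < m) bwt la (iter i (@bnx n z) s)) *
    bco (iter m (@bnx n w) s') (f (bnode la (iter m (@bnx n z) s))) =
    (\prod_(i < m) bwt mu (iter i (@bnx n w) s')) * bco s' (f (bnode la s)).
  elim: m => [|m IH]; first by rewrite !big_ord0.
  rewrite !big_ord_recr /= -mulrA (hom_coef_next SZ SW hf) ?st.2 //.
  by rewrite mulrCA IH mulrA; congr (_ * _); rewrite mulrC.
have e2 : iter (size z) (@bnx n w) s' = s' by rewrite zw iter_bnx_size.
have := H (size z); rewrite iter_bnx_size e2.
rewrite (big_orbit _ s _ (erefl _)) (big_orbit _ s' _ zw) !prod_bwt pz pw.
by move/(mulIf cn0)/eqP; rewrite (negPf lm).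
Qed.

(** Off-diagonal coefficients of an endomorphism vanish by [band_hom_support] and rigidity; the
    diagonal ones are constant along the band, the weights on both sides being the same. *)
Lemma band_module_is_brick z (la : k) : la != 0 -> bands_uncrossed z z ->
  brick (band_module z 1 la).
Proof.
move=> la0 uc; have SZ := band_strand_basis z la0; split=> [|f hf].
  by rewrite /= dimvf /dim /= mul1n; apply/eqP; rewrite -lt0n band_size_gt0.
pose s0 := Ordinal (band_size_gt0 z); exists (bco s0 (f (bnode la s0))).
have diag s : bco s (f (bnode la s)) = bco s0 (f (bnode la s0)).
  have [m ->] := bnx_reach s0 s; elim: m => [//|m IH]; rewrite iterS -IH.
  exact: (mulfI (st_wt SZ _) (hom_coef_next SZ SZ hf (erefl _))).
apply/lfunP => x; rewrite scale_lfunE id_lfunE; apply: (co_ext SZ) => t; rewrite (coZ SZ).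
rewrite {1}(st_decomp SZ x) linear_sum (co_sum SZ) (bigD1 t) //= linearZ /= (coZ SZ) diag.
rewrite mulrC big1 ?addr0 // => s st; rewrite linearZ /= (coZ SZ).
have [->|cn0] := eqVneq (bco t (f (bnode la s))) 0; first by rewrite mulr0.
by case/eqP: st; apply: same_itin_eq; exact: (band_hom_support la0 la0 uc hf cn0).
Qed.

End BandHoms.

(** * Construction of the bands *)

Section Levels.
Variables (n : nat) (H : nat -> nat).
Hypotheses (H0 : H 0%N = 0%N) (Hn : forall e, (n <= e)%N -> H e = 0%N).

(* The state (d, e, j) is the strand at level j < H e of the edge between the
   vertices e - 1 and e, followed downwards along alpha if d and upwards along
   beta otherwise.  A strand keeps its level as long as that level exists on the
   next edge; otherwise it turns, and turning reverses the order of the levels. *)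
Definition state := (bool * nat * nat)%type.

Definition valid (x : state) : bool := (x.2 < H x.1.2)%N.

(** The levels that turn are those of the edge [e] missing on the next edge; the formula is the
    order-reversing involution of this interval. *)
Definition snext (x : state) : state :=
  let: (d, e, j) := x in
  if d then
    if (j < H e.-1)%N then (true, e.-1, j) else (false, e, H e.-1 + H e - j.+1)%N
  else
    if (j < H e.+1)%N then (false, e.+1, j) else (true, e, H e + H e.+1 - j.+1)%N.

Definition svx (x : state) : nat := if x.1.1 then x.1.2 else x.1.2.-1.

Definition sflip (x : state) : state := (~~ x.1.1, x.1.2, x.2).

Lemma valid_edge x : valid x -> (0 < x.1.2 < n)%N.
Proof.
rewrite /valid; case: (posnP x.1.2) => [->|x0]; first by rewrite H0.
by move=> h; rewrite /= ltnNge; apply: contraL h => /Hn ->.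
Qed.

Lemma snext_valid x : valid x -> valid (snext x).
Proof.
move=> vx; have := valid_edge vx; move: vx.
case: x => [[d e] j]; rewrite /valid /= => je e0.
by case: d; [case: (ltnP j (H e.-1)) | case: (ltnP j (H e.+1))] => h /=; lia.
Qed.

(** Travelling in the opposite direction retraces the strand; hence the rule is injective on valid
    states. *)
Lemma snextK x : valid x -> sflip (snext (sflip (snext x))) = x.
Proof.
move=> vx; have := valid_edge vx; move: vx.
case: x => [[d e] j]; rewrite /valid /sflip /= => je e0.
case: d; [case: (ltnP j (H e.-1)) | case: (ltnP j (H e.+1))] => h /=.
- by rewrite prednK ?je //; lia.
- by rewrite ifF /=; [congr (_, _, _); lia | lia].
- by rewrite je.
- by rewrite ifF /=; [congr (_, _, _); lia | lia].
Qed.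

Lemma snext_step x : valid x ->
  if x.1.1 then svx x = (svx (snext x)).+1 else svx (snext x) = (svx x).+1.
Proof.
move=> vx; have := valid_edge vx; move: vx.
case: x => [[d e] j]; rewrite /valid /svx /= => je e0.
by case: d; [case: (ltnP j (H e.-1)) | case: (ltnP j (H e.+1))] => h /=; lia.
Qed.

(* x lies inside y on alpha-edges and outside y on beta-edges. *)
Definition below (x y : state) : bool :=
  [&& x.1 == y.1 & if x.1.1 then (x.2 < y.2)%N else (y.2 < x.2)%N].

(** Turning changes both the order of the levels and the colour that says how to read it, so the
    relation persists. *)
Lemma below_next x y : valid x -> valid y -> below x y ->
  (snext x).1.1 = (snext y).1.1 -> below (snext x) (snext y).
Proof.
move=> vx vy; have := valid_edge vx; have := valid_edge vy; move: vx vy.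
case: x y => [[d e] j] [[d' e'] j']; rewrite /valid /below /= => v1 v2 e1 e2.
case/andP=> /eqP[dd ee]; subst d' e'.
case: d.
  case: (ltnP j (H e.-1)) => h1; case: (ltnP j' (H e.-1)) => h2 //= h3 _; rewrite eqxx /=; lia.
case: (ltnP j (H e.+1)) => h1; case: (ltnP j' (H e.+1)) => h2 //= h3 _; rewrite eqxx /=; lia.
Qed.

(** On an alpha-edge the higher level turns up first; on a beta-edge it turns down first. *)
Lemma below_down x y : valid x -> valid y -> below x y ->
  (snext y).1.1 -> (snext x).1.1.
Proof.
case: x y => [[d e] j] [[d' e'] j']; rewrite /valid /below /= => v1 v2.
case/andP=> /eqP[dd ee]; subst d' e'.
case: d.
  by case: (ltnP j (H e.-1)) => h1; case: (ltnP j' (H e.-1)) => h2 //= h3 _; lia.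
by case: (ltnP j (H e.+1)) => h1; case: (ltnP j' (H e.+1)) => h2 //= h3 _; lia.
Qed.

(** A strand that turns stays on levels missing on the edge it has avoided, hence higher than those
    of a strand that passes through from there. Both cannot turn, as each of the two heights would
    have to exceed the other. *)
Lemma below_meet x y : valid x -> valid y -> ~~ x.1.1 -> y.1.1 ->
  svx (snext x) = svx (snext y) ->
  if (snext x).1.1 == (snext y).1.1 then below (snext y) (snext x)
  else ~~ (snext x).1.1 && (snext y).1.1.
Proof.
move=> vx vy; have := valid_edge vx; have := valid_edge vy; move: vx vy.
case: x y => [[d e] j] [[d' e'] j']; rewrite /valid /below /svx /= => v1 v2 e1 e2.
case: d d' => [] [] //= _ _ h; have {h} ee : e' = e.+1.
  by move: h; case: (j < _)%N; case: (j' < _)%N => /=; lia.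
subst e'; rewrite /=; case: (ltnP j (H e.+1)) => h1; case: (ltnP j' (H e)) => h2 //=;
  rewrite ?eqxx /=; lia.
Qed.

End Levels.

(** * The orbits of the level rule as bands *)

Section OrbitBands.
Variables (n : nat) (H : nat -> nat).
Hypotheses (H0 : H 0%N = 0%N) (Hn : forall e, (n <= e)%N -> H e = 0%N).

(** The valid states as a finite type, so that orbits can be formed. *)
Definition level_state := ({e : 'I_n & 'I_(H e)} * bool)%type.

Definition raw (y : level_state) : state := (y.2, val (tag y.1), val (tagged y.1)).

Lemma raw_valid y : valid H (raw y).
Proof. exact: (ltn_ord (tagged y.1)). Qed.

Lemma raw_inj : injective raw.
Proof.
move=> [[e j] d] [[e' j'] d'] /= [-> /val_inj ee]; case: e' / ee j' => j' /val_inj -> //.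
Qed.

Lemma raw_surj x : valid H x -> exists y, raw y = x.
Proof.
move=> vx; have /andP[_ en] := valid_edge H0 Hn vx.
case: x vx en => [[d e] j] /= vx en.
by exists (Tagged (fun e : 'I_n => 'I_(H e)) (Ordinal vx : 'I_(H (Ordinal en))), d).
Qed.

(** Found by search, which keeps proofs of validity out of the term; [raw_lnext] shows that the
    search succeeds. *)
Definition lnext (y : level_state) : level_state :=
  odflt y [pick y' | raw y' == snext H (raw y)].

Lemma raw_lnext y : raw (lnext y) = snext H (raw y).
Proof.
rewrite /lnext; case: pickP => [y' /eqP //|none].
have [y' e] := raw_surj (snext_valid H0 Hn (raw_valid y)).
by have := none y'; rewrite e eqxx.
Qed.

Lemma lnext_inj : injective lnext.
Proof.
move=> y y' e; apply: raw_inj.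
rewrite -(snextK H0 Hn (raw_valid y)) -(snextK H0 Hn (raw_valid y')).
by rewrite -!raw_lnext e.
Qed.

Lemma edge_subproof (y : level_state) : ((tag y.1).-1 < n.-1)%N.
Proof. by have := valid_edge H0 Hn (raw_valid y); rewrite /=; lia. Qed.

(** The direction equals the colour, so all orbit bands are positive and their parameters need no
    inversion. The edge [e] carries the arrows of index [e.-1]. *)
Definition slet (y : level_state) : letter n := ((Ordinal (edge_subproof y), y.2), y.2).

Lemma lsrc_slet y : lsrc (slet y) = svx (raw y) :> nat.
Proof.
have := valid_edge H0 Hn (raw_valid y); rewrite /lsrc /svx /=.
by case: (y.2) => //= /andP[/prednK].
Qed.

Lemma ltgt_slet y : ltgt (slet y) = svx (raw (lnext y)) :> nat.
Proof.
have := snext_step H0 Hn (raw_valid y); rewrite -raw_lnext.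
have := valid_edge H0 Hn (raw_valid y); rewrite /ltgt [svx (raw y)]/svx /=.
by case: (y.2) => /= [_ ->|_ ->].
Qed.

Lemma slet_raw y y' : slet y = slet y' -> (raw y).1 = (raw y').1.
Proof.
move=> /[dup] /(congr1 (fun x : letter n => val x.1.1)) /= e /(congr1 snd) /= d.
have := valid_edge H0 Hn (raw_valid y); have := valid_edge H0 Hn (raw_valid y').
rewrite /raw /= d => h1 h2; congr pair; lia.
Qed.

Lemma sorted_traject (T : Type) (R : rel T) (f : level_state -> T) m x :
  (forall y, R (f y) (f (lnext y))) -> sorted R [seq f y | y <- traject lnext x m].
Proof.
move=> Rf; case: m => // m; rewrite trajectS /=.
by elim: m x => //= m IH x; rewrite Rf IH.
Qed.

(** Since direction and colour agree in every letter, consecutive letters are neither inverse to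
    each other nor in a relation. *)
Lemma string_traject m x : string_walk [seq slet y | y <- traject lnext x m].
Proof.
apply/andP; split; apply: sorted_traject => y.
  by rewrite -(inj_eq val_inj) /= ltgt_slet lsrc_slet.
apply/andP; split.
  by rewrite /linv /slet !xpair_eqE /=; case: (y.2); case: ((lnext y).2); rewrite ?andbF.
rewrite /letters_in_R /in_R /=; case: (y.2); case: ((lnext y).2) => //=;
  by rewrite ?andbF ?orbF.
Qed.

Definition orbit_walk (x : level_state) : seq (letter n) := [seq slet y | y <- orbit lnext x].

Lemma size_orbit_walk x : size (orbit_walk x) = order lnext x.
Proof. by rewrite size_map size_orbit. Qed.

Lemma wpower_orbit m x :
  wpower m (orbit_walk x) = [seq slet y | y <- traject lnext x (m * order lnext x)].
Proof.
elim: m => [//|m IH]; rewrite /wpower /= -/(wpower m _) IH mulSn trajectD map_cat.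
by rewrite (iter_order lnext_inj).
Qed.

Lemma nth_orbit_walk x x0 i : (i < order lnext x)%N ->
  nth x0 (orbit_walk x) i = slet (iter i lnext x).
Proof. by move=> ix; rewrite (nth_map x) ?size_orbit // nth_traject. Qed.

Lemma below_trans x y z : below x y -> below y z -> below x z.
Proof.
case/andP=> /eqP e1 l1 /andP[/eqP e2 l2]; rewrite /below e1 e2 eqxx /=.
by move: l1 l2; rewrite e1 e2; case: ifP => _ a b; [exact: ltn_trans a b | exact: ltn_trans b a].
Qed.

(* Levels are strictly monotone along x, lnext^d x, lnext^2d x, ..., a closed sequence. *)
Lemma no_period_below x d m : (0 < m)%N -> iter (m * d) lnext x = x ->
  (forall i, (raw (iter (i + d) lnext x)).1 = (raw (iter i lnext x)).1) ->
  below (raw x) (raw (iter d lnext x)) = false /\ below (raw (iter d lnext x)) (raw x) = false.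
Proof.
move=> m0 per eq1.
have prop1 i : below (raw x) (raw (iter d lnext x)) ->
    below (raw (iter i lnext x)) (raw (iter (i + d) lnext x)).
  move=> b; elim: i => [//|i IH]; rewrite addSn !iterS !raw_lnext.
  apply: (below_next H0 Hn) => //; try exact: raw_valid.
  by rewrite -!raw_lnext -!iterS -addSn eq1.
have prop2 i : below (raw (iter d lnext x)) (raw x) ->
    below (raw (iter (i + d) lnext x)) (raw (iter i lnext x)).
  move=> b; elim: i => [//|i IH]; rewrite addSn !iterS !raw_lnext.
  apply: (below_next H0 Hn) => //; try exact: raw_valid.
  by rewrite -!raw_lnext -!iterS -addSn eq1.
have irr u : below u u = false by rewrite /below !ltnn if_same andbF.
split; apply/negP => b.
  suff : below (raw x) (raw (iter (m * d) lnext x)) by rewrite per irr.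
  case: (m) m0 => // q _; elim: q => [|q IH]; first by rewrite mul1n.
  by apply: below_trans IH _; rewrite [(q.+2 * d)%N]mulSn addnC prop1.
suff : below (raw (iter (m * d) lnext x)) (raw x) by rewrite per irr.
case: (m) m0 => // q _; elim: q => [|q IH]; first by rewrite mul1n.
by apply: below_trans IH; rewrite [(q.+2 * d)%N]mulSn addnC prop2.
Qed.

(** In a proper power, [x] and the state one factor later share edge and direction. By
    [no_period_below] they share the level too, so the orbit would close too early. *)
Lemma orbit_primitive x w m : (1 < m)%N -> orbit_walk x <> wpower m w.
Proof.
move=> m1 e; have sz : order lnext x = (m * size w)%N.
  by rewrite -size_orbit_walk e size_wpower.
have o0 := order_gt0 lnext x.
have d0 : (0 < size w)%N by move: o0; rewrite sz muln_gt0 => /andP[].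
pose d := size w; pose x0 := slet x.
have dn : (d < order lnext x)%N by rewrite sz -[X in (X < _)%N]mul1n ltn_pmul2r.
have letE i : slet (iter i lnext x) = nth x0 w (i %% d).
  have -> : iter i lnext x = iter (i %% order lnext x) lnext x.
    rewrite {1}(divn_eq i (order lnext x)) addnC iterD; congr (iter _ _ _).
    by elim: (i %/ _)%N => // q IH; rewrite mulSn iterD IH (iter_order lnext_inj).
  rewrite -(nth_orbit_walk x0) ?ltn_pmod // e nth_wpower -?sz ?ltn_pmod //.
  by rewrite sz modn_dvdm // dvdn_mull.
have eq1 i : (raw (iter (i + d) lnext x)).1 = (raw (iter i lnext x)).1.
  by apply: slet_raw; rewrite !letE modnDr.
have per : iter (m * d) lnext x = x by rewrite -sz (iter_order lnext_inj).
have [b1 b2] := no_period_below (ltnW m1) per eq1.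
have xE : raw (iter d lnext x) = raw x.
  have e1 : (raw (iter d lnext x)).1 = (raw x).1 := eq1 0%N.
  move: b1 b2; rewrite /below e1 eqxx.
  case: (raw x) (raw (iter d lnext x)) e1 => [[c a] j] [[c' a'] j'] /= [-> ->].
  by case: c => b1 b2; congr pair; lia.
have xE0 := raw_inj xE.
have : nth x (orbit lnext x) d = nth x (orbit lnext x) 0.
  by rewrite !nth_traject // xE0.
move/eqP; rewrite nth_uniq ?size_orbit ?orbit_uniq //; by rewrite /d; case: (size w) d0.
Qed.

Lemma orbit_band_walk x : band_walk (orbit_walk x).
Proof.
split.
- exact: string_traject.
- rewrite /orbit_walk /orbit -orderSpred /= last_map last_traject; apply: val_inj.
  by rewrite /= lsrc_slet ltgt_slet -iterS orderSpred (iter_order lnext_inj).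
- by move=> w m _ m1; apply: orbit_primitive.
- by move=> m; rewrite wpower_orbit; apply: string_traject.
Qed.

Definition orbit_band x : band n := Band (orbit_band_walk x).

Section Nodes.
Variable x : level_state.
Let z := orbit_band x.

Definition node_state (t : 'I_(size z)) : level_state := iter t lnext x.

Lemma blet_orbit t : blet t = slet (node_state t).
Proof.
rewrite /blet (tnth_nth (slet x)) /= nth_orbit_walk //.
by rewrite -size_orbit_walk; exact: (ltn_ord t).
Qed.

Lemma orbit_bpos : bpos z.
Proof. by rewrite /bpos /= /orbit_walk /orbit -orderSpred /= /lsign /= eqxx. Qed.

Lemma node_state_next t : node_state (bnx t) = lnext (node_state t).
Proof.
rewrite /bnx orbit_bpos /node_state /= -iterS.
have tz : (t < size z)%N := ltn_ord t.
have [h|h] := ltnP t.+1 (size z); first by rewrite modn_small.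
have -> : t.+1 = size z by apply/eqP; rewrite eqn_leq tz.
by rewrite modnn /= size_orbit_walk (iter_order lnext_inj).
Qed.

Lemma node_state_prev t : lnext (node_state (bpv t)) = node_state t.
Proof. by rewrite -node_state_next bpvK. Qed.

Lemma bdr_orbit t : bdr t = (raw (node_state t)).1.1.
Proof. by rewrite /bdr orbit_bpos blet_orbit. Qed.

Lemma bvx_orbit t : bvx t = svx (raw (node_state t)) :> nat.
Proof. by rewrite /bvx /bvertex blet_orbit lsrc_slet. Qed.

End Nodes.

(** Where the stretch begins, the strand coming from above is [below] the other one, by
    [below_meet], and remains so by [below_next]. At the end [below_down] makes it go down if the
    other does, contrary to a crossing. *)
Lemma orbit_uncrossed x y : bands_uncrossed (orbit_band x) (orbit_band y).
Proof.
move=> s s' l vs drs Ds Ds' Dl Dl'.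
have := below_meet H0 Hn (raw_valid (node_state (bpv s))) (raw_valid (node_state (bpv s'))).
rewrite -!raw_lnext !node_state_prev -!bdr_orbit => /(_ Ds Ds').
rewrite -!bvx_orbit vs => /(_ erefl) meet.
case: l => [|l] in drs Dl Dl' *.
  by move: meet; rewrite /= in Dl Dl'; rewrite Dl (negPf Dl').
have low m : (m <= l)%N -> below (raw (node_state (iter m (@bnx n _) s')))
                               (raw (node_state (iter m (@bnx n _) s))).
  elim: m => [_|m IH ml]; first by move: meet; have /= -> := drs 0%N isT; rewrite eqxx.
  rewrite !iterS !node_state_next !raw_lnext.
  apply: (below_next H0 Hn); try exact: raw_valid; first exact: IH (ltnW ml).
  by rewrite -!raw_lnext -!node_state_next -!bdr_orbit -!iterS drs.
have := below_down H0 (raw_valid _) (raw_valid _) (low l (leqnn l)).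
rewrite -!raw_lnext -!node_state_next -!bdr_orbit -!iterS Dl => /(_ isT).
by rewrite (negPf Dl').
Qed.

(** One band per cycle. Different cycles can give the same family, which accounts for the
    repetitions. *)
Definition level_bands (i : 'I_#|froots lnext|) : band n := orbit_band (enum_val i).

(** The nodes of the bands are in bijection with the states, and the descents from the vertex [j]
    are the alpha-states on the edge [j], one for each level. *)
Lemma level_bands_descents j :
  (\sum_i descents (@bvx n (level_bands i)) (@bdr n (level_bands i)) j)%N = H j.
Proof.
have csym := fconnect_sym lnext_inj.
rewrite -node_descents; pose io (t : node level_bands) := node_state (tagged t).
have root_enum (i : 'I_#|froots lnext|) : froot lnext (enum_val i) = enum_val i.
  by apply/eqP; exact: (enum_valP i).
have io_root (t : node level_bands) : froot lnext (io t) = enum_val (tag t).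
  by rewrite -[RHS]root_enum; apply/eqP; rewrite eq_sym (root_connect csym) fconnect_iter.
have io_inj : injective io.
  move=> [i t] [i' t'] e; have ii : i = i'.
    by apply: enum_val_inj; have := io_root (existT _ i t); rewrite e io_root => ->.
  case: i' / ii in t' e *; congr (Tagged _ _); apply: val_inj => /=.
  have tz (u : 'I_(size (level_bands i))) : (u < order lnext (enum_val i))%N.
    by rewrite -size_orbit_walk; exact: (ltn_ord u).
  move: e; rewrite /io /node_state /= => e; apply/eqP.
  rewrite -(nth_uniq (enum_val i) _ _ (orbit_uniq lnext (enum_val i))) ?size_orbit ?tz //.
  by rewrite !nth_traject ?tz // e.
have io_surj y : exists t, io t = y.
  have yr : froot lnext y \in froots lnext by exact: (roots_root csym).
  have cy : fconnect lnext (froot lnext y) y by rewrite csym connect_root.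
  have iE : enum_val (enum_rank_in yr (froot lnext y)) = froot lnext y by rewrite enum_rankK_in.
  have lt : (findex lnext (froot lnext y) y < size (level_bands (enum_rank_in yr (froot lnext y))))%N.
    by rewrite /= size_orbit_walk iE findex_max.
  exists (Tagged (fun i => 'I_(size (level_bands i))) (Ordinal lt)).
  by rewrite /io /node_state /= iE iter_findex.
rewrite /descents -(card_image io_inj).
transitivity #|[pred y : level_state | y.2 && (tag y.1 == j :> nat)]|.
  apply: eq_card => y; have [t <-] := io_surj y.
  rewrite mem_image // !inE /ndr /nvx bdr_orbit bvx_orbit /svx.
  by case: t => i t; rewrite /io /=; case: (_.2).
transitivity #|[pred p : {e : 'I_n & 'I_(H e)} | tag p == j :> nat]|.
  have pi : injective (fun p : {e : 'I_n & 'I_(H e)} => (p, true)) by move=> p p' [].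
  rewrite -(card_image pi); apply: eq_card => -[p d]; rewrite !inE /=.
  case: d; first by rewrite (mem_image pi).
  by apply/esym/imageP => -[].
case: (ltnP j n) => jn; last first.
  by rewrite (Hn jn); apply: eq_card0 => -[e u]; rewrite !inE /= ltn_eqF // (leq_trans (ltn_ord e)).
by rewrite -[RHS](card_tag (fun e : 'I_n => H e) (Ordinal jn)); apply: eq_card.
Qed.

End OrbitBands.

(** * The generic decomposition *)

(** Euclid's argument: adding one to the product of the [X - a], for [a] zero or already found,
    gives a polynomial all of whose roots are new. *)
Lemma distinct_nonzero (k : closedFieldType) r :
  exists la : 'I_r -> k, torus la /\ injective la.
Proof.
have [s [ss us s0]] : exists s : seq k, [/\ size s = r, uniq s & 0 \notin s].
  elim: r => [|r [s [ss us s0]]]; first by exists [::].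
  pose p := \prod_(a <- 0 :: s) ('X - a%:P) + 1.
  have [x px] : exists x, root p x.
    apply/closed_rootP; rewrite /p size_polyDl ?size_prod_XsubC //.
    by rewrite size_poly1.
  have : x \notin 0 :: s.
    apply: contraL px => xs; rewrite /root /p hornerD hornerE.
    have -> : (\prod_(a <- 0 :: s) ('X - a%:P)).[x] = 0.
      by apply/eqP; rewrite -[_ == 0]/(root _ _) root_prod_XsubC.
    by rewrite add0r oner_eq0.
  rewrite inE negb_or => /andP[x0 xs]; exists (x :: s).
  by rewrite /= ss us xs inE negb_or eq_sym x0 s0.
exists (fun i => nth 0 s i); split=> [i|i j /eqP].
  by apply: contraNneq s0 => <-; rewrite mem_nth // ss.
by rewrite nth_uniq ?ss // => /eqP/val_inj.
Qed.

(** The product of all differences vanishes exactly at the tuples with a repetition, so distinct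
    parameters form a non-empty open set. *)
Lemma generically_injective (k : closedFieldType) r (Pr : ('I_r -> k) -> Prop) :
  (forall la, torus la -> injective la -> Pr la) -> generically Pr.
Proof.
move=> H; pose p : {mpoly k[r]} := \prod_i \prod_(j | j != i) ('X_i - 'X_j).
have pE la : p.@[la] = \prod_i \prod_(j | j != i) (la i - la j).
  rewrite /p (big_morph _ (mevalM la) (meval1 la)); apply: eq_bigr => i _.
  rewrite (big_morph _ (mevalM la) (meval1 la)); apply: eq_bigr => j _.
  by rewrite mevalB !mevalXU.
have pn0 la : p.@[la] != 0 <-> injective la.
  rewrite pE; split=> [/prodf_neq0 h i j e|inj].
    apply/eqP; apply: contraT => ij; have /prodf_neq0 /(_ i) := h j isT.
    by rewrite ij => /(_ isT); rewrite e subrr eqxx.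
  apply/prodf_neq0 => i _; apply/prodf_neq0 => j ji; rewrite subr_eq0.
  by apply: contraNneq ji => /inj ->.
exists (fun la => torus la /\ injective la); split.
- exists (fun q => q = p) => la; split=> [[t inj]|[t [q -> /pn0 inj]]]; split=> //.
  by exists p => //; apply/pn0.
- exact: distinct_nonzero.
- by move=> la [t inj]; apply: H.
Qed.

Section Main.
Variables (k : closedFieldType) (n : nat) (g : 'I_n -> int).

Definition dominated : Prop :=
  (forall l : nat, (1 <= l <= n.-1)%N -> \sum_(i < n | (i < l)%N) g i <= 0) /\
  \sum_(i < n) g i = 0.

Lemma semibrick_dominated (X : lmodule k n) :
  band_semibrick X -> gvector X g -> dominated.
Proof.
move=> /semibrick_has_strand[a Ha] gX; have S := gvector_partial_sums Ha gX.
split=> [l /andP[_ ln]|]; first by rewrite S ?oppr_le0 // (leq_trans ln) ?leq_pred.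
have := S n (leqnn n); rewrite (has_strand_ends Ha).2 oppr0 => S0.
by rewrite -[RHS]S0; apply: eq_bigl => i; rewrite ltn_ord.
Qed.

(** Minus a partial sum, that is, the prescribed number of descents; [absz] lands in the natural
    numbers and [depthE] restores the sign. *)
Definition depth (e : nat) : nat := absz (\sum_(i < n | (i < e)%N) g i).

Hypothesis dom : dominated.

Lemma depth0 : depth 0 = 0%N.
Proof. by rewrite /depth big_pred0. Qed.

Lemma depth_ge e : (n <= e)%N -> depth e = 0%N.
Proof.
move=> ne; rewrite /depth (eq_bigl predT) ?dom.2 // => i.
by rewrite (leq_trans (ltn_ord i)).
Qed.

Lemma depthE e : (depth e)%:Z = - \sum_(i < n | (i < e)%N) g i.
Proof.
rewrite /depth lez0_abs //; case: (posnP e) => [->|e0]; first by rewrite big_pred0.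
case: (ltnP e n) => en; first by apply: dom.1; rewrite e0 /=; lia.
by rewrite (eq_bigl predT) ?dom.2 // => i; rewrite (leq_trans (ltn_ord i)).
Qed.

Lemma depth_step (i : 'I_n) : g i = (depth i)%:Z - (depth i.+1)%:Z.
Proof.
rewrite !depthE opprK addrC [X in X - _](bigD1 i) //= -addrA -[LHS]addr0.
congr (_ + _); apply/esym/eqP; rewrite subr_eq0; apply/eqP; apply: eq_bigl => j.
by rewrite ltnS [RHS]ltn_neqAle andbC.
Qed.

Let F := level_bands depth0 depth_ge.

Lemma level_bands_generic : generic_decomposition k g F.
Proof.
split=> [i la la0|].
  by apply: band_module_is_brick => //; exact: orbit_uncrossed.
apply: generically_injective => la la0 inj /=; split.
  eexists _, _; split; last exact: iso_refl.
  - move=> i; split; first by apply: band_module_is_brick => //; exact: orbit_uncrossed.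
    by exists (F i), 1%N, (la i); split=> //; exact: iso_refl.
  - move=> i j ij f hf; apply: band_hom_eq0 hf => //; try exact: orbit_bpos.
      by apply: contra_neq ij; exact: inj.
    exact: orbit_uncrossed.
apply/(has_strand_gvector g (has_strand_sum (fun i => band_has_strand (F i) (la0 i)))) => i.
by rewrite !level_bands_descents depth_step.
Qed.

(** One point of the open set suffices, since the conclusions concern the bands alone and not the
    parameters. *)
Lemma generic_descents r (F' : 'I_r -> band n) : generic_decomposition k g F' ->
  (forall i j, bands_uncrossed (F' i) (F' j)) /\
  forall j, (\sum_i descents (@bvx n (F' i)) (@bdr n (F' i)) j)%N = depth j.
Proof.
case=> Fb [U [[S SU] [la Ula] UP]].
have la0 : torus la by have [] := (SU la).1 Ula.
have [sb gX] := UP la Ula; split; first exact: semibrick_uncrossed Fb la0 sb.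
move=> j; have Ha := has_strand_sum (fun i => band_has_strand (F' i) (la0 i)).
case: (leqP j n) => jn.
  have := gvector_partial_sums Ha gX jn; rewrite -[LHS]opprK -depthE.
  by move/oppr_inj => [->].
rewrite depth_ge 1?ltnW // big1 // => i _; apply: eq_card0 => t.
by rewrite !inE ltn_eqF ?andbF // (leq_trans (ltn_ord _)) // ltnW.
Qed.

Lemma level_bands_unique r (F' : 'I_r -> band n) : generic_decomposition k g F' ->
  exists2 sigma : 'I_r -> 'I_#|froots (@lnext n depth)|, bijective sigma &
    forall i, same_family k (F' i) (F (sigma i)).
Proof.
move=> /generic_descents[uF' dF'].
apply: families_determined => // [i j|j]; first exact: orbit_uncrossed.
by rewrite dF' level_bands_descents.
Qed.

End Main.

Theorem corollary4p11 (k : closedFieldType) (n : nat) (hn : (1 <= n)%N)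
    (g : 'I_n -> int) :
  ((exists X : lmodule k n, band_semibrick X /\ gvector X g) <->
   (forall l : nat, (1 <= l <= n.-1)%N -> \sum_(i < n | (i < l)%N) g i <= 0) /\
   \sum_(i < n) g i = 0) /\
  ((forall l : nat, (1 <= l <= n.-1)%N -> \sum_(i < n | (i < l)%N) g i <= 0) /\
   \sum_(i < n) g i = 0 ->
   exists (r : nat) (F : 'I_r -> band n),
     generic_decomposition k g F /\
     (forall (r' : nat) (F' : 'I_r' -> band n),
        generic_decomposition k g F' ->
        exists2 sigma : 'I_r' -> 'I_r, bijective sigma &
          forall i, same_family k (F' i) (F (sigma i)))).
Proof.
split; first split=> [[X [sX gX]]|dom]; first exact: semibrick_dominated sX gX.
  have [_ [U [_ [la Ula] UP]]] := level_bands_generic k dom.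
  by eexists; exact: UP Ula.
move=> dom; eexists _, _; split; first exact: (level_bands_generic k dom).
by move=> r' F' GF; exact: (level_bands_unique dom GF).
Qed.
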